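(* Let $T_1=\widetilde T^*$ and $\widetilde T_1=T^*$ as in the context. Then $$\dim\ker T_1=n_a^++n_b^-\qquad\text{and}\qquad \dim\ker\widetilde T_1=n_a^-+n_b^+,$$ where for $x\in\{a,b\}$, $n_x^+$ and $n_x^-$ denote the number of positive and negative eigenvalues (counted with multiplicity) of the Hermitian matrix $\mathbf{A}(x)$.
   Context: Let $a<b$ real, $r\in\mathbb{N}$; $\mathbf{A}\in W^{1,\infty}((a,b);\mathbb{C}^{r\times r})$ (identified with its Lipschitz representative on $[a,b]$) with $\mathbf{A}(x)$ Hermitian; $\mathbf{B}\in L^\infty((a,b);\mathbb{C}^{r\times r})$, and suppose there exists $\mu_0>0$ with $\mathbf{B}+\mathbf{B}^*+\mathbf{A}'\ge2\mu_0\mathbb{1}$ a.e. on $(a,b)$. Let $\mathcal{H}=L^2((a,b);\mathbb{C}^r)$ and define $T,\widetilde T:C_c^\infty((a,b);\mathbb{C}^r)\to\mathcal{H}$ by $T\mathsf{u}=(\mathbf{A}\mathsf{u})'+\mathbf{B}\mathsf{u}$ and $\widetilde T\mathsf{u}=-(\mathbf{A}\mathsf{u})'+(\mathbf{B}^*+\mathbf{A}')\mathsf{u}$. $T_1:=\widetilde T^*$ and $\widetilde T_1:=T^*$ are the Hilbert space adjoints; their common domain is $\mathcal{W}=\{\mathsf{u}\in\mathcal{H}:(\mathbf{A}\mathsf{u})'\in\mathcal{H}\}$ (distributional derivative), with $T_1\mathsf{u}=(\mathbf{A}\mathsf{u})'+\mathbf{B}\mathsf{u}$ and $\widetilde T_1\mathsf{u}=-(\mathbf{A}\mathsf{u})'+(\mathbf{B}^*+\mathbf{A}')\mathsf{u}$.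 *)

(* Defs.v *)
From mathcomp Require Import all_boot all_order all_algebra.
From mathcomp Require Import all_classical all_reals all_analysis.
From mathcomp Require Import complex.
Import Order.TTheory GRing.Theory Num.Theory.

Set Implicit Arguments.
Unset Strict Implicit.
Unset Printing Implicit Defensive.

Local Open Scope ring_scope.
Local Open Scope classical_set_scope.

Section Defs.
Variable R : realType.
Local Notation C := R[i].
Local Notation leb := (@lebesgue_measure R).

Definition ctr {m n : nat} (M : 'M[C]_(m, n)) : 'M[C]_(n, m) :=
  map_mx Num.conj (M^T).

Definition sqnormv {r : nat} (v : 'cV[C]_r) : R :=
  \sum_(i < r) (complex.Re (v i 0) ^+ 2 + complex.Im (v i 0) ^+ 2).

Definition cmeasurable (a b : R) (f : R -> C) : Prop :=
  measurable_fun `]a, b[ (fun x => complex.Re (f x)) /\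
  measurable_fun `]a, b[ (fun x => complex.Im (f x)).

Definition L2on (a b : R) {r : nat} (u : R -> 'cV[C]_r) : Prop :=
  (forall i : 'I_r, cmeasurable a b (fun x => u x i 0)) /\
  (\int[leb]_(x in `]a, b[) (sqnormv (u x))%:E < +oo)%E.

Definition smooth (phi : R -> R) : Prop :=
  forall (n : nat) (x : R), derivable (derive1n n phi) x 1.

Definition test_fun (a b : R) (phi : R -> R) : Prop :=
  smooth phi /\
  exists c d : R, a < c /\ d < b /\ (forall x, (x < c \/ d < x) -> phi x = 0).

Definition rweak_deriv (a b : R) (f g : R -> R) : Prop :=
  forall phi, test_fun a b phi ->
    (\int[leb]_(x in `]a, b[) (f x * derive1 phi x)%:E
      = - \int[leb]_(x in `]a, b[) (g x * phi x)%:E)%E.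

Definition weak_deriv (a b : R) {r : nat} (f g : R -> 'cV[C]_r) : Prop :=
  forall i : 'I_r,
    rweak_deriv a b (fun x => complex.Re (f x i 0)) (fun x => complex.Re (g x i 0)) /\
    rweak_deriv a b (fun x => complex.Im (f x i 0)) (fun x => complex.Im (g x i 0)).

Definition mderiv {r : nat} (A : R -> 'M[C]_r) (x : R) : 'M[C]_r :=
  \matrix_(i, j) Complex (derive1 (fun t => complex.Re (A t i j)) x)
                         (derive1 (fun t => complex.Im (A t i j)) x).

Definition ker_T1 (a b : R) {r : nat} (A B : R -> 'M[C]_r)
  (u : R -> 'cV[C]_r) : Prop :=
  L2on a b u /\
  exists g : R -> 'cV[C]_r, L2on a b g /\
    weak_deriv a b (fun x => A x *m u x) g /\
    {ae leb, forall x, `]a, b[ x -> g x + B x *m u x = 0}.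

Definition ker_T1t (a b : R) {r : nat} (A B : R -> 'M[C]_r)
  (u : R -> 'cV[C]_r) : Prop :=
  L2on a b u /\
  exists g : R -> 'cV[C]_r, L2on a b g /\
    weak_deriv a b (fun x => A x *m u x) g /\
    {ae leb, forall x, `]a, b[ x -> - g x + (ctr (B x) + mderiv A x) *m u x = 0}.

Definition dim_ae (a b : R) {r : nat} (P : (R -> 'cV[C]_r) -> Prop) (k : nat)
  : Prop :=
  exists e : 'I_k -> R -> 'cV[C]_r,
    (forall j, P (e j)) /\
    (forall c : 'I_k -> C,
        {ae leb, forall x, `]a, b[ x -> \sum_(j < k) c j *: e j x = 0} ->
        forall j, c j = 0) /\
    (forall u, P u -> exists c : 'I_k -> C,
        {ae leb, forall x, `]a, b[ x -> u x = \sum_(j < k) c j *: e j x}).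

(* the eigenvalues of a square complex matrix, listed with (algebraic)
   multiplicity: the roots of its characteristic polynomial *)
Definition eigvals {r : nat} (M : 'M[C]_r) : seq C :=
  proj1_sig (closed_field_poly_normal (char_poly M)).

Definition npos {r : nat} (M : 'M[C]_r) : nat := count (fun z => 0 < z) (eigvals M).
Definition nneg {r : nat} (M : 'M[C]_r) : nat := count (fun z => z < 0) (eigvals M).

End Defs.

(* Main.v *)
(* Write F = A u for u in ker T_1, so that F is absolutely continuous with
   F' = -B u.  Multiplying by u gives the energy identity
     (u . F)' = - u . (B + B^* + A') u <= - 2 mu0 |u|^2   a.e.,
   whose justification only uses Steklov averages, since u itself need not be
   continuous where A degenerates.  At an end point e one has F(e) = A(e) xi for
   some xi: a component of F(e) along ker A(e) would make |u| grow like 1/|x - e|,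
   which is not square integrable.  Hence u . F has the end value xi . A(e) xi, and
   2 mu0 |u|^2 <= xi_a . A(a) xi_a - xi_b . A(b) xi_b: an element of the kernel is
   determined by the components of F(a) along the positive eigenvectors of A(a)
   and those of F(b) along the negative eigenvectors of A(b).  Conversely these
   components can be prescribed: the boundary value problem is solved weakly by
   minimising |T~ v|^2 / 2 - l(v) over C^1 functions v whose end values lie in
   subspaces where A(a) is >= 0 and A(b) is <= 0, the energy inequality for v
   giving coercivity.  The second formula is the first one for -A and B^* + A'.
   Complex vectors are handled through their real and imaginary parts. *)
Require Import Defs.
From mathcomp Require Import all_boot all_order all_algebra.
From mathcomp Require Import all_classical all_reals all_analysis.
From mathcomp Require Import measurable_realfun complex ring lra.
Import Order.TTheory GRing.Theory Num.Theory numFieldNormedType.Exports.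
Local Open Scope ring_scope.
Local Open Scope classical_set_scope.

Set Implicit Arguments.
Unset Strict Implicit.
Unset Printing Implicit Defensive.

(* [R] carries two syntactically different (but convertible) Borel structures;
   the one of [measurableTypeR R] is the one on which the Lebesgue measure lives. *)
Notation mbl D := (measurable (D : set (measurableTypeR _))).
Notation mblfun D f := (measurable_fun (D : set (measurableTypeR _)) f).

(** The energy identity rests on an exact discrete product rule: for q = u . F with A symmetric, q(x
    + h) - q(x) is a combination of increments of F and of A alone, so that translations of u, which
    are continuous in L^2, are all that is asked of u. Since A may degenerate anywhere, the equation
    cannot be solved for u', and existence has to be weak. The test functions obey the adjoint
    boundary conditions: their end values lie in maximal subspaces of the required sign, large
    enough to contain the eigenvectors along which the end values of F are to be prescribed. The
    data enter through an affine lifting h; the solution is h - w, where w is the L^2 limit of T~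
    v_n along a minimising sequence, and no limit of v_n itself is taken. The same variational lemma
    produces the a.e. derivative of a Lipschitz coefficient, as the Riesz representative of v |-> -
    int f v'. The dimension is then read off a coordinate system: existence yields a dual family for
    the chosen components of F(a) and F(b), uniqueness shows that the family spans. *)

Definition L1 {R : realType} (D : set R) (f : R -> R) : Prop :=
  (@lebesgue_measure R).-integrable D (EFin \o f).

Definition L2 {R : realType} (D : set R) (f : R -> R) : Prop :=
  mblfun D f /\ L1 D (fun x => f x ^+ 2).

(** * Almost-everywhere reasoning *)

Section AE.
Context {R : realType}.
Local Notation mu := (@lebesgue_measure R).

Lemma aeT (P : R -> Prop) : (forall x, P x) -> {ae mu, forall x, P x}.
Proof. by move=> h; apply: aeW. Qed.

Lemma aeS (P Q : R -> Prop) : (forall x, P x -> Q x) ->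
  {ae mu, forall x, P x} -> {ae mu, forall x, Q x}.
Proof. by move=> PQ; apply: (@filterS _ _ (ae_filter_ringOfSetsType mu)). Qed.

Lemma aeS2 (P Q S : R -> Prop) : (forall x, P x -> Q x -> S x) ->
  {ae mu, forall x, P x} -> {ae mu, forall x, Q x} -> {ae mu, forall x, S x}.
Proof. by move=> PQ; apply: (@filterS2 _ _ (ae_filter_ringOfSetsType mu)). Qed.

Lemma ae_all (I : finType) (P : I -> R -> Prop) :
  (forall i, {ae mu, forall x, P i x}) -> {ae mu, forall x, forall i, P i x}.
Proof. by move=> h; apply: (@filter_forall _ _ _ _ (ae_filter_ringOfSetsType mu)). Qed.

End AE.

(** * Integrable and square-integrable real functions *)

Section L1L2.
Context {R : realType}.
Local Notation mu := (@lebesgue_measure R).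
Variable D : set R.
Hypothesis mD : mbl D.
Implicit Types f g : R -> R.

Lemma L1_meas f : L1 D f -> mblfun D f.
Proof. by move=> /integrableP[/measurable_EFinP]. Qed.

Lemma L1_ae f g : L1 D f -> mblfun D g ->
  {ae mu, forall x, D x -> f x = g x} -> L1 D g.
Proof.
move=> Lf mg fg; apply/integrableP; split; first exact/measurable_EFinP.
have mf := L1_meas Lf; move/integrableP : Lf => [_]; apply: le_lt_trans.
rewrite le_eqVlt; apply/orP; left; apply/eqP/ae_eq_integral => //.
- by apply: measurableT_comp => //; exact/measurable_EFinP.
- by apply: measurableT_comp => //; exact/measurable_EFinP.
- by apply: (aeS _ fg) => x {}fg Dx /=; rewrite fg.
Qed.

Lemma L1_dom f g : mblfun D f -> L1 D g ->
  {ae mu, forall x, D x -> `|f x| <= g x} -> L1 D f.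
Proof.
move=> mf Lg fg; apply/integrableP; split; first exact/measurable_EFinP.
have mg := L1_meas Lg; move/integrableP : Lg => [_]; apply: le_lt_trans.
apply: ae_ge0_le_integral => //.
- by apply: measurableT_comp => //; exact/measurable_EFinP.
- by apply: measurableT_comp => //; exact/measurable_EFinP.
- by apply: (aeS _ fg) => x {}fg Dx /=; rewrite lee_fin (le_trans (fg Dx))// ler_norm.
Qed.

Lemma L1D f g : L1 D f -> L1 D g -> L1 D (fun x => f x + g x).
Proof. by move=> Lf Lg; exact: (integrableD mD Lf Lg). Qed.

Lemma L1B f g : L1 D f -> L1 D g -> L1 D (fun x => f x - g x).
Proof. by move=> Lf Lg; exact: (integrableB mD Lf Lg). Qed.

Lemma L1Z k f : L1 D f -> L1 D (fun x => k * f x).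
Proof. by move=> Lf; exact: (integrableZl mD k Lf). Qed.

Lemma L1N f : L1 D f -> L1 D (fun x => - f x).
Proof. by move=> Lf; exact: (integrableN Lf). Qed.

Lemma L1_norm f : L1 D f -> L1 D (fun x => `|f x|).
Proof. by move=> Lf; exact: (integrable_norm Lf). Qed.

Lemma L1_0 : L1 D (fun=> 0).
Proof. exact: integrable0. Qed.

Lemma L1_sum (I : Type) (s : seq I) (P : pred I) (f : I -> R -> R) :
  (forall i, P i -> L1 D (f i)) -> L1 D (fun x => \sum_(i <- s | P i) f i x).
Proof.
move=> Lf; elim: s => [|i s IH].
  by under eq_fun do rewrite big_nil; exact: L1_0.
under eq_fun do rewrite big_cons.
by have [Pi|_] := boolP (P i); [apply: L1D => //; exact: Lf|].
Qed.

Lemma L1_bdd M f g : L1 D f -> mblfun D g ->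
  {ae mu, forall x, D x -> `|g x| <= M} -> L1 D (fun x => g x * f x).
Proof.
move=> Lf mg gM; apply: (@L1_dom _ (fun x => M * `|f x|)).
- by apply: measurable_funM => //; exact: L1_meas.
- exact/L1Z/L1_norm.
- by apply: (aeS _ gM) => x {}gM Dx; rewrite normrM ler_wpM2r// gM.
Qed.

Lemma L1_cst k : (mu D < +oo)%E -> L1 D (fun=> k).
Proof.
move=> Df; apply: measurable_bounded_integrable => //.
by exists `|k|; split; rewrite ?num_real// => M kM x _; rewrite ltW.
Qed.

Lemma Rint_ae f g : mblfun D f -> mblfun D g ->
  {ae mu, forall x, D x -> f x = g x} ->
  \int[mu]_(x in D) f x = \int[mu]_(x in D) g x.
Proof.
move=> mf mg fg; congr fine; apply: ae_eq_integral => //.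
- exact/measurable_EFinP.
- exact/measurable_EFinP.
- by apply: (aeS _ fg) => x {}fg Dx /=; rewrite fg.
Qed.

Lemma EFin_Rint f : L1 D f ->
  (\int[mu]_(x in D) f x)%:E = (\int[mu]_(x in D) (f x)%:E)%E.
Proof. by move=> Lf; rewrite /Rintegral fineK// (integrable_fin_num mD Lf). Qed.

Lemma Rint_ae_ge0 f : mblfun D f ->
  {ae mu, forall x, D x -> 0 <= f x} -> 0 <= \int[mu]_(x in D) f x.
Proof.
move=> mf f0; rewrite (@Rint_ae _ (fun x => `|f x|))//.
- exact: Rintegral_ge0.
- exact: measurableT_comp.
- by apply: (aeS _ f0) => x {}f0 Dx; rewrite ger0_norm// f0.
Qed.

Lemma Rint_ae_le f g : L1 D f -> L1 D g ->
  {ae mu, forall x, D x -> f x <= g x} ->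
  \int[mu]_(x in D) f x <= \int[mu]_(x in D) g x.
Proof.
move=> Lf Lg fg; rewrite -subr_ge0 -RintegralB//; apply: Rint_ae_ge0.
- by apply: measurable_funB; exact: L1_meas.
- by apply: (aeS _ fg) => x {}fg Dx; rewrite subr_ge0 fg.
Qed.

Lemma Rint_eq0 f : L1 D f -> {ae mu, forall x, D x -> 0 <= f x} ->
  \int[mu]_(x in D) f x <= 0 -> {ae mu, forall x, D x -> f x = 0}.
Proof.
move=> Lf f0 I0; have mf := L1_meas Lf.
have : (\int[mu]_(x in D) `|(f x)%:E| = 0)%E.
  rewrite -[LHS]/(\int[mu]_(x in D) (`|f x|)%:E)%E -EFin_Rint; last exact: L1_norm.
  rewrite -(@Rint_ae f)//.
  - by congr EFin; apply/eqP; rewrite eq_le I0 Rint_ae_ge0.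
  - exact: measurableT_comp.
  - by apply: (aeS _ f0) => x {}f0 Dx; rewrite ger0_norm// f0.
move=> I; apply: (aeS _ ((ae_eq_integral_abs mu mD ((measurable_EFinP _ _).2 mf)).1 I)).
by move=> x + Dx => /(_ Dx)[].
Qed.

Lemma Rint_sum (I : Type) (s : seq I) (P : pred I) (f : I -> R -> R) :
  (forall i, P i -> L1 D (f i)) ->
  \int[mu]_(x in D) (\sum_(i <- s | P i) f i x) =
  \sum_(i <- s | P i) \int[mu]_(x in D) f i x.
Proof.
move=> Lf; elim: s => [|i s IH].
  by under eq_Rintegral do rewrite big_nil; rewrite big_nil Rintegral_cst// mul0r.
under eq_Rintegral do rewrite big_cons.
rewrite big_cons; have [Pi|_] := boolP (P i); last by [].
by rewrite RintegralD//; [rewrite IH|exact: Lf|exact: L1_sum].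
Qed.

Lemma L2_meas f : L2 D f -> mblfun D f. Proof. by case. Qed.

Lemma L2_ae f g : L2 D f -> mblfun D g ->
  {ae mu, forall x, D x -> f x = g x} -> L2 D g.
Proof.
move=> [mf Lf] mg fg; split=> //; apply: (L1_ae Lf).
- exact: measurable_funX.
- by apply: (aeS _ fg) => x {}fg Dx; rewrite fg.
Qed.

Lemma L2M f g : L2 D f -> L2 D g -> L1 D (fun x => f x * g x).
Proof.
move=> [mf Lf] [mg Lg]; apply: (@L1_dom _ (fun x => f x ^+ 2 + g x ^+ 2)).
- exact: measurable_funM.
- exact: L1D.
- by apply: aeW => x _; rewrite normrM -(real_normK (num_real (f x))) -(real_normK (num_real (g x))); nra.
Qed.

Lemma L2D f g : L2 D f -> L2 D g -> L2 D (fun x => f x + g x).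
Proof.
move=> Lf Lg; have Lfg := L2M Lf Lg; case: Lf Lg => mf Lf [mg Lg].
split; first exact: measurable_funD.
have := L1D (L1D Lf Lg) (L1Z 2 Lfg); congr L1.
by apply/funext => x; ring.
Qed.

Lemma L2Z k f : L2 D f -> L2 D (fun x => k * f x).
Proof.
move=> [mf Lf]; split; first exact: measurable_funM.
by have := L1Z (k ^+ 2) Lf; congr L1; apply/funext => x; ring.
Qed.

Lemma L2N f : L2 D f -> L2 D (fun x => - f x).
Proof. by move=> /(L2Z (-1)); congr L2; apply/funext => x; ring. Qed.

Lemma L2B f g : L2 D f -> L2 D g -> L2 D (fun x => f x - g x).
Proof. by move=> Lf /L2N; exact: L2D. Qed.

Lemma L2_0 : L2 D (fun=> 0).
Proof.
by split=> //; rewrite [X in L1 _ X](_ : _ = fun=> 0)//;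
  [exact: L1_0|apply/funext => x; ring].
Qed.

Lemma L2_sum (I : Type) (s : seq I) (P : pred I) (f : I -> R -> R) :
  (forall i, P i -> L2 D (f i)) -> L2 D (fun x => \sum_(i <- s | P i) f i x).
Proof.
move=> Lf; elim: s => [|i s IH].
  by under eq_fun do rewrite big_nil; exact: L2_0.
under eq_fun do rewrite big_cons.
by have [Pi|_] := boolP (P i); [apply: L2D => //; exact: Lf|].
Qed.

Lemma L2_bdd M f g : L2 D f -> mblfun D g ->
  {ae mu, forall x, D x -> `|g x| <= M} -> L2 D (fun x => g x * f x).
Proof.
move=> [mf Lf] mg gM; split; first exact: measurable_funM.
have := @L1_bdd (M ^+ 2) (fun x => f x ^+ 2) (fun x => g x ^+ 2) Lf.
rewrite (_ : (fun x => (g x * f x) ^+ 2) = fun x => g x ^+ 2 * f x ^+ 2); last first.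
  by apply/funext => x; ring.
apply; first exact: measurable_funX.
apply: (aeS _ gM) => x {}gM Dx; rewrite normrX lerXn2r ?nnegrE ?gM//.
by apply: le_trans (gM Dx).
Qed.

Lemma L2_L1 f : (mu D < +oo)%E -> L2 D f -> L1 D f.
Proof.
move=> Df [mf Lf]; apply: (L1_dom mf (L1D (L1_cst 1 Df) Lf)).
by apply: aeW => x _; rewrite -(real_normK (num_real (f x))); nra.
Qed.

Lemma L2_bounded M f : (mu D < +oo)%E -> mblfun D f ->
  {ae mu, forall x, D x -> `|f x| <= M} -> L2 D f.
Proof.
move=> Df mf fM; split=> //; apply: (L1_dom _ (L1_cst (M ^+ 2) Df)).
- exact: measurable_funX.
apply: (aeS _ fM) => x {}fM Dx; rewrite normrX lerXn2r ?nnegrE ?fM//.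
by apply: le_trans (fM Dx).
Qed.

End L1L2.

Lemma L1S {R : realType} (D E : set R) (f : R -> R) : mbl E -> mbl D -> D `<=` E ->
  L1 E f -> L1 D f.
Proof. by move=> mE mD DE; exact: integrableS. Qed.

Lemma L2S {R : realType} (D E : set R) (f : R -> R) : mbl E -> mbl D -> D `<=` E ->
  L2 E f -> L2 D f.
Proof.
by move=> mE mD DE [mf Lf]; split; [exact: measurable_funS DE mf|exact: L1S Lf].
Qed.

(** The derivative is carried as data and lives on the whole line: no one-sided derivatives occur at
    the end points, and the pairs (v, v') are the points over which the variational problems below
    minimise. *)
Definition C1 {R : realType} (v dv : R -> R) : Prop :=
  (forall x, is_derive x (1 : R) v (dv x)) /\ continuous dv.

(** * Integrals over open intervals, continuous functions, density in L^1 *)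

Section Intervals.
Context {R : realType}.
Local Notation mu := (@lebesgue_measure R).
Implicit Types (a b c x y : R) (f g v dv : R -> R).

Lemma moo a b : mbl `]a, b[. Proof. exact: measurable_itv. Qed.
Hint Resolve moo : core.

Lemma muoo a b : (mu `]a, b[ < +oo)%E.
Proof. by rewrite lebesgue_measure_itv/=; case: ifPn => // _; rewrite -EFinD ltry. Qed.
Hint Resolve muoo : core.

Lemma muooE a b : a <= b -> fine (mu `]a, b[) = b - a.
Proof.
rewrite le_eqVlt => /orP[/eqP->|ab]; rewrite lebesgue_measure_itv/= lte_fin ?ab//.
by rewrite ltxx subrr.
Qed.

Lemma cont_mblfun (D : set R) f : mbl D -> continuous f -> mblfun D f.
Proof.
by move=> mD cf; apply: measurable_funTS; exact: continuous_measurable_fun.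
Qed.

Lemma cont_bdd a b f : continuous f ->
  exists2 M, 0 <= M & forall x, a <= x <= b -> `|f x| <= M.
Proof.
move=> cf; have [M [_ hM]] : bounded_set (f @` `[a, b]).
  apply: compact_bounded; apply: continuous_compact; last exact: segment_compact.
  exact: continuous_subspaceT.
exists (`|M| + 1); first by rewrite addr_ge0.
move=> x xab; apply: hM; first by rewrite ltr_pwDr// ler_norm.
by exists x => //=; rewrite in_itv.
Qed.

Lemma cont_bdd_ae a b f : continuous f ->
  exists2 M, 0 <= M & {ae mu, forall x, `]a, b[ x -> `|f x| <= M}.
Proof.
move=> /(cont_bdd a b)[M M0 h]; exists M => //; apply: aeW => x /=.
by rewrite in_itv/= => /andP[/ltW ax /ltW xb]; apply: h; rewrite ax.
Qed.

Lemma cont_L2 a b f : continuous f -> L2 `]a, b[ f.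
Proof.
move=> cf; have [M _ h] := cont_bdd_ae a b cf.
by apply: L2_bounded h => //; exact: cont_mblfun.
Qed.

Lemma cont_L1 a b f : continuous f -> L1 `]a, b[ f.
Proof. by move=> cf; apply: L2_L1 => //; exact: cont_L2. Qed.

Lemma L1_oo a b c d f : a <= c -> d <= b -> L1 `]a, b[ f -> L1 `]c, d[ f.
Proof.
move=> ac db; apply: L1S => // x /=.
rewrite !in_itv/= => /andP[cx xd]; apply/andP; split.
  exact: le_lt_trans ac cx.
exact: lt_le_trans xd db.
Qed.

Lemma L2_oo a b c d f : a <= c -> d <= b -> L2 `]a, b[ f -> L2 `]c, d[ f.
Proof.
move=> ac db; apply: L2S => // x /=.
rewrite !in_itv/= => /andP[cx xd]; apply/andP; split.
  exact: le_lt_trans ac cx.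
exact: lt_le_trans xd db.
Qed.

Lemma Rint_split a c b f : a <= c -> c <= b -> L1 `]a, b[ f ->
  \int[mu]_(x in `]a, b[) f x =
  \int[mu]_(x in `]a, c[) f x + \int[mu]_(x in `]c, b[) f x.
Proof.
move=> ac cb Lf.
have Lac : L1 `]a, c[ f by apply: L1_oo Lf.
have Lcb : L1 `]c, b[ f by apply: L1_oo Lf.
case: (ltgtP a c) ac => // [ac _|-> _]; last first.
  by rewrite set_itvoo0 ?lexx// Rintegral_set0 add0r.
case: (ltgtP c b) cb => // [cb _|-> _]; last first.
  by rewrite [in X in _ = _ + X]set_itvoo0 ?lexx// Rintegral_set0 addr0.
rewrite [in X in _ = X + _]Rintegral_itv_bndo_bndc//.
rewrite -(@Rintegral_itvB _ f (BRight a) (BLeft b) c)//.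
  by rewrite addrC subrK.
  by rewrite bnd_simp ltW.
Qed.

Lemma Rint_le_norm a b f : L1 `]a, b[ f ->
  `|\int[mu]_(x in `]a, b[) f x| <= \int[mu]_(x in `]a, b[) `|f x|.
Proof. exact: le_normr_Rintegral. Qed.

Lemma Rint_bdd a b M f : a <= b -> mblfun `]a, b[ f ->
  {ae mu, forall x, `]a, b[ x -> `|f x| <= M} ->
  `|\int[mu]_(x in `]a, b[) f x| <= M * (b - a).
Proof.
move=> ab mf fM; have Lf : L1 `]a, b[ f.
  by apply: (L1_dom _ mf (L1_cst (moo a b) M (muoo a b)) fM).
apply: le_trans (Rint_le_norm Lf) _.
rewrite -muooE// -Rintegral_cst//; apply: Rint_ae_le => //.
- exact: L1_norm.
- exact: L1_cst.
Qed.

Lemma L1_approx a b f (e : R) : 0 < e -> L1 `]a, b[ f ->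
  exists2 g, continuous g & \int[mu]_(x in `]a, b[) `|f x - g x| <= e.
Proof.
move=> e0 Lf; have [g_ [cg Lg]] := approximation_continuous_integrable (moo a b) (muoo a b) Lf.
move=> /fine_cvgP[_ /cvgr0Pnorm_le /(_ e e0)[N _ /(_ N (leqnn N)) h]].
exists (g_ N); first exact: cg.
by apply: le_trans h; rewrite /= ler_norm.
Qed.

Lemma C1_cont v dv : C1 v dv -> continuous v.
Proof. by move=> [h _] x; apply: differentiable_continuous; apply/derivable1_diffP; case: (h x). Qed.

End Intervals.
#[export] Hint Resolve moo muoo : core.

(** * Primitives of integrable functions and integration by parts *)

Section IBP.
Context {R : realType}.
Local Notation mu := (@lebesgue_measure R).
Implicit Types (a b c x y : R) (f g v dv : R -> R).

Lemma derivable_LR a b f : (forall x, a <= x <= b -> derivable f x 1) ->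
  a < b -> derivable_oo_LRcontinuous f a b.
Proof.
move=> df ab; have cf x : a <= x <= b -> {for x, continuous f}.
  by move=> /df h; apply: differentiable_continuous; apply/derivable1_diffP.
split.
- by move=> x; rewrite in_itv/= => /andP[/ltW ax /ltW xb]; apply: df; rewrite ax.
- by apply: cvg_at_right_filter; apply: cf; rewrite lexx ltW.
- by apply: cvg_at_left_filter; apply: cf; rewrite lexx ltW.
Qed.

(** The integral is unsigned: to the left of [a] the interval is empty and the value is 0. *)
Definition prim g a x := \int[mu]_(t in `]a, x[) g t.

Lemma prim0 g a : prim g a a = 0.
Proof. by rewrite /prim set_itvoo0 ?lexx// Rintegral_set0. Qed.

Lemma prim_diff g a b x y : L1 `]a, b[ g -> a <= x -> x <= y -> y <= b ->
  prim g a y - prim g a x = \int[mu]_(t in `]x, y[) g t.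
Proof.
move=> Lg ax xy yb; rewrite /prim (@Rint_split _ a x y)//; first by rewrite addrC addrA addNr add0r.
by apply: L1_oo Lg.
Qed.

Lemma prim_ext g h a b : (forall x, `]a, b[ x -> g x = h x) ->
  forall x, x <= b -> prim g a x = prim h a x.
Proof.
move=> gh x xb; apply: eq_Rintegral => t; rewrite inE/= in_itv/= => /andP[at_ tx].
by apply: gh; rewrite /= in_itv/= at_ (lt_le_trans tx).
Qed.

Lemma prim_cont_derive g a x : continuous g -> a < x ->
  is_derive x (1 : R) (prim g a) (g x).
Proof.
move=> cg ax.
have -> : prim g a = fun y => \int[mu]_(t in [set` Interval (BRight a) (BRight y)]) g t.
  by apply/funext => y; rewrite /prim Rintegral_itv_bndo_bndc//; exact: cont_L1.
set F := fun y => _; have [d1 d2] : derivable F x 1 /\ F^`() x = g x.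
  apply: (@continuous_FTC1 R g (BRight a) x (x + 1)); last exact: cg.
  - by rewrite ltrDl.
  - have : L1 `]a, x + 2[ g by exact: cont_L1.
    apply: L1S => //.
    move=> y /=; rewrite !in_itv/= => /andP[-> /=] /le_lt_trans; apply.
    by rewrite ltrD2l ltr1n.
  - exact: ax.
by apply: DeriveDef; [exact: d1|rewrite -d2 derive1E].
Qed.

Lemma Rint_cc a b f : L1 `[a, b] f ->
  \int[mu]_(x in `[a, b]) f x = \int[mu]_(x in `]a, b[) f x.
Proof.
move=> Lf; rewrite -Rintegral_itv_obnd_cbnd.
  rewrite -Rintegral_itv_bndo_bndc//; apply: L1S Lf => //.
  exact: subset_itv_oo_cc.
by apply: L1S Lf => //; exact: subset_itv_oc_cc.
Qed.

Lemma within_L1 a b f : {within `[a, b], continuous f} -> L1 `[a, b] f.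
Proof. by move=> cf; apply: continuous_compact_integrable => //; exact: segment_compact. Qed.

Lemma FTC2_within v dv a b : a < b ->
  (forall x, a <= x <= b -> is_derive x (1 : R) v (dv x)) ->
  {within `[a, b], continuous dv} ->
  \int[mu]_(x in `]a, b[) dv x = v b - v a.
Proof.
move=> ab hv cdv.
rewrite -Rint_cc; last exact: within_L1.
rewrite /Rintegral (@continuous_FTC2 _ dv v)//.
- by apply: derivable_LR => // x /hv [].
- move=> x; rewrite in_itv/= => /andP[/ltW ax /ltW xb]; rewrite derive1E.
  by have [|_ h] := hv x; rewrite ?ax.
Qed.

Lemma FTC2_C1 v dv a b : a < b -> C1 v dv ->
  \int[mu]_(x in `]a, b[) dv x = v b - v a.
Proof.
move=> ab [hv cdv]; apply: FTC2_within => //; exact: continuous_subspaceT.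
Qed.

Lemma isdM v w x dvx dwx : is_derive x (1 : R) v dvx -> is_derive x (1 : R) w dwx ->
  is_derive x (1 : R) (fun y => v y * w y) (dvx * w x + v x * dwx).
Proof.
move=> hv hw; have h := @is_deriveM _ _ v w x 1 _ _ hv hw.
by rewrite (_ : dvx * w x + v x * dwx = v x *: dwx + w x *: dvx)// /GRing.scale/=; ring.
Qed.

Lemma C1M v dv w dw : C1 v dv -> C1 w dw -> C1 (fun x => v x * w x) (fun x => dv x * w x + v x * dw x).
Proof.
move=> hv hw; have cv := C1_cont hv; have cw := C1_cont hw.
case: hv hw => v1 v2 [w1 w2]; split => x; last first.
  by apply: cvgD; apply: cvgM; solve [exact: v2|exact: w2|exact: cv|exact: cw].
exact: isdM.
Qed.

Let IBP_cont g a b c v dv : a < b -> continuous g -> C1 v dv ->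
  \int[mu]_(x in `]a, b[) (g x * v x) +
  \int[mu]_(x in `]a, b[) ((c + prim g a x) * dv x)
  = (c + prim g a b) * v b - c * v a.
Proof.
move=> ab cg vC; have cv := C1_cont vC; have cdv := vC.2.
(* [prim g a] is constant to the left of [a] and may have a kink there. Starting the primitive at
   [a - 1] gives a function that agrees with it on [a, b] and is differentiable on both sides of
   [a]. *)
pose G x := c + (prim g (a - 1) x - prim g (a - 1) a).
have GE x : a <= x -> G x = c + prim g a x.
  move=> ax; rewrite /G (@prim_diff _ _ x)//; first exact: cont_L1.
  by rewrite gerBl.
have dG x : a - 1 < x -> is_derive x (1 : R) G (g x).
  move=> ax; have h := prim_cont_derive cg ax.
  have := is_deriveD (is_derive_cst c x 1) (is_deriveB h (is_derive_cst (prim g (a - 1) a) x 1)).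
  by rewrite subr0 add0r.
have a1 : a - 1 < a by rewrite gtrBl.
have cG x : a - 1 < x -> {for x, continuous G}.
  by move=> /dG[h _]; apply: differentiable_continuous; apply/derivable1_diffP.
have cGw (h : R -> R) : continuous h -> {within `[a, b], continuous (fun x => G x * h x)}.
  move=> ch; apply: continuous_in_subspaceT => x; rewrite inE/= in_itv/= => /andP[ax _].
  by apply: cvgM; [apply: cG; exact: lt_le_trans ax|exact: ch].
have LG : L1 `]a, b[ (fun x => G x * dv x).
  by apply: L1S (within_L1 (cGw _ cdv)) => //; exact: subset_itv_oo_cc.
have cgv : continuous (fun x => g x * v x).
  by move=> x; apply: cvgM; [exact: cg|exact: cv].
have -> : \int[mu]_(x in `]a, b[) ((c + prim g a x) * dv x) =
  \int[mu]_(x in `]a, b[) (G x * dv x).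
  by apply: eq_Rintegral => x; rewrite inE/= in_itv/= => /andP[/ltW ax _]; rewrite GE.
rewrite -RintegralD//; last exact: cont_L1.
transitivity ((fun x => G x * v x) b - (fun x => G x * v x) a); last first.
  by rewrite /= (GE _ (lexx a)) (GE _ (ltW ab)) prim0 addr0.
apply: (@FTC2_within (fun x => G x * v x) (fun x => g x * v x + G x * dv x)) => //.
- move=> x /andP[ax xb].
  exact: isdM (dG x (lt_le_trans a1 ax)) (vC.1 x).
- apply: continuous_in_subspaceT => x; rewrite inE/= in_itv/= => /andP[ax _].
  apply: cvgD; first exact: cgv.
  by apply: cvgM; [apply: cG; exact: lt_le_trans ax|exact: cdv].
Qed.

Lemma prim_norm_le g a b x : L1 `]a, b[ g -> x <= b ->
  `|prim g a x| <= \int[mu]_(t in `]a, b[) `|g t|.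
Proof.
move=> Lg xb; have Lx : L1 `]a, x[ g by apply: L1_oo Lg.
apply: le_trans (Rint_le_norm Lx) _.
have [xa|ax] := leP x a; first by rewrite set_itv_ge ?bnd_simp -?leNgt// Rintegral_set0; exact: Rintegral_ge0.
rewrite (@Rint_split _ a x b)//; [|exact: ltW|exact: L1_norm].
by rewrite lerDl; exact: Rintegral_ge0.
Qed.

Lemma L1_patch g a b : L1 `]a, b[ g -> L1 setT (g \_ `]a, b[).
Proof.
move=> Lg; rewrite /L1 -restrict_EFin; exact: (integrable_mkcond _ (moo a b)).1.
Qed.

Lemma patchoo g a b x : `]a, b[ x -> (g \_ `]a, b[) x = g x.
Proof. by move=> abx; rewrite patchE mem_set. Qed.

Lemma prim_patch g a b x : x <= b -> prim (g \_ `]a, b[) a x = prim g a x.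
Proof. by apply: prim_ext => y /patchoo. Qed.

Lemma prim_cont_within g a b : L1 `]a, b[ g -> a < b -> {within `[a, b], continuous (prim g a)}.
Proof.
move=> Lg ab; have Lp := L1_patch Lg.
have Lcc c d : L1 `[c, d] (g \_ `]a, b[).
  exact: L1S Lp.
have := @parameterized_integral_continuous R a b (g \_ `]a, b[) (ltW ab) (Lcc a b).
rewrite (_ : (fun x => parameterized_integral mu a x (g \_ `]a, b[)) = prim (g \_ `]a, b[) a); last first.
  by apply/funext => x; exact: Rint_cc.
move=> h; apply: subspace_eq_continuous h => x; rewrite inE/= in_itv/= => /andP[_ xb].
exact: prim_patch.
Qed.

Lemma prim_mbl g a b : L1 `]a, b[ g -> a < b -> mblfun `]a, b[ (prim g a).
Proof.
move=> Lg ab; have h := prim_cont_within Lg ab.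
apply: (@measurable_funS _ _ _ _ `[a, b]%classic); first exact: measurable_itv.
  exact: subset_itv_oo_cc.
by apply: subspace_continuous_measurable_fun => //; exact: measurable_itv.
Qed.

Lemma prim_L2 g a b c : L1 `]a, b[ g -> a < b -> L2 `]a, b[ (fun x => c + prim g a x).
Proof.
move=> Lg ab.
have L2p : L2 `]a, b[ (prim g a).
  apply: (@L2_bounded _ _ _ (\int[mu]_(t in `]a, b[) `|g t|)) => //; first exact: prim_mbl.
  apply: aeW => x /=; rewrite in_itv/= => /andP[_ /ltW xb]; exact: prim_norm_le.
apply: L2D => //; apply: cont_L2; exact: cst_continuous.
Qed.

Lemma primB g h a b x : L1 `]a, b[ g -> L1 `]a, b[ h -> x <= b ->
  prim (fun t => g t - h t) a x = prim g a x - prim h a x.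
Proof.
by move=> Lg Lh xb; apply: RintegralB => //; [apply: L1_oo Lg|apply: L1_oo Lh].
Qed.

(* [g] is approximated in L^1 by continuous functions, for which this is
   the classical formula. *)
Lemma IBP g a b c v dv : a < b -> L1 `]a, b[ g -> C1 v dv ->
  \int[mu]_(x in `]a, b[) (g x * v x) +
  \int[mu]_(x in `]a, b[) ((c + prim g a x) * dv x)
  = (c + prim g a b) * v b - c * v a.
Proof.
move=> ab Lg vC; have cv := C1_cont vC; have cdv := vC.2.
have [V V0 hV] := cont_bdd a b cv; have [W W0 hW] := cont_bdd a b cdv.
have hVae : {ae mu, forall x, `]a, b[ x -> `|v x| <= V}.
  by apply: aeW => x /=; rewrite in_itv/= => /andP[/ltW ax /ltW xb]; apply: hV; rewrite ax.
have mv := cont_mblfun (moo a b) cv; have mdv := cont_mblfun (moo a b) cdv.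
apply/eqP; rewrite -subr_eq0 -normr_le0; apply/ler_addgt0Pr => e e0; rewrite add0r.
(* Replacing [g] by a continuous [h] at L^1 distance [d] costs V d in the first integral, W (b - a)
   d in the second and V d in the boundary terms; the summand 1 makes [K] positive. *)
pose K := V + W * (b - a) + V + 1.
have K0 : 0 < K by rewrite /K ltr_wpDl// !addr_ge0// mulr_ge0// subr_ge0 ltW.
pose d := e / K; have d0 : 0 < d by rewrite divr_gt0.
have [h ch hd] := L1_approx d0 Lg.
have Lh : L1 `]a, b[ h by exact: cont_L1.
have LgB : L1 `]a, b[ (fun x => g x - h x) by exact: L1B.
have Igd : \int[mu]_(x in `]a, b[) `|g x - h x| <= d by [].
have := IBP_cont c ab ch vC; set bh := RHS => Eh.
have E1 : `|\int[mu]_(x in `]a, b[) (g x * v x) - \int[mu]_(x in `]a, b[) (h x * v x)| <= V * d.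
  rewrite -RintegralB//; first last.
  - by have := L1_bdd (moo a b) Lh mv hVae; congr L1; apply/funext => x; rewrite mulrC.
  - by have := L1_bdd (moo a b) Lg mv hVae; congr L1; apply/funext => x; rewrite mulrC.
  under eq_Rintegral do rewrite -mulrBl mulrC.
  apply: le_trans (Rint_le_norm (L1_bdd (moo a b) LgB mv hVae)) _.
  apply: le_trans (ler_wpM2l V0 Igd); rewrite -RintegralZl//; last exact: L1_norm.
  apply: Rint_ae_le => //.
  - by apply: L1_norm; exact: (L1_bdd (moo a b) LgB mv hVae).
  - by apply: L1Z => //; exact: L1_norm.
  - by apply: (aeS _ hVae) => x {}hVae Dx; rewrite normrM ler_wpM2r// hVae.
have pB x : x <= b -> `|prim g a x - prim h a x| <= d.
  by move=> xb; rewrite -(primB Lg Lh xb); apply: le_trans Igd; exact: prim_norm_le.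
have L2dv : L2 `]a, b[ dv by exact: cont_L2.
have E2 : `|\int[mu]_(x in `]a, b[) ((c + prim g a x) * dv x) -
           \int[mu]_(x in `]a, b[) ((c + prim h a x) * dv x)| <= d * W * (b - a).
  have L1g : L1 `]a, b[ (fun x => (c + prim g a x) * dv x) by apply: L2M => //; exact: prim_L2.
  have L1h : L1 `]a, b[ (fun x => (c + prim h a x) * dv x) by apply: L2M => //; exact: prim_L2.
  rewrite -RintegralB//; apply: Rint_bdd; first exact: ltW.
    by apply: L1_meas; exact: L1B.
  apply: aeW => x /=; rewrite in_itv/= => /andP[/ltW ax /ltW xb].
  rewrite -mulrBl normrM ler_pM//; last by rewrite hW// ax.
  by rewrite opprD addrACA subrr add0r pB.
have E3 : `|(c + prim g a b) * v b - c * v a - bh| <= V * d.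
  rewrite /bh [X in `|X|](_ : _ = v b * (prim g a b - prim h a b)); last by ring.
  by rewrite normrM ler_pM// ?pB// hV// ltW//=.
rewrite (_ : e = K * d); last by rewrite /d mulrC divfK// gt_eqF.
move: E1 E2 E3 Eh; set X1 := \int[mu]_(x in _) (g x * v x).
set X2 := \int[mu]_(x in _) (h x * v x).
set X3 := \int[mu]_(x in _) _; set X4 := \int[mu]_(x in _) _.
set Y := _ - c * v a => E1 E2 E3 Eh.
have -> : X1 + X3 - Y = (X1 - X2) + (X3 - X4) - (Y - bh) by rewrite -Eh; ring.
apply: le_trans (ler_normB _ _) _; apply: le_trans (lerD (ler_normD _ _) (lexx _)) _.
apply: le_trans (lerD (lerD E1 E2) E3) _.
by rewrite [leRHS](_ : _ = V * d + d * W * (b - a) + V * d + d); [rewrite lerDl ltW|rewrite /K; ring].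
Qed.

End IBP.

(** * Smooth bump functions with compact support *)

Section Bump.
Context {R : realType}.
Local Notation mu := (@lebesgue_measure R).
Implicit Types (a b c d x y e : R) (f g v dv : R -> R).

Lemma isdV f x df : f x != 0 -> is_derive x (1 : R) f df ->
  is_derive x (1 : R) (fun y => (f y)^-1) (- ((f x)^-1 ^+ 2 * df)).
Proof.
move=> fx0 [d1 d2]; apply: DeriveDef; first exact: derivableV.
by rewrite deriveV// d2 /GRing.scale/= exprVn mulNr.
Qed.

Lemma isdX f n x df : is_derive x (1 : R) f df ->
  is_derive x (1 : R) (fun y => f y ^+ n) (n%:R * f x ^+ n.-1 * df).
Proof.
move=> h; elim: n => [|n IH].
  by rewrite !mul0r (_ : (fun _ => _) = cst 1)//; exact: is_derive_cst.
have -> : (fun y => f y ^+ n.+1) = fun y => f y * f y ^+ n.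
  by apply/funext => y; rewrite exprS.
have := isdM h IH; congr is_derive; case: n {IH} => [|n]/=.
  by rewrite !mul0r mulr0 addr0 expr0 mulr1 !mul1r.
by rewrite exprS -[n.+2]addn1 natrD; ring.
Qed.

Lemma isd_horner (p : {poly R}) x : is_derive x (1 : R) (horner p) (p^`()).[x].
Proof.
apply: DeriveDef; first exact: derivable_horner.
by rewrite -derive1E -derivE.
Qed.

Lemma isd_exp f x df : is_derive x (1 : R) f df ->
  is_derive x (1 : R) (fun y => expR (f y)) (expR (f x) * df).
Proof.
by move=> h; have := is_derive1_comp (is_derive_expR (f x)) h; rewrite mulrC.
Qed.

Lemma isd_near f g x df : (\forall y \near x, f y = g y) ->
  is_derive x (1 : R) f df -> is_derive x (1 : R) g df.
Proof. by move=> fg; apply: near_eq_is_derive. Qed.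

(** Quadratic contact with 0 makes the difference quotient O(h). This settles the two ends of the
    support of a bump, where the differentiation rules do not apply. *)
Lemma isd_sqr0 f x K : (forall y, `|f y| <= K * (y - x) ^+ 2) ->
  is_derive x (1 : R) f 0.
Proof.
move=> fK; have fx0 : f x = 0.
  by apply/eqP; rewrite -normr_le0; have := fK x; rewrite subrr expr0n mulr0.
have h : (fun h => h^-1 *: ((f \o shift x) (h *: (1 : R)) - f x)) @ (0 : R)^' --> (0 : R).
  apply/cvgr0Pnorm_le => e e0.
  have K0 : 0 < `|K| + 1 by rewrite ltr_wpDl.
  near=> h; have h0 : h != 0 by near: h; exact: nbhs_dnbhs_neq.
  rewrite /= fx0 subr0 /GRing.scale/= mulr1 normrM normfV.
  rewrite mulrC ler_pdivrMr ?normr_gt0//.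
  apply: le_trans (fK _) _; rewrite addrK -(real_normK (num_real h)).
  have hs : `|h| <= e / (`|K| + 1).
    near: h; apply: dnbhs0_le; rewrite divr_gt0//.
  have : (`|K| + 1) * `|h| <= e by rewrite mulrC -ler_pdivlMr.
  have := ler_norm K; have := normr_ge0 h; nra.
apply: DeriveDef; first by apply/cvg_ex; exists 0; exact: h.
exact: cvg_lim h.
Unshelve. all: by end_near. Qed.

Section bump.
Variables (c d e : R).
Hypotheses (cd : c < d) (e0 : 0 < e).

Let S : {poly R} := ('X - c%:P) * (d%:P - 'X).

(** The functions p S^(-n) exp(- e / S) with S = (x - c)(d - x) form a family closed under
    differentiation; the pair (p, n) encodes the prefactor and [bump_next] is the derivative on such
    codes, so that smoothness follows by iteration. *)
Definition bumpf (pn : {poly R} * nat) x :=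
  if (c < x) && (x < d) then
    pn.1.[x] * (S.[x])^-1 ^+ pn.2 * expR (- e * (S.[x])^-1) else 0.

Definition bump_next (pn : {poly R} * nat) : {poly R} * nat :=
  (pn.1^`() * S ^+ 2 - pn.2%:R *: (pn.1 * S * S^`()) + e *: (pn.1 * S^`()), pn.2.+2).

Let SE x : S.[x] = (x - c) * (d - x). Proof. by rewrite /S !hornerE. Qed.

Let S_gt0 x : c < x -> x < d -> 0 < S.[x].
Proof. by move=> cx xd; rewrite SE mulr_gt0// subr_gt0. Qed.

Let bump_in pn x : c < x -> x < d -> is_derive x (1 : R) (bumpf pn) (bumpf (bump_next pn) x).
Proof.
case: pn => p n cx xd; have s0 := S_gt0 cx xd; have sn0 : S.[x] != 0 by rewrite gt_eqF.
have i1 := isdV sn0 (isd_horner S x).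
have := isdM (isdM (isd_horner p x) (isdX n i1)) (isd_exp (isdM (is_derive_cst (- e) x 1) i1)).
set D := (X in is_derive _ _ _ X) => h.
have -> : bumpf (bump_next (p, n)) x = D.
  rewrite /bumpf cx xd/= /D /bump_next/= {h D}/cst.
  move: (S) sn0 => S0 s0n.
  rewrite !(hornerD, hornerN, hornerZ, hornerM, horner_exp).
  move: (expR _) (p.[x]) (p^`().[x]) (S0^`().[x]) s0n => E P P' S'.
  move: (S0.[x]) => t t0; rewrite !exprS.
  case: n => [|n]/=; rewrite ?exprS ?expr0; first by field.
  by move: (t^-1 ^+ n) => q; field.
apply: isd_near h; near=> y.
rewrite /bumpf ifT//; apply/andP; split; near: y; [exact: lt_nbhsr|exact: lt_nbhsl].
Unshelve. all: by end_near. Qed.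

Let S_le x y : (y == c) || (y == d) -> c < x -> x < d ->
  S.[x] ^+ 2 <= (d - c) ^+ 2 * (x - y) ^+ 2.
Proof.
move=> ycd cx xd; have s0 := S_gt0 cx xd; rewrite -exprMn.
rewrite -[leRHS]real_normK ?num_real// lerXn2r ?nnegrE ?(ltW s0)//.
have xc0 : 0 <= x - c by rewrite subr_ge0 ltW.
have dx0 : 0 <= d - x by rewrite subr_ge0 ltW.
have dc0 : 0 <= d - c by rewrite subr_ge0 ltW.
rewrite SE normrM (ger0_norm dc0); case/orP: ycd => /eqP->.
  by rewrite (ger0_norm xc0) mulrC ler_wpM2r// lerD2l lerN2 ltW.
by rewrite distrC (ger0_norm dx0) ler_wpM2r// lerD2r ltW.
Qed.

(** From exp t >= t^(n+2) / (n+2)! at t = e / S one gets exp(- e / S) <= (n+2)! (S / e)^(n+2): this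
    cancels the pole S^(-n) and leaves the factor S^2 that gives quadratic contact at the ends. *)
Let bump_decay pn : exists2 K, 0 <= K & forall x, c < x -> x < d ->
  `|bumpf pn x| <= K * S.[x] ^+ 2.
Proof.
case: pn => p n; have [M M0 hM] := cont_bdd c d (@continuous_horner _ p).
pose F : R := n.+2`!%:R; have F0 : 0 < F by rewrite ltr0n fact_gt0.
exists (M * F * (e^-1) ^+ n.+2).
  apply: mulr_ge0; first by apply: mulr_ge0 => //; exact: ltW.
  by apply: exprn_ge0; rewrite invr_ge0 ltW.
move=> x cx xd; have s0 := S_gt0 cx xd.
rewrite /bumpf cx xd/= !normrM.
have hMx : `|p.[x]| <= M by apply: hM; rewrite (ltW cx) (ltW xd).
have t0 : 0 < e * S.[x]^-1 by rewrite mulr_gt0// invr_gt0.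
have h : expR (- e * S.[x]^-1) <= F * (e^-1 * S.[x]) ^+ n.+2.
  rewrite mulNr expRN -[leRHS]invrK lef_pV2 ?posrE ?expR_gt0//; last first.
    by rewrite invr_gt0 mulr_gt0// exprn_gt0// mulr_gt0// invr_gt0.
  apply: le_trans (expR_ge1Dxn n.+1 (ltW t0)).
  by rewrite invfM -exprVn invfM invrK mulrC lerDr.
have i0 : 0 <= S.[x]^-1 ^+ n by rewrite exprn_ge0// invr_ge0 ltW.
rewrite (ger0_norm (expR_ge0 _)) (ger0_norm i0).
apply: le_trans (_ : M * S.[x]^-1 ^+ n * (F * (e^-1 * S.[x]) ^+ n.+2) <= _).
  by rewrite ler_pM ?mulr_ge0 ?expR_ge0// ler_wpM2r.
rewrite exprMn !exprS !exprVn -!exprVn le_eqVlt; apply/orP; left; apply/eqP.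
have -> : forall A B D : R, M * A * (F * (B * (S.[x] * (S.[x] * D)))) = M * F * B * (S.[x] * S.[x] ) * (A * D).
  by move=> *; ring.
by rewrite -exprMn mulVf ?gt_eqF// expr1n mulr1 expr0 mulr1 !mulrA.
Qed.

Lemma bump_out pn x : (x <= c) || (d <= x) -> bumpf pn x = 0.
Proof.
by rewrite /bumpf => /orP[]; rewrite leNgt => /negbTE ->//; rewrite andbF.
Qed.

Lemma bump_is_derive pn x : is_derive x (1 : R) (bumpf pn) (bumpf (bump_next pn) x).
Proof.
have z0 : is_derive x (1 : R) (fun=> 0 : R) 0 by exact: is_derive_cst.
have bd y : (y == c) || (y == d) -> is_derive y (1 : R) (bumpf pn) (bumpf (bump_next pn) y).
  move=> ycd; rewrite [X in is_derive _ _ _ X]bump_out; last first.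
    by case/orP: ycd => /eqP->; rewrite lexx ?orbT.
  have [K K0 hK] := bump_decay pn.
  apply: (@isd_sqr0 _ _ (K * (d - c) ^+ 2)) => x'.
  have [/andP[cx xd]|] := boolP ((c < x') && (x' < d)).
    by apply: le_trans (hK x' cx xd) _; rewrite -mulrA ler_wpM2l// S_le.
  rewrite negb_and -!leNgt => xo; rewrite bump_out// normr0.
  by apply: mulr_ge0; [apply: mulr_ge0 => //; exact: sqr_ge0|exact: sqr_ge0].
have [cx|cx|<-] := ltgtP c x; last by apply: bd; rewrite eqxx.
- have [xd|xd|->] := ltgtP x d; last by apply: bd; rewrite eqxx orbT.
  + exact: bump_in.
  + have -> : bumpf (bump_next pn) x = 0 by apply: bump_out; rewrite (ltW xd) orbT.
    apply: isd_near z0; near=> y; rewrite bump_out//.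
    by apply/orP; right; apply: ltW; near: y; exact: lt_nbhsr.
- have -> : bumpf (bump_next pn) x = 0 by apply: bump_out; rewrite (ltW cx).
  apply: isd_near z0; near=> y; rewrite bump_out//.
  by apply/orP; left; apply: ltW; near: y; exact: lt_nbhsl.
Unshelve. all: by end_near. Qed.

End bump.

(** An explicit tower of derivatives passes to linear combinations and to primitives term by term,
    without computing any iterated [derive1n]. *)
Definition smoothD (f : R -> R) := exists Ds : nat -> R -> R,
  Ds 0%N = f /\ forall n x, is_derive x (1 : R) (Ds n) (Ds n.+1 x).

Lemma smoothD_smooth f : smoothD f -> smooth f.
Proof.
move=> [Ds [D0 hD]] n x; have -> : derive1n n f = Ds n.
  elim: n => [//|n IH]; rewrite derive1nS IH; apply/funext => y.
  by rewrite derive1E; apply: derive_val.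
by case: (hD n x).
Qed.

Lemma smoothD_lin k l f g : smoothD f -> smoothD g -> smoothD (fun x => k * f x + l * g x).
Proof.
move=> [Df [<- hf]] [Dg [<- hg]].
exists (fun n x => k * Df n x + l * Dg n x); split=> // n x.
have := is_deriveD (isdM (is_derive_cst k x 1) (hf n x)) (isdM (is_derive_cst l x 1) (hg n x)).
by rewrite /cst !mul0r !add0r.
Qed.

Lemma smoothD_int f g : (forall x, is_derive x (1 : R) f (g x)) -> smoothD g -> smoothD f.
Proof.
move=> fg [Dg [D0 hg]]; exists (fun n => if n is n'.+1 then Dg n' else f); split => // -[|n] x.
  by rewrite D0; exact: fg.
exact: hg.
Qed.

(** This is exp(- e / ((x - c)(d - x))). The parameter [e] is sent to 0, which turns the bump into
    the indicator of ]c, d[. *)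
Definition bumpfun (c d e : R) := bumpf c d e (1, 0%N).

Lemma bump_smoothD c d e : c < d -> 0 < e -> smoothD (bumpfun c d e).
Proof.
move=> cd e0; exists (fun n => bumpf c d e (iter n (bump_next c d e) (1, 0%N))).
by split=> // n x; apply: bump_is_derive.
Qed.

Lemma smoothD_cont f : smoothD f -> continuous f.
Proof.
move=> [Ds [<- h]] x; apply: differentiable_continuous; apply/derivable1_diffP.
by case: (h 0%N x).
Qed.

Lemma bumpE c d e x : c < x -> x < d -> bumpfun c d e x = expR (- e * ((x - c) * (d - x))^-1).
Proof. by move=> cx xd; rewrite /bumpfun /bumpf cx xd/= expr0 !hornerE ?mul1r ?mulr1. Qed.

End Bump.

(** * The du Bois-Reymond lemma and weak derivatives *)

Section DuBoisReymond.
Context {R : realType}.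
Local Notation mu := (@lebesgue_measure R).
Implicit Types (a b c d x y e : R) (f g k v dv : R -> R).

Lemma Rdct (D : set R) (f_ : nat -> R -> R) f g : mbl D ->
  (forall n, mblfun D (f_ n)) -> mblfun D f ->
  {ae mu, forall x, D x -> f_ n x @[n --> \oo] --> f x} ->
  L1 D g -> {ae mu, forall x, D x -> forall n, `|f_ n x| <= g x} ->
  [/\ L1 D f,
    \int[mu]_(x in D) `|f_ n x - f x| @[n --> \oo] --> (0 : R) &
    \int[mu]_(x in D) f_ n x @[n --> \oo] --> \int[mu]_(x in D) f x].
Proof.
move=> mD mf_ mf f_f Lg fg.
have [] := @dominated_convergence _ _ _ mu D mD (fun n => EFin \o f_ n) (EFin \o f) (EFin \o g).
- by move=> n; exact/measurable_EFinP.
- exact/measurable_EFinP.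
- by apply: (aeS _ f_f) => x h Dx; apply: cvg_EFin; [apply: nearW|exact: h].
- exact: Lg.
- by apply: (aeS _ fg) => x h n Dx /=; rewrite lee_fin; exact: h.
move=> Lf h1 h2; split => //.
- by move/fine_cvgP : h1 => [_].
- have := h2; rewrite -[X in _ --> X -> _](@EFin_Rint _ _ mD f)//.
  by move/fine_cvgP => [_].
Qed.

Lemma FTC1_ae g a b : L1 `]a, b[ g ->
  {ae mu, forall x, `]a, b[ x -> is_derive x (1 : R) (prim g a) (g x)}.
Proof.
move=> Lg; have Lp := L1_patch Lg.
have Lac (c : itv_bound R) d : L1 [set` Interval c (BRight d)] (g \_ `]a, b[).
  by apply: L1S Lp => //.
have := @FTC1 R (g \_ `]a, b[) (BRight a) (Lac _) (integrable_locally (moo a b) Lg).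
apply: aeS => x h xab; move: (xab); rewrite /= in_itv/= => /andP[ax xb].
have [h1 h2] := h ax.
apply: (@isd_near _ (prim (g \_ `]a, b[) a)).
  by near=> y; apply: prim_patch; apply: ltW; near: y; exact: lt_nbhsl.
rewrite (_ : prim _ a = fun y => \int[mu]_(t in `]a, y]) (g \_ `]a, b[) t); last first.
  apply/funext => y; rewrite /prim Rintegral_itv_bndo_bndc//.
  exact: L1S Lp.
apply: DeriveDef => //; rewrite -derive1E.
by move: h2; rewrite patchoo.
Unshelve. all: by end_near. Qed.

Lemma Rint_zero (D : set R) f : (forall x, D x -> f x = 0) -> \int[mu]_(x in D) f x = 0.
Proof.
move=> f0; rewrite (@eq_Rintegral _ _ _ mu D (fun=> 0)).
  by rewrite /Rintegral integral0.
by move=> x; rewrite inE => /f0.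
Qed.

Lemma bump_bdd c d e x : c < d -> 0 < e -> 0 <= bumpfun c d e x <= 1.
Proof.
move=> cd e0; have [/andP[cx xd]|] := boolP ((c < x) && (x < d)).
  rewrite bumpE// expR_ge0/= expR_le1 mulNr oppr_le0 mulr_ge0 ?(ltW e0)//.
  by rewrite invr_ge0 mulr_ge0 ?subr_ge0// ltW.
by rewrite negb_and -!leNgt => h; rewrite /bumpfun bump_out// lexx ler01.
Qed.

Lemma bump_cvg c d x : c < d ->
  bumpfun c d n.+1%:R^-1 x @[n --> \oo] --> (\1_`]c, d[%classic x : R).
Proof.
move=> cd; rewrite indicE; case: (boolP (x \in _)) => [|]; last first.
  rewrite notin_setE/= in_itv/= => /negP; rewrite negb_and -!leNgt => h.
  rewrite (_ : (fun n => _) = fun=> 0); first exact: cvg_cst.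
  by apply/funext => n; rewrite /bumpfun bump_out.
rewrite inE/= in_itv/= => /andP[cx xd].
have h : - n.+1%:R^-1 * ((x - c) * (d - x))^-1 @[n --> \oo] --> (0 : R).
  rewrite -(mul0r ((x - c) * (d - x))^-1) -oppr0; apply: cvgMl; apply: cvgN.
  exact: cvg_harmonic.
have := cvg_comp _ _ h (@continuous_expR R 0); rewrite expR0 mulr1n.
rewrite (_ : expR \o _ = fun n => bumpfun c d n.+1%:R^-1 x)//.
by apply/funext => n /=; rewrite bumpE.
Qed.

Lemma bump_int_cvg a b c d k : L1 `]a, b[ k -> a <= c -> c < d -> d <= b ->
  \int[mu]_(x in `]a, b[) (k x * bumpfun c d n.+1%:R^-1 x) @[n --> \oo]
    --> \int[mu]_(x in `]c, d[) k x.
Proof.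
move=> Lk ac cd db.
have -> : \int[mu]_(x in `]c, d[) k x =
  \int[mu]_(x in `]a, b[) (k x * (\1_`]c, d[%classic x : R)).
  rewrite [LHS](_ : _ = \int[mu]_(x in `]a, b[ `&` `]c, d[) k x); last first.
    congr (fine (integral _ _ _)).
    apply/seteqP; split => [x|x []//] /=; rewrite !in_itv/= => /andP[cx xd].
    by rewrite cx xd (le_lt_trans ac cx) (lt_le_trans xd db).
  rewrite Rintegral_mkcondr; apply: eq_Rintegral => x _.
  by rewrite patchE indicE; case: ifP => _; rewrite ?mulr1 ?mulr0.
have mk := L1_meas Lk.
have mb n : mblfun `]a, b[ (bumpfun c d n.+1%:R^-1).
  by apply: cont_mblfun => //; apply: smoothD_cont; exact: bump_smoothD.
have [] // := @Rdct `]a, b[ (fun n x => k x * bumpfun c d n.+1%:R^-1 x)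
  (fun x => k x * (\1_`]c, d[%classic x : R)) (fun x => `|k x|).
- by move=> n; exact: measurable_funM.
- by apply: measurable_funM => //; exact: measurable_indic.
- by apply: aeW => x _; apply: cvgMr; exact: bump_cvg.
- exact: L1_norm.
- apply: aeW => x _ n; rewrite normrM ler_piMr//.
  have /andP[h1 h2] := @bump_bdd c d n.+1%:R^-1 x cd (harmonic_gt0 n).
  by rewrite ger0_norm.
Qed.

Lemma test_C1 a b phi : test_fun a b phi -> C1 phi (derive1 phi).
Proof.
move=> [sm _]; split=> [x|x].
  by rewrite derive1E; apply/derivableP; exact: (sm 0%N x).
apply: differentiable_continuous; apply/derivable1_diffP.
by have := sm 1%N x; rewrite derive1n1.
Qed.

(* Normalised difference of two bumps has mean zero, so its primitive is a test function. *)
Lemma bump_pair_test a b c d c' d' e : a < c -> c < d -> d < b -> a < c' -> c' < d' -> d' < b -> 0 < e ->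
  exists2 phi, test_fun a b phi &
    forall x, derive1 phi x = (\int[mu]_(t in `]a, b[) bumpfun c' d' e t) * bumpfun c d e x
      - (\int[mu]_(t in `]a, b[) bumpfun c d e t) * bumpfun c' d' e x.
Proof.
move=> ac cd db ac' cd' db' e0.
set m' := \int[mu]_(t in `]a, b[) bumpfun c' d' e t.
set m := \int[mu]_(t in `]a, b[) bumpfun c d e t.
pose h x := m' * bumpfun c d e x + (- m) * bumpfun c' d' e x.
have sh : smoothD h by apply: smoothD_lin; exact: bump_smoothD.
have ch := smoothD_cont sh.
have Lh x y : L1 `]x, y[ h by exact: cont_L1.
have ho x : (x <= Num.min c c') || (Num.max d d' <= x) -> h x = 0.
  rewrite le_min ge_max /h => /orP[] /andP[h1 h2]; rewrite /bumpfun !bump_out ?h1 ?h2 ?orbT//; ring.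
pose C0 := Num.min c c'; pose D0 := Num.max d d'.
have aC : a < C0 by rewrite lt_min ac.
have Db : D0 < b by rewrite gt_max db.
have CD : C0 < D0 by rewrite gt_min !lt_max cd.
have phi0 x : x <= C0 -> prim h a x = 0.
  move=> xC; apply: Rint_zero => t /=; rewrite in_itv/= => /andP[_ tx].
  by apply: ho; rewrite (le_trans (ltW tx) xC).
have cb c1 d1 : c1 < d1 -> L1 `]a, b[ (bumpfun c1 d1 e).
  by move=> ?; apply: cont_L1; apply: smoothD_cont; exact: bump_smoothD.
have phib : prim h a b = 0.
  rewrite /prim /h RintegralD//; [|by apply: L1Z => //; exact: cb..].
  by rewrite !RintegralZl//; [rewrite -/m -/m'; ring|exact: cb..].
have phi1 x : D0 <= x -> prim h a x = 0.
  have z y z : D0 <= y -> \int[mu]_(t in `]y, z[) h t = 0.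
    move=> Dy; apply: Rint_zero => t /=; rewrite in_itv/= => /andP[yt _].
    by apply: ho; rewrite (le_trans Dy (ltW yt)) orbT.
  have aD : a <= D0 by exact/ltW/(lt_trans aC).
  have phiD : prim h a D0 = 0.
    have := @prim_diff R h a b D0 b (Lh _ _) aD (ltW Db) (lexx b).
    by rewrite z// phib => /eqP; rewrite sub0r oppr_eq0 => /eqP.
  move=> Dx; have := @prim_diff R h a x D0 x (Lh _ _) aD Dx (lexx x).
  by rewrite z// phiD subr0.
have dphi x : is_derive x (1 : R) (prim h a) (h x).
  have [ax|xa] := ltP a x; first exact: prim_cont_derive.
  rewrite ho; last by rewrite (le_trans xa (ltW aC)).
  have z0 : is_derive x (1 : R) (fun=> 0 : R) 0 by exact: is_derive_cst.
  apply: isd_near z0.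
  near=> y; rewrite phi0//; apply: ltW; near: y; apply: lt_nbhsl.
  exact: le_lt_trans aC.
exists (prim h a); last by move=> x; rewrite derive1E; have [_ ->] := dphi x; rewrite /h mulNr.
split; first by apply: smoothD_smooth; exact: smoothD_int sh.
exists C0, D0; split => //; split => // x [/ltW|/ltW]; first exact: phi0.
exact: phi1.
Unshelve. all: by end_near. Qed.

(** Testing with the primitive of a normalised difference of two bumps and letting them tend to
    indicators shows that [k] has the same mean over all intervals compactly contained in ]a, b[.
    Its primitive is therefore affine, and Lebesgue differentiation gives a constant a.e. *)
Lemma ae_const a b k : a < b -> L1 `]a, b[ k ->
  (forall phi, test_fun a b phi -> \int[mu]_(x in `]a, b[) (k x * derive1 phi x) = 0) ->
  exists C, {ae mu, forall x, `]a, b[ x -> k x = C}.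
Proof.
move=> ab Lk hk.
have key c d c' d' : a < c -> c < d -> d < b -> a < c' -> c' < d' -> d' < b ->
    (d' - c') * (\int[mu]_(x in `]c, d[) k x) = (d - c) * (\int[mu]_(x in `]c', d'[) k x).
  move=> ac cd db ac' cd' db'.
  have L1one : L1 `]a, b[ (fun=> 1 : R) by apply: cont_L1; exact: cst_continuous.
  have m1 c1 d1 : a < c1 -> c1 < d1 -> d1 < b ->
    \int[mu]_(x in `]a, b[) bumpfun c1 d1 n.+1%:R^-1 x @[n --> \oo] --> (d1 - c1).
    move=> ac1 cd1 db1; have := bump_int_cvg L1one (ltW ac1) cd1 (ltW db1).
    rewrite Rintegral_cst// mul1r muooE ?ltW//.
    by under eq_fun do under eq_Rintegral do rewrite mul1r.
  have I1 := bump_int_cvg Lk (ltW ac) cd (ltW db).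
  have I2 := bump_int_cvg Lk (ltW ac') cd' (ltW db').
  pose I (f : nat -> R -> R) n := \int[mu]_(x in `]a, b[) f n x : R.
  pose A n := I (fun n => bumpfun c' d' n.+1%:R^-1) n * I (fun n x => k x * bumpfun c d n.+1%:R^-1 x) n.
  pose B n := I (fun n => bumpfun c d n.+1%:R^-1) n * I (fun n x => k x * bumpfun c' d' n.+1%:R^-1 x) n.
  have E1 : A @ \oo --> (d' - c') * (\int[mu]_(x in `]c, d[) k x).
    exact: cvgM (m1 _ _ ac' cd' db') I1.
  have E2 : B @ \oo --> (d - c) * (\int[mu]_(x in `]c', d'[) k x).
    exact: cvgM (m1 _ _ ac cd db) I2.
  suff AB : A = B by rewrite -(cvg_lim (@Rhausdorff R) E1) AB (cvg_lim (@Rhausdorff R) E2).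
  apply/funext => n; rewrite /A /B /I.
  have e0 := @harmonic_gt0 R n.
  have [phi tphi phiE] := bump_pair_test ac cd db ac' cd' db' e0.
  have := hk phi tphi; under eq_Rintegral do rewrite phiE.
  set m' := \int[mu]_(t in `]a, b[) bumpfun c' d' _ t.
  set m := \int[mu]_(t in `]a, b[) bumpfun c d _ t.
  clearbody m m'.
  have Lb c1 d1 : c1 < d1 -> L1 `]a, b[ (fun x => k x * bumpfun c1 d1 n.+1%:R^-1 x).
    move=> cd1; have := @L1_bdd R _ (moo a b) 1 _ (bumpfun c1 d1 n.+1%:R^-1) Lk.
    rewrite (_ : (fun x => _ * k x) = fun x => k x * bumpfun c1 d1 n.+1%:R^-1 x); last first.
      by apply/funext => x; rewrite mulrC.
    apply; first by apply: cont_mblfun => //; apply: smoothD_cont; exact: bump_smoothD.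
    apply: aeW => x _; have /andP[h1 h2] := @bump_bdd c1 d1 n.+1%:R^-1 x cd1 e0.
    by rewrite ger0_norm.
  rewrite (@eq_Rintegral _ _ _ mu _ (fun x => m' * (k x * bumpfun c d n.+1%:R^-1 x)
     - m * (k x * bumpfun c' d' n.+1%:R^-1 x))); last first.
    by move=> x _; move: (k x) (bumpfun c d _ x) (bumpfun c' d' _ x) m m' => *; ring.
  have L1c := Lb _ _ cd; have L2c := Lb _ _ cd'.
  rewrite (RintegralB (moo a b) (L1Z (moo a b) m' L1c) (L1Z (moo a b) m L2c)).
  rewrite (RintegralZl _ (moo a b) L1c) (RintegralZl _ (moo a b) L2c).
  by move=> /eqP; rewrite subr_eq0 => /eqP ->.
(* The middle third serves as the reference interval whose mean is the constant. *)
pose c0 := a + (b - a) / 3; pose d0 := a + 2 * (b - a) / 3.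
have ac0 : a < c0 by rewrite /c0; lra.
have cd0 : c0 < d0 by rewrite /c0 /d0; lra.
have db0 : d0 < b by rewrite /d0; lra.
pose C := (\int[mu]_(x in `]c0, d0[) k x) / (d0 - c0).
have intk c d : a < c -> c < d -> d < b -> \int[mu]_(x in `]c, d[) k x = C * (d - c).
  move=> ac cd db; have := key _ _ _ _ ac cd db ac0 cd0 db0.
  have dc0 : d0 - c0 != 0 by rewrite subr_eq0 gt_eqF.
  by move=> E; apply: (mulfI dc0); rewrite E /C; field.
exists C; apply: (aeS _ (FTC1_ae Lk)) => x h xab.
have {h} := h xab; move: xab; rewrite /= in_itv/= => /andP[ax xb] h.
pose p := (a + x) / 2.
have ap : a < p by rewrite /p; lra.
have px : p < x by rewrite /p; lra.
have h2 : is_derive x (1 : R) (prim k a) C.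
  have h0 : is_derive x (1 : R) (fun y => prim k a p + C * (y - p)) C.
    have := is_deriveD (is_derive_cst (prim k a p) x 1) (isdM (is_derive_cst C x 1)
      (is_deriveB (is_derive_id x (1 : R)) (is_derive_cst p x 1))).
    by rewrite /cst mul0r !add0r subr0 mulr1.
  apply: isd_near h0; near=> y.
  have py : p < y by near: y; exact: lt_nbhsr.
  have yb : y < b by near: y; exact: lt_nbhsl.
  have := @prim_diff R k a b p y Lk (ltW ap) (ltW py) (ltW yb).
  by rewrite intk// => <-; rewrite addrC subrK.
by case: h => _ <-; case: h2 => _ <-.
Unshelve. all: by end_near. Qed.

(** By integration by parts [f] minus the primitive of [g] has weak derivative 0, hence is a.e.
    constant. *)
Lemma weak_deriv_prim a b f g : a < b -> L1 `]a, b[ f -> L1 `]a, b[ g ->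
  (forall phi, test_fun a b phi ->
    \int[mu]_(x in `]a, b[) (f x * derive1 phi x) = - \int[mu]_(x in `]a, b[) (g x * phi x)) ->
  exists c, {ae mu, forall x, `]a, b[ x -> f x = c + prim g a x}.
Proof.
move=> ab Lf Lg hfg.
have L2p := prim_L2 0 Lg ab.
have Lp : L1 `]a, b[ (fun x => 0 + prim g a x) by exact: L2_L1.
have [||C hC] := @ae_const a b (fun x => f x - (0 + prim g a x)) ab.
- exact: L1B.
- move=> phi tphi; have pC := test_C1 tphi.
  have mL (k : R -> R) : L1 `]a, b[ k -> L1 `]a, b[ (fun x => k x * derive1 phi x).
    move=> Lk; have [M _ hM] := cont_bdd_ae a b pC.2.
    have := L1_bdd (moo a b) Lk (cont_mblfun (moo a b) pC.2) hM.
    by congr L1; apply/funext => x; rewrite mulrC.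
  under eq_Rintegral do rewrite mulrBl.
  rewrite RintegralB//; [|exact: mL..].
  rewrite hfg//; have := IBP 0 ab Lg pC.
  case: tphi => _ [c [d [ac [db h]]]].
  have -> : phi b = 0 by apply: h; right.
  have -> : phi a = 0 by apply: h; left.
  rewrite !mulr0 subr0 => /eqP; rewrite addr_eq0 => /eqP ->; ring.
exists C; apply: (aeS _ hC) => x h xab; have := h xab => <-; ring.
Qed.

End DuBoisReymond.

(** * Minimising sequences of quadratic functionals *)

Section Variational.
Context {R : realType}.

(** Common source of the Cauchy-Schwarz inequalities below, for sums and for integrals, and of the
    approximate Euler-Lagrange equation. The degenerate case r = 0 is included; there [q] must
    vanish. *)
Lemma quad_disc (p q r : R) : 0 <= r -> (forall t, 0 <= p + 2 * t * q + t ^+ 2 * r) -> q ^+ 2 <= p * r.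
Proof.
move=> r0 h; case: (ltgtP r 0) r0 => // [rp _|rz _].
  have := h (- q / r); rewrite (_ : p + _ + _ = (p * r - q ^+ 2) / r); last by field; rewrite gt_eqF.
  by rewrite pmulr_lge0 ?invr_gt0// subr_ge0.
case: (eqVneq q 0) => [->|q0]; first by rewrite rz expr0n mulr0.
(* With r = 0 the polynomial is affine in t with nonzero slope; at this t it takes the value -1. *)
have := h (- (p + 1) / (2 * q)); rewrite rz mulr0 addr0.
have -> : p + 2 * (- (p + 1) / (2 * q)) * q = - 1 by field.
by rewrite oppr_ge0 ler10.
Qed.

(* Minimising sequence of [b v v - 2 l v]: it is Cauchy by the parallelogram
   identity and satisfies the Euler-Lagrange equation in the limit.
   [lc u t v] stands for [u + t v]. *)
Lemma minimizing_sequence (V : Type) (lc : V -> R -> V -> V) (P : V -> Prop)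
    (b : V -> V -> R) (l : V -> R) (C : R) :
  (exists v, P v) -> (forall u v t, P u -> P v -> P (lc u t v)) ->
  (forall u v, P u -> P v -> b u v = b v u) ->
  (forall u v w t, P u -> P v -> P w -> b (lc u t v) w = b u w + t * b v w) ->
  (forall u, P u -> 0 <= b u u) ->
  (forall u v t, P u -> P v -> l (lc u t v) = l u + t * l v) ->
  (forall u, P u -> 2 * l u <= b u u + C) ->
  exists v_ : nat -> V, [/\ forall n, P (v_ n),
    forall n m, (n <= m)%N ->
      b (lc (v_ m) (-1) (v_ n)) (lc (v_ m) (-1) (v_ n)) <= 4 * 8^-1 ^+ n &
    forall v, P v -> forall n, (b (v_ n) v - l v) ^+ 2 <= 8^-1 ^+ n * b v v].
Proof.
move=> [v0 Pv0] PD bC bD b0 lD lC.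
have bDr u v w t : P u -> P v -> P w -> b w (lc u t v) = b w u + t * b w v.
  by move=> Pu Pv Pw; rewrite bC ?bD ?(bC u) ?(bC v)//; exact: PD.
pose J v := b v v - 2 * l v.
have JD u v t : P u -> P v -> J (lc u t v) = J u + 2 * t * (b u v - l v) + t ^+ 2 * b v v.
  move=> Pu Pv; have Puv := PD _ _ t Pu Pv.
  by rewrite /J bDr// !bD// lD// (bC v u)//; ring.
pose S := [set J v | v in [set v | P v]].
have S0 : S !=set0 by exists (J v0), v0.
have Slb : lbound S (- C).
  by move=> _ [v Pv <-]; rewrite /J; have := lC v Pv; lra.
have hlb : has_inf S by split => //; exists (- C).
pose m := inf S.
have mJ v : P v -> m <= J v by move=> Pv; apply: ge_inf; [exists (- C)|exists v].
have e0 n : 0 < 8^-1 ^+ n :> R by rewrite exprn_gt0.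
(* The rate 8^-n bounds squared distances. Weighted by 2^n it is still below 2^-n, which makes the
   increments summable in [L2_complete]. *)
have ex n : exists v, P v /\ J v <= m + 8^-1 ^+ n.
  have [_ [v Pv <-] Jv] := inf_adherent (e0 n) hlb.
  by exists v; split => //; exact: ltW.
have /choice[v_ hv_] := ex.
have Pv n : P (v_ n) by case: (hv_ n).
have Jv n : J (v_ n) <= m + 8^-1 ^+ n by case: (hv_ n).
exists v_; split => // [n k nk|v Pv' n].
- have Pd := PD _ _ (-1) (Pv k) (Pv n).
  (* Parallelogram identity at the midpoint of [v_ n] and [v_ k]: a quarter of b(d, d), for their
     difference d, is the mean of the two values of J minus J at the midpoint, hence at most 8^-n.
     This is the origin of the factor 4. *)
  have h1 := mJ _ (PD _ _ (2^-1) (Pv n) Pd); rewrite JD// in h1.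
  have E1 : b (v_ n) (lc (v_ k) (-1) (v_ n)) = b (v_ n) (v_ k) - b (v_ n) (v_ n).
    by rewrite bDr// mulN1r.
  have E2 : b (lc (v_ k) (-1) (v_ n)) (lc (v_ k) (-1) (v_ n)) =
      b (v_ k) (v_ k) - 2 * b (v_ n) (v_ k) + b (v_ n) (v_ n).
    by rewrite bD// E1 bDr// (bC (v_ k) (v_ n))//; ring.
  have E3 : l (lc (v_ k) (-1) (v_ n)) = l (v_ k) - l (v_ n) by rewrite lD// mulN1r.
  rewrite E1 E2 E3 in h1 *.
  have h3 : 8^-1 ^+ k <= 8^-1 ^+ n :> R by rewrite ler_wiXn2l// invf_le1// ler1n.
  have := Jv n; have := Jv k; move: h1; rewrite /J; lra.
(* Since [v_ n] is within 8^-n of the infimum, 8^-n + 2 t (b(v_n, v) - l(v)) + t^2 b(v, v) >= 0 for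
   every t, and the discriminant gives the claim. *)
- apply: quad_disc; first exact: b0.
  move=> t; have := mJ _ (PD _ _ t (Pv n) Pv'); rewrite JD//.
  by have := Jv n; lra.
Qed.

End Variational.

(** * Fatou's lemma and completeness of L^2 *)

Section L2complete.
Context {R : realType}.
Local Notation mu := (@lebesgue_measure R).
Implicit Types (a b c d x y e : R) (f g k v dv : R -> R).

Lemma limn_einf_ub (u : nat -> \bar R) C : (forall n, u n <= C)%E -> (limn_einf u <= C)%E.
Proof.
move=> uC; rewrite limn_einf_lim; apply: lime_le; first exact: is_cvg_einfs.
apply: nearW => n; apply: le_trans (uC n); apply: ereal_inf_lbound.
by exists n => //=.
Qed.

Lemma Rfatou (D : set R) (f_ : nat -> R -> R) f C : mbl D ->
  (forall n, L1 D (f_ n)) -> (forall n x, D x -> 0 <= f_ n x) -> mblfun D f ->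
  {ae mu, forall x, D x -> f_ n x @[n --> \oo] --> f x} ->
  (forall n, \int[mu]_(x in D) f_ n x <= C) ->
  L1 D f /\ \int[mu]_(x in D) f x <= C.
Proof.
move=> mD Lf f0 mf f_f fC.
have mf_ n := L1_meas (Lf n).
have fge0 : {ae mu, forall x, D x -> 0 <= f x}.
  apply: (aeS _ f_f) => x h Dx; have := h Dx => {}h.
  rewrite -(cvg_lim (@Rhausdorff R) h); apply: limr_ge; first by apply/cvg_ex; exists (f x).
  by apply: nearW => n; exact: f0.
have H : (\int[mu]_(x in D) `|(f x)%:E| <= C%:E)%E.
  have -> : (\int[mu]_(x in D) `|(f x)%:E| = \int[mu]_(x in D) limn_einf (fun n => (f_ n x)%:E))%E.
    apply: ae_eq_integral => //.
    - by apply: measurableT_comp => //; exact/measurable_EFinP.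
    - apply: (@measurableT_comp _ _ _ _ _ _ -%E) => //.
      by apply: measurable_fun_limn_esup => n; apply: measurableT_comp => //; exact/measurable_EFinP.
    - apply: (aeS2 _ f_f fge0) => x h1 h2 Dx.
      rewrite gee0_abs ?lee_fin ?h2//; apply/esym.
      have h : (f_ n x)%:E @[n --> \oo] --> (f x)%:E.
        by apply: cvg_EFin; [exact: nearW|exact: h1].
      by have [-> _] := cvg_limn_einf_sup h.
  apply: (@le_trans _ _ (limn_einf (fun n => \int[mu]_(x in D) (f_ n x)%:E))%E).
    apply: (@fatou _ _ _ mu D mD (fun n x => (f_ n x)%:E)).
    - by move=> n; exact/measurable_EFinP.
    - by move=> n x Dx; rewrite lee_fin f0.
  by apply: limn_einf_ub => n; rewrite -EFin_Rint// lee_fin.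
have Lf1 : L1 D f.
  apply/integrableP; split; first exact/measurable_EFinP.
  by apply: le_lt_trans H _; rewrite ltry.
split => //; rewrite -lee_fin EFin_Rint//.
apply: le_trans H; apply: le_integral => //.
  exact: integrable_abse.
by move=> x _ /=; rewrite lee_fin ler_norm.
Qed.

(** By monotone convergence the sum of the absolute values has integral at most 2 K, so it is finite
    a.e. and the series converges absolutely there. *)
Lemma L1_series_cvg (D : set R) (d_ : nat -> R -> R) (K : R) : mbl D ->
  (forall n, L1 D (d_ n)) -> (forall n, \int[mu]_(x in D) `|d_ n x| <= K * 2^-1 ^+ n) ->
  {ae mu, forall x, D x -> cvgn (series (fun n => d_ n x))}.
Proof.
move=> mD Ld hd.
have K0 : 0 <= K by have := hd 0%N; rewrite expr0 mulr1; apply: le_trans; exact: Rintegral_ge0.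
have md n := L1_meas (Ld n).
pose g x := (\sum_(n <oo) `|d_ n x|%:E)%E.
have Ig : (\int[mu]_(x in D) g x <= (2 * K)%:E)%E.
  rewrite /g integral_nneseries//; last first.
    by move=> n; apply/measurable_EFinP; exact: measurableT_comp.
  apply: lime_le; first by apply: is_cvg_nneseries => n _ _; apply: integral_ge0.
  apply: nearW => n; rewrite /=.
  apply: (@le_trans _ _ (\sum_(0 <= i < n) (K * 2^-1 ^+ i)%:E)%E).
    by apply: lee_sum => i _; rewrite -(EFin_Rint mD (L1_norm (Ld i))) lee_fin.
  rewrite sumEFin lee_fin -mulr_sumr mulrC ler_wpM2r//.
  suff -> : \sum_(0 <= i < n) 2^-1 ^+ i = 2 - 2 * 2^-1 ^+ n :> R.
    by rewrite gerBl mulr_ge0// exprn_ge0// invr_ge0.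
  elim: n => [|n IH]; first by rewrite big_nil expr0; ring.
  by rewrite big_nat_recr//= IH exprS; field.
have mg : measurable_fun (D : set (measurableTypeR R)) g.
  apply: ge0_emeasurable_sum => //.
  by move=> n _; apply/measurable_EFinP; exact: measurableT_comp.
have g0 x : (0 <= g x)%E by apply: nneseries_ge0 => n _ _; rewrite lee_fin.
have ig : mu.-integrable D g.
  apply/integrableP; split => //.
  under eq_integral do rewrite gee0_abs//.
  by apply: le_lt_trans Ig _; rewrite ltry.
apply: (aeS _ (integrable_ae mD ig)) => x h Dx; have := h Dx => gfin.
apply: normed_cvg; apply: nondecreasing_is_cvgn.
  by apply/nondecreasing_seqP => n; rewrite [leRHS]seriesSr lerDl/= normr_ge0.
exists (fine (g x)) => _ [n _ <-].
rewrite -lee_fin fineK// /series/= -sumEFin.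
by apply: nneseries_lim_ge => i _ _; rewrite lee_fin.
Qed.

(** The inequality |d| <= 2^-n + 2^n d^2 turns the bound on the squares of the increments into a
    summable L^1 bound, whence an a.e. limit; Fatou's lemma then returns the same bound for the
    distance to the limit. *)
Lemma L2_complete a b (f_ : nat -> R -> R) (K : R) :
  (forall n, L2 `]a, b[ (f_ n)) ->
  (forall n m, (n <= m)%N -> \int[mu]_(x in `]a, b[) (f_ m x - f_ n x) ^+ 2 <= K * 8^-1 ^+ n) ->
  exists2 f, L2 `]a, b[ f &
    forall n, \int[mu]_(x in `]a, b[) (f x - f_ n x) ^+ 2 <= K * 8^-1 ^+ n.
Proof.
move=> Lf hf.
pose d_ n x := f_ n.+1 x - f_ n x.
have Ld n : L2 `]a, b[ (d_ n) by exact: L2B.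
have L1d n : L1 `]a, b[ (d_ n) by exact: L2_L1.
have K0 : 0 <= K.
  by have := hf _ _ (leqnn 0); rewrite expr0 mulr1; apply: le_trans; apply: Rintegral_ge0 => x _; exact: sqr_ge0.
have hd n : \int[mu]_(x in `]a, b[) `|d_ n x| <= (fine (mu `]a, b[) + K) * 2^-1 ^+ n.
  have p2 : 0 < 2^-1 ^+ n :> R by rewrite exprn_gt0.
  have L1s : L1 `]a, b[ (fun x => 2^-1 ^+ n * 1 + 2 ^+ n * d_ n x ^+ 2).
    by apply: L1D => //; apply: L1Z => //; [exact: L1_cst|case: (Ld n)].
  apply: (@le_trans _ _ (\int[mu]_(x in `]a, b[) (2^-1 ^+ n * 1 + 2 ^+ n * d_ n x ^+ 2))).
    apply: Rint_ae_le => //; first exact: L1_norm.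
    apply: aeW => x _; rewrite -(real_normK (num_real (d_ n x))).
    have t0 : 0 < 2 ^+ n :> R by rewrite exprn_gt0.
    rewrite exprVn -subr_ge0 (_ : _ - _ = 2 ^+ n *
      ((`|d_ n x| - (2 ^+ n)^-1 / 2) ^+ 2 + 3 / 4 * (2 ^+ n)^-1 ^+ 2)).
      by rewrite mulr_ge0 ?(ltW t0)// addr_ge0 ?sqr_ge0// mulr_ge0// sqr_ge0.
    by field; rewrite gt_eqF.
  have L1c : L1 `]a, b[ (fun=> 1 : R) by exact: L1_cst.
  have L1q : L1 `]a, b[ (fun x => d_ n x ^+ 2) by case: (Ld n).
  rewrite (RintegralD (moo a b) (L1Z (moo a b) _ L1c) (L1Z (moo a b) _ L1q)).
  rewrite (RintegralZl _ (moo a b) L1c) (RintegralZl _ (moo a b) L1q).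
  rewrite Rintegral_cst// mul1r [leRHS]mulrDl [X in X + _]mulrC lerD2l.
  apply: (@le_trans _ _ (2 ^+ n * (K * 8^-1 ^+ n))).
    by rewrite ler_wpM2l ?exprn_ge0//; exact: (hf n n.+1 (leqnSn n)).
  rewrite mulrCA -exprMn ler_wpM2l// lerXn2r ?nnegrE//; lra.
have cv := L1_series_cvg (moo a b) L1d hd.
(* Taking the upper limit defines [f] everywhere and keeps it measurable, whatever happens on the
   null set of divergence. *)
pose f x := fine (limn_esup (fun n => (f_ n x)%:E)).
have mf : mblfun `]a, b[ f.
  apply: measurableT_comp => //.
  by apply: measurable_fun_limn_esup => n; apply/measurable_EFinP; case: (Lf n).
have f_f : {ae mu, forall x, `]a, b[ x -> f_ n x @[n --> \oo] --> f x}.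
  apply: (aeS _ cv) => x h Dx; have {}h := h Dx.
  have c : cvgn (f_ ^~ x).
    have -> : f_ ^~ x = fun n => f_ 0%N x + series (fun n => d_ n x) n.
      apply/funext => n; rewrite /series/= /d_ telescope_sumr//; ring.
    by apply: is_cvgD => //; exact: is_cvg_cst.
  move/cvg_ex : c => [l hl]; have hE : (f_ n x)%:E @[n --> \oo] --> l%:E.
    by apply: cvg_EFin; [exact: nearW|exact: hl].
  by rewrite /f; have [_ ->] := cvg_limn_einf_sup hE.
have fat n : L1 `]a, b[ (fun x => (f x - f_ n x) ^+ 2) /\
    \int[mu]_(x in `]a, b[) (f x - f_ n x) ^+ 2 <= K * 8^-1 ^+ n.
  have mn := L2_meas (Lf n).
  apply: (@Rfatou `]a, b[ (fun p x => (f_ (p + n)%N x - f_ n x) ^+ 2)) => //.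
  - by move=> k; have [] := L2B (moo a b) (Lf (k + n)%N) (Lf n).
  - by move=> k x _; exact: sqr_ge0.
  - by apply: measurable_funX; exact: measurable_funB.
  - apply: (aeS _ f_f) => x h Dx; have {}h := h Dx.
    have h2 : f_ (p + n)%N x @[p --> \oo] --> f x by rewrite (cvg_shiftn n (f_ ^~ x)).
    rewrite [X in _ --> X]expr2.
    under eq_fun do rewrite expr2.
    by apply: cvgM; apply: cvgB => //; exact: cvg_cst.
  - by move=> k; apply: hf; exact: leq_addl.
exists f => [|n]; last by case: (fat n).
have L0 : L2 `]a, b[ (fun x => f x - f_ 0%N x).
  by split; [apply: measurable_funB => //; case: (Lf 0%N)|case: (fat 0%N)].
by have := L2D (moo a b) L0 (Lf 0%N); congr L2; apply/funext => x; ring.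
Qed.

End L2complete.

Lemma cvg_sqr {R : realType} (u : nat -> R) (l : R) :
  u n @[n --> \oo] --> l -> u n ^+ 2 @[n --> \oo] --> l ^+ 2.
Proof.
move=> h; rewrite [l ^+ 2]expr2.
have -> : (fun n => u n ^+ 2) = (fun n => u n * u n) by apply/funext => n; rewrite expr2.
exact: cvgM.
Qed.

(** * Translation invariance of the Lebesgue integral *)

Section Shift.
Context {R : realType}.
Local Notation mu := (@lebesgue_measure R).
Implicit Types (a b c d x y e h : R) (f g v dv : R -> R).

Lemma shift_mbl h : measurable_fun [set: measurableTypeR R] (fun x : measurableTypeR R => (x + h : measurableTypeR R)).
Proof. exact: (@measurable_funD _ (measurableTypeR R) R setT id (cst h)). Qed.

Lemma preim_shift c d h : (fun x => x + h) @^-1` `]c + h, d + h[ = `]c, d[%classic.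
Proof. by apply/seteqP; split => x /=; rewrite !in_itv/= !ltrD2r. Qed.

(** The image of the measure under the translation agrees with it on half-open intervals, which
    determine the Lebesgue measure. *)
Lemma mu_shift h (S : set R) : mbl S -> mu ((fun x => x + h) @^-1` S) = mu S.
Proof.
move=> mS; apply/esym.
pose nu := pushforward mu (fun x : measurableTypeR R => (x + h : measurableTypeR R)).
pose M := [the measure _ _ of measure_function_pushforward__canonical__measure_function_Measure mu (shift_mbl h)].
apply: (@lebesgue_measure_unique R M) => // _ [[x y] _ <-] /=.
rewrite /pushforward.
have -> : (fun t => t + h) @^-1` `]x, y] = `](x - h), (y - h)]%classic.
  by apply/seteqP; split => t /=; rewrite !in_itv/= ltrBlDr lerBrDr.
rewrite !lebesgue_measure_itv/= !lte_fin ltrD2r; case: ifP => // _.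
by rewrite -!EFinD; congr EFin; ring.
Qed.

Lemma ae_shift h (P : R -> Prop) : {ae mu, forall x, P x} -> {ae mu, forall x, P (x + h)}.
Proof.
move=> [N [mN N0 PN]]; exists ((fun x => x + h) @^-1` N); split => //.
- by rewrite -[X in measurable X]setTI; exact: shift_mbl.
- by rewrite mu_shift.
- by move=> x nPx; apply: PN.
Qed.

Lemma mbl_shift c d h f : mblfun `]c + h, d + h[ f -> mblfun `]c, d[ (fun x => f (x + h)).
Proof.
move=> mf; rewrite -(preim_shift c d h).
apply: (@measurable_comp _ _ _ _ _ _ `]c + h, d + h[%classic f) => //.
- by move=> _ [x /= xcd <-].
- exact: measurable_funTS (shift_mbl h).
Qed.

Lemma L1_shiftT h f : L1 setT f -> L1 setT (fun x => f (x + h)) /\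
  forall c d, \int[mu]_(x in `]c, d[) f (x + h) = \int[mu]_(x in `]c + h, d + h[) f x.
Proof.
move=> Lf; have mf := L1_meas Lf.
pose phi := (fun x : measurableTypeR R => (x + h : measurableTypeR R)).
have mphi : measurable_fun setT phi := shift_mbl h.
pose M := [the measure _ _ of measure_function_pushforward__canonical__measure_function_Measure mu mphi].
have E (D : set R) (g : R -> \bar R) : mbl D -> (\int[M]_(x in D) g x = \int[mu]_(x in D) g x)%E.
  by move=> mD; apply: eq_measure_integral => S mS _; rewrite /M/= /pushforward mu_shift.
have mfe : measurable_fun (setT : set (measurableTypeR R)) (EFin \o f) by exact/measurable_EFinP.
have Ls : L1 setT (fun x => f (x + h)).
  apply/integrableP; split.
    by apply/measurable_EFinP; exact: measurableT_comp mf mphi.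
  have := @ge0_integral_pushforward _ _ _ _ R phi mphi mu setT (fun x => `|(f x)%:E|)%E measurableT.
  rewrite preimage_setT => /(_ _ _) <-//.
  - rewrite -[X in (X < _)%E]/(\int[M]_(x in setT) `|(f x)%:E|)%E E//.
    by move/integrableP : Lf => [].
  - exact: measurableT_comp.
split => // c d; rewrite -[in LHS](preim_shift c d h).
pose S : set R := `]c + h, d + h[%classic; rewrite -/S.
have mphiS : mbl (phi @^-1` S) by rewrite -[X in measurable X]setTI; exact: (shift_mbl h measurableT (moo _ _)).
have := @integral_pushforward _ _ _ _ R phi mphi mu S (EFin \o f) mfe (L1S measurableT mphiS (@subsetT _ _) Ls) (moo _ _).
rewrite -[X in X = _ -> _]/(\int[M]_(x in S) (f x)%:E)%E E; last exact: moo.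
by rewrite /Rintegral => ->.
Qed.

Lemma shiftoo c d h x : `]c, d[ x -> `]c + h, d + h[ (x + h).
Proof. by rewrite /= !in_itv/= !ltrD2r. Qed.

Lemma L1_shift c d h f : L1 `]c + h, d + h[ f -> L1 `]c, d[ (fun x => f (x + h)).
Proof.
move=> Lf; have [Ls _] := L1_shiftT h (L1_patch Lf).
apply: (L1_ae (moo c d) (f := fun x => (f \_ `]c + h, d + h[) (x + h))).
- exact: L1S Ls.
- exact: mbl_shift (L1_meas Lf).
- by apply: aeW => x xcd; rewrite patchoo//; exact: shiftoo.
Qed.

Lemma L2_shift c d h f : L2 `]c + h, d + h[ f -> L2 `]c, d[ (fun x => f (x + h)).
Proof. by move=> [mf Lf]; split; [exact: mbl_shift|exact: (L1_shift Lf)]. Qed.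

Lemma Rint_shift c d h f : L1 `]c + h, d + h[ f ->
  \int[mu]_(x in `]c, d[) f (x + h) = \int[mu]_(x in `]c + h, d + h[) f x.
Proof.
move=> Lf; have [_ /(_ c d) Es] := L1_shiftT h (L1_patch Lf).
transitivity (\int[mu]_(x in `]c, d[) (f \_ `]c + h, d + h[) (x + h)).
  by apply: eq_Rintegral => x; rewrite inE => xcd; rewrite patchoo//; exact: shiftoo.
rewrite Es; apply: eq_Rintegral => x; rewrite inE => xcd; exact: patchoo.
Qed.

End Shift.

(** * Translations and difference quotients in the limit of small steps *)

Section ShiftLimit.
Context {R : realType}.
Local Notation mu := (@lebesgue_measure R).
Implicit Types (a b c d x y e : R) (f g v dv : R -> R).

Variables (h_ : nat -> R) (dl : R).
Hypothesis h0 : forall n, 0 < h_ n.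
Hypothesis hdl : forall n, h_ n <= dl.
Hypothesis hcvg : h_ n @[n --> \oo] --> (0 : R).

Lemma h_within c d x n : `]c, d[ x -> `]c, d + dl[ (x + h_ n).
Proof.
rewrite /= !in_itv/= => /andP[cx xd]; have := h0 n; have := hdl n => ? ?; apply/andP; split; lra.
Qed.

Lemma L1_h c d f n : L1 `]c, d + dl[ f -> L1 `]c, d[ (fun x => f (x + h_ n)).
Proof.
move=> Lf; apply: L1_shift; apply: L1_oo Lf; first by rewrite lerDl ltW.
by rewrite lerD2l.
Qed.

Lemma L2_h c d f n : L2 `]c, d + dl[ f -> L2 `]c, d[ (fun x => f (x + h_ n)).
Proof.
move=> Lf; apply: L2_shift; apply: L2_oo Lf; first by rewrite lerDl ltW.
by rewrite lerD2l.
Qed.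

Lemma Rint_h_le c d f n : L1 `]c, d + dl[ f -> (forall x, 0 <= f x) -> c <= d ->
  \int[mu]_(x in `]c, d[) f (x + h_ n) <= \int[mu]_(x in `]c, d + dl[) f x.
Proof.
move=> Lf f0 cd; have := h0 n; have := hdl n => ? ?.
have Lf1 : L1 `]c, d + h_ n[ f by apply: L1_oo Lf; lra.
have Lf2 : L1 `]c + h_ n, d + h_ n[ f by apply: L1_oo Lf1; lra.
rewrite Rint_shift// (@Rint_split _ c (d + h_ n) (d + dl))//; [|lra|lra].
rewrite [X in _ <= X + _](@Rint_split _ c (c + h_ n) (d + h_ n))//; [|lra|lra].
rewrite -[leLHS]add0r -[leLHS]addr0 lerD ?lerD2r//; exact: Rintegral_ge0.
Qed.

(** For a continuous approximant [g] of [f] dominated convergence applies; translation invariance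
    bounds the error of the shifted approximation by that of the unshifted one on the larger
    interval. *)
Lemma L1_shift_cvg c d f : c <= d -> L1 `]c, d + dl[ f ->
  \int[mu]_(x in `]c, d[) `|f (x + h_ n) - f x| @[n --> \oo] --> (0 : R).
Proof.
move=> cd Lf; apply/cvgr0Pnorm_le => e e0.
have dl0 : 0 < dl := lt_le_trans (h0 0) (hdl 0).
have e3 : 0 < e / 3 by rewrite divr_gt0.
have [g cg gf] := L1_approx e3 Lf.
have cgs n : continuous (fun x => g (x + h_ n)).
  move=> x; apply: (@continuous_comp _ _ _ (fun x => x + h_ n) g); last exact: cg.
  by apply: cvgD; [exact: cvg_id|exact: cvg_cst].
have [M M0 hM] := cont_bdd c (d + dl) cg.
have gx x : g (x + h_ n) @[n --> \oo] --> g x.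
  have xh : x + h_ n @[n --> \oo] --> x + 0 by apply: cvgD => //; exact: cvg_cst.
  rewrite addr0 in xh; exact: (cvg_comp _ _ xh (cg x)).
have gM x n : `]c, d[ x -> `|g (x + h_ n)| <= M.
  move=> /(h_within n); rewrite /= in_itv/= => /andP[c1 d1]; apply: hM.
  by rewrite (ltW c1) (ltW d1).
have [_ H _] := @Rdct R `]c, d[ (fun n x => g (x + h_ n)) g (fun=> M) (moo c d)
  (fun n => cont_mblfun (moo c d) (cgs n)) (cont_mblfun (moo c d) cg)
  (aeT (fun x _ => gx x)) (L1_cst (moo c d) M (muoo c d)) (aeT (fun x xcd n => gM x n xcd)).
near=> n.
have H2 : `|\int[mu]_(x in `]c, d[) `|g (x + h_ n) - g x| | <= e / 3.
  by near: n; move/cvgr0Pnorm_le : H; apply.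
have L1r : L1 `]c, d + dl[ (fun x => f x - g x) by apply: L1B => //; exact: cont_L1.
have L1n := L1_norm L1r.
have cdd : d <= d + dl by rewrite lerDl ltW.
have Lcd : L1 `]c, d[ f by apply: L1_oo Lf.
have Lg : L1 `]c, d[ g by exact: cont_L1.
have Lgs : L1 `]c, d[ (fun x => g (x + h_ n)) by exact: cont_L1.
have Lfs := L1_h n Lf.
rewrite ger0_norm ?Rintegral_ge0// in H2; rewrite ger0_norm ?Rintegral_ge0//.
apply: (@le_trans _ _ (\int[mu]_(x in `]c, d[) (`|f (x + h_ n) - g (x + h_ n)|
   + `|g (x + h_ n) - g x| + `|f x - g x|))).
  apply: Rint_ae_le => //.
  - by apply: L1_norm; exact: L1B.
  - by apply: L1D => //; [apply: L1D => //|]; apply: L1_norm; exact: L1B.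
  - apply: aeW => x _; rewrite (distrC (f x)).
    rewrite [X in `|X| <= _](_ : _ = (f (x + h_ n) - g (x + h_ n)) + (g (x + h_ n) - g x) + (g x - f x)); last by ring.
    by apply: le_trans (ler_normD _ _) _; rewrite lerD2r ler_normD.
rewrite RintegralD//; [|by apply: L1D => //; apply: L1_norm; exact: L1B|by apply: L1_norm; exact: L1B].
rewrite RintegralD//; [|by apply: L1_norm; exact: L1B..].
have E1 := le_trans (Rint_h_le n L1n (fun x => normr_ge0 _) cd) gf.
have E2 : \int[mu]_(x in `]c, d[) `|f x - g x| <= e / 3.
  apply: le_trans gf; rewrite [leRHS](@Rint_split _ c d)//.
  by rewrite lerDl; exact: Rintegral_ge0.
lra.
Unshelve. all: by end_near. Qed.

(** If u is in L^2 then u |u| is in L^1: this inequality transfers continuity of translations from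
    L^1 to L^2. *)
Lemma sqr_dist_le (s t : R) : (s - t) ^+ 2 <= 2 * `|s * `|s| - t * `|t| |.
Proof.
wlog ts : s t / t <= s.
  move=> h; have [/h//|/ltW/h] := leP t s.
  by rewrite -[in X in _ -> X]sqrrN opprB distrC.
have d0 : 0 <= s - t by rewrite subr_ge0.
apply: (@le_trans _ _ (2 * (s * `|s| - t * `|t|))); last by rewrite ler_wpM2l// ler_norm.
have [s0|s0] := leP 0 s; have [t0|t0] := leP 0 t;
  rewrite ?(ger0_norm s0) ?(ger0_norm t0) ?(ltr0_norm s0) ?(ltr0_norm t0).
- have := mulr_ge0 d0 t0; have := mulr_ge0 d0 s0; nra.
- have := sqr_ge0 (s + t); nra.
- lra.
- have s0' : 0 <= - s by rewrite oppr_ge0 ltW.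
  have t0' : 0 <= - t by rewrite oppr_ge0 ltW.
  have := mulr_ge0 d0 t0'; have := mulr_ge0 d0 s0'; nra.
Qed.

Lemma L2_shift_cvg c d u : c <= d -> L2 `]c, d + dl[ u ->
  \int[mu]_(x in `]c, d[) (u (x + h_ n) - u x) ^+ 2 @[n --> \oo] --> (0 : R).
Proof.
move=> cd Lu; have [mu_ Lu2] := Lu.
have dl0 : 0 < dl := lt_le_trans (h0 0) (hdl 0).
have cdd : d <= d + dl by rewrite lerDl ltW.
pose v x := u x * `|u x|.
have Lv : L1 `]c, d + dl[ v.
  apply: (L1_dom (moo _ _) _ Lu2); first by apply: measurable_funM => //; exact: measurableT_comp.
  by apply: aeW => x _; rewrite /v normrM normr_id -expr2 real_normK// num_real.
have := L1_shift_cvg cd Lv => /cvgr0Pnorm_le H.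
have Lcd : L2 `]c, d[ u by apply: L2_oo Lu.
have Lvcd : L1 `]c, d[ v by apply: L1_oo Lv.
apply/cvgr0Pnorm_le => e e0; have e2 : 0 < e / 2 by rewrite divr_gt0.
near=> n.
have : `|\int[mu]_(x in `]c, d[) `|v (x + h_ n) - v x| | <= e / 2.
  by near: n; exact: H.
rewrite ger0_norm ?Rintegral_ge0// => H3.
rewrite ger0_norm; last by apply: Rintegral_ge0 => x _; exact: sqr_ge0.
have LB := L1_norm (L1B (moo c d) (L1_h n Lv) Lvcd).
apply: (@le_trans _ _ (\int[mu]_(x in `]c, d[) (2 * `|v (x + h_ n) - v x|))).
  apply: Rint_ae_le => //.
  - by have [] := L2B (moo c d) (L2_h n Lu) Lcd.
  - exact: L1Z.
  - apply: aeT => x _; rewrite /v; move: (u _) (u x) => s t.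
    exact: sqr_dist_le.
by rewrite RintegralZl//; lra.
Unshelve. all: by end_near. Qed.

(* Truncating by [phi] splits [f_] into a dominated part and a part below
   [phi_ - min phi_ phi], whose integral also tends to 0. *)
Lemma generalized_dct (D : set R) (f_ phi_ : nat -> R -> R) (phi : R -> R) : mbl D ->
  (forall n, mblfun D (f_ n)) -> (forall n x, 0 <= f_ n x) ->
  (forall n, L1 D (phi_ n)) -> L1 D phi ->
  (forall n, {ae mu, forall x, D x -> f_ n x <= phi_ n x}) ->
  (forall x, 0 <= phi x) -> (forall n x, 0 <= phi_ n x) ->
  {ae mu, forall x, D x -> f_ n x @[n --> \oo] --> (0 : R)} ->
  {ae mu, forall x, D x -> phi_ n x @[n --> \oo] --> phi x} ->
  \int[mu]_(x in D) phi_ n x @[n --> \oo] --> \int[mu]_(x in D) phi x ->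
  \int[mu]_(x in D) f_ n x @[n --> \oo] --> (0 : R).
Proof.
move=> mD mf f0 Lphi_ Lphi fphi phi0 phi_0 f_0 phi_cvg Iphi.
have mphi := L1_meas Lphi; have mphi_ n := L1_meas (Lphi_ n).
have mm (k : nat -> R -> R) n : mblfun D (k n) -> mblfun D (fun x => Num.min (k n x) (phi x)).
  by move=> mk; exact: measurable_minr.
have mindom (k : nat -> R -> R) : (forall n x, 0 <= k n x) ->
    {ae mu, forall x, D x -> forall n, `|Num.min (k n x) (phi x)| <= phi x}.
  by move=> k0; apply: aeT => x _ n; rewrite ger0_norm ?ge_min ?lexx ?orbT// le_min k0 phi0.
have f_0' : {ae mu, forall x, D x -> Num.min (f_ n x) (phi x) @[n --> \oo] --> (0 : R)}.
  apply: (aeS _ f_0) => x h Dx; apply: (squeeze_cvgr _ (cvg_cst 0) (h Dx)).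
  by apply: nearW => n; rewrite le_min f0 phi0/= ge_min lexx.
have phi_cvg' : {ae mu, forall x, D x -> Num.min (phi_ n x) (phi x) @[n --> \oo] --> phi x}.
  apply: (aeS _ phi_cvg) => x h Dx; have {}h := h Dx.
  apply/cvgrPdist_le => e e0; move/cvgrPdist_le : h => /(_ e e0).
  apply: filterS => n; rewrite /=; have [pp|pp] := leP (phi_ n x) (phi x) => //.
  by move=> _; rewrite subrr normr0 ltW.
have [_ _ I1] := @Rdct R D (fun n x => Num.min (f_ n x) (phi x)) (fun=> 0) phi mD
  (fun n => mm _ _ (mf n)) (@measurable_cst _ _ (measurableTypeR R) _ D (0 : R)) f_0' Lphi (mindom _ f0).
have [_ _ I2] := @Rdct R D (fun n x => Num.min (phi_ n x) (phi x)) phi phi mD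
  (fun n => mm _ _ (mphi_ n)) mphi phi_cvg' Lphi (mindom _ phi_0).
rewrite [X in _ --> X]Rint_zero// in I1.
have I3 : (\int[mu]_(x in D) Num.min (f_ n x) (phi x) + (\int[mu]_(x in D) phi_ n x -
    \int[mu]_(x in D) Num.min (phi_ n x) (phi x))) @[n --> \oo] --> (0 : R).
  by rewrite -[X in _ --> X](addr0 (0 : R)) -[X in 0 + X](subrr (\int[mu]_(x in D) phi x)); apply: cvgD => //; exact: cvgB.
apply: (squeeze_cvgr _ (cvg_cst 0) I3).
apply: nearW => n; rewrite Rintegral_ge0//=.
have Lmin1 : L1 D (fun x => Num.min (f_ n x) (phi x)).
  apply: (L1_dom mD _ Lphi); first exact: mm.
  by apply: (aeS _ (mindom _ f0)) => x h Dx; exact: h.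
have Lmin2 : L1 D (fun x => Num.min (phi_ n x) (phi x)).
  apply: (L1_dom mD _ Lphi); first exact: mm.
  by apply: (aeS _ (mindom _ phi_0)) => x h Dx; exact: h.
have Lf : L1 D (f_ n).
  apply: (L1_dom mD _ (Lphi_ n)) => //.
  by apply: (aeS _ (fphi n)) => x h Dx; rewrite ger0_norm// h.
rewrite -(RintegralB mD (Lphi_ n) Lmin2) -(RintegralD mD Lmin1 (L1B mD (Lphi_ n) Lmin2)).
apply: Rint_ae_le => //; first by apply: L1D => //; exact: L1B.
apply: (aeS _ (fphi n)) => x h Dx; have := h Dx.
by have [|] := leP (f_ n x) (phi x); have [|] := leP (phi_ n x) (phi x); lra.
Qed.

Lemma Rint_indic a b c d f : a <= c -> d <= b ->
  \int[mu]_(x in `]c, d[) f x = \int[mu]_(x in `]a, b[) (f x * (\1_(`]c, d[%classic : set R) x : R)).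
Proof.
move=> ac db; rewrite [LHS](_ : _ = \int[mu]_(x in `]a, b[ `&` `]c, d[) f x); last first.
  congr (fine (integral _ _ _)).
  apply/seteqP; split => [x|x []//] /=; rewrite !in_itv/= => /andP[cx xd].
  by rewrite cx xd (le_lt_trans ac cx) (lt_le_trans xd db).
rewrite Rintegral_mkcondr; apply: eq_Rintegral => x _.
by rewrite patchE indicE; case: ifP => _; rewrite ?mulr1 ?mulr0.
Qed.

Lemma small_int e f : L1 `]e, e + dl[ f ->
  \int[mu]_(x in `]e, e + h_ n[) f x @[n --> \oo] --> (0 : R).
Proof.
move=> Lf; have mf := L1_meas Lf.
have [|||||_ _] := @Rdct R `]e, e + dl[ (fun n x => f x * (\1_(`]e, e + h_ n[%classic : set R) x : R))
  (fun=> 0) (fun x => `|f x|) (moo _ _).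
- by move=> n; apply: measurable_funM => //; exact: measurable_indic.
- exact: measurable_cst.
- apply: aeT => x; rewrite /= in_itv/= => /andP[ex _].
  have /cvgr0Pnorm_le H := hcvg.
  have xe : 0 < x - e by rewrite subr_gt0.
  apply: cvg_near_cst; near=> n.
  rewrite indicE memNset ?mulr0//= in_itv/= ex/= ltNge; apply/negP/negPn.
  rewrite -lerBrDl; apply: le_trans (ler_norm _) _; near: n; exact: H.
- exact: L1_norm.
- apply: aeT => x _ n; rewrite normrM ler_piMr// indicE; case: (_ \in _); rewrite ?normr1 ?normr0//.
rewrite [X in _ --> X]Rint_zero//.
by under eq_fun do rewrite -Rint_indic// ?lexx ?lerD2l//.
Unshelve. all: by end_near. Qed.

(** After the change of variable the two integrals cancel except on a strip of width [h_ n] at each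
    end. *)
Lemma telescope_int c d q n : c <= d -> L1 `]c, d + dl[ q ->
  \int[mu]_(x in `]c, d[) (q (x + h_ n) - q x) =
  \int[mu]_(x in `]d, d + h_ n[) q x - \int[mu]_(x in `]c, c + h_ n[) q x.
Proof.
move=> cd Lq; have := h0 n; have := hdl n => ? ?.
have Lq1 : L1 `]c, d[ q by apply: L1_oo Lq; lra.
have Lq2 : L1 `]c + h_ n, d + h_ n[ q by apply: L1_oo Lq; lra.
have Lq3 : L1 `]c, d + h_ n[ q by apply: L1_oo Lq; lra.
rewrite RintegralB//; last exact: L1_h.
rewrite Rint_shift//.
have E1 : \int[mu]_(x in `]c, d + h_ n[) q x = \int[mu]_(x in `]c, d[) q x + \int[mu]_(x in `]d, d + h_ n[) q x.
  by apply: Rint_split => //; lra.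
have E2 : \int[mu]_(x in `]c, d + h_ n[) q x = \int[mu]_(x in `]c, c + h_ n[) q x + \int[mu]_(x in `]c + h_ n, d + h_ n[) q x.
  by apply: Rint_split => //; lra.
by move: E1 E2; lra.
Qed.

Definition dq f n x := (f (x + h_ n) - f x) / h_ n.

Lemma dq_cvg f x df : is_derive x (1 : R) f df -> dq f n x @[n --> \oo] --> df.
Proof.
move=> [/cvg_ex[l hl] hd].
have ldf : l = df by rewrite -hd; apply/esym/cvg_lim => //; exact: Rhausdorff.
have hn : (forall n, h_ n != 0) /\ h_ n @[n --> \oo] --> (0 : R).
  by split => // n; rewrite gt_eqF.
have := (cvgr_dnbhsP _ _ _).1 hl h_ hn; rewrite ldf.
rewrite [X in X @ _ --> _ -> _](_ : _ = fun n => dq f n x)//.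
by apply/funext => n; rewrite /dq /GRing.scale/= mulr1 mulrC (addrC (h_ n)).
Qed.

Lemma avg_right_cvg e f l : L1 `]e, e + dl[ f ->
  (exists2 g, L1 `]e, e + dl[ g & forall x, `]e, e + dl[ x -> `|f x - l| <= \int[mu]_(t in `]e, x[) `|g t|) ->
  (h_ n)^-1 * (\int[mu]_(x in `]e, e + h_ n[) f x) @[n --> \oo] --> l.
Proof.
move=> Lf [g Lg hg]; have Lgn := L1_norm Lg.
apply/cvgrPdist_le => r r0; have := small_int Lgn => /cvgr0Pnorm_le /(_ r r0).
apply: filterS => n hn; have hp := h0 n; have hd := hdl n.
have le1 : e <= e + h_ n by rewrite lerDl ltW.
have Lfn : L1 `]e, e + h_ n[ f by apply: L1_oo Lf; rewrite ?lerD2l.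
have Lgn' : L1 `]e, e + h_ n[ (fun t => `|g t|) by apply: L1_oo Lgn; rewrite ?lerD2l.
rewrite distrC.
have Lc : L1 `]e, e + h_ n[ (fun=> l) by exact: L1_cst.
have -> : (h_ n)^-1 * (\int[mu]_(x in `]e, e + h_ n[) f x) - l =
    (h_ n)^-1 * (\int[mu]_(x in `]e, e + h_ n[) (f x - l)).
  rewrite RintegralB// Rintegral_cst// muooE//; have := hp.
  by move=> hp'; field; rewrite gt_eqF.
rewrite normrM ger0_norm ?invr_ge0 ?(ltW hp)// mulrC ler_pdivrMr//.
apply: le_trans (@Rint_bdd R _ _ r _ le1 _ _) _; last by rewrite addrAC subrr add0r.
- by apply: L1_meas; exact: L1B.
apply: aeT => x; rewrite /= in_itv/= => /andP[ex xe].
apply: le_trans (hg x _) _; first by rewrite /= in_itv/= ex (lt_le_trans xe)// lerD2l.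
apply: le_trans hn; apply: le_trans (ler_norm _).
by rewrite [leRHS](@Rint_split _ e x (e + h_ n)) ?lerDl ?(ltW ex) ?(ltW xe)//; exact: Rintegral_ge0.
Qed.

Lemma prim_avg_cvg c d e f : L1 `]c, d + dl[ f -> c <= e -> e <= d ->
  (h_ n)^-1 * (\int[mu]_(x in `]e, e + h_ n[) prim f c x) @[n --> \oo] --> prim f c e.
Proof.
move=> Lf ce ed; have dl0 : 0 < dl := lt_le_trans (h0 0) (hdl 0).
have cd : c < d + dl by lra.
have Lp : L1 `]c, d + dl[ (prim f c).
  have := L2_L1 (moo _ _) (muoo _ _) (prim_L2 0 Lf cd).
  by congr L1; apply/funext => x; rewrite add0r.
apply: avg_right_cvg; first by apply: L1_oo Lp => //; rewrite lerD2r.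
exists f; first by apply: L1_oo Lf => //; rewrite lerD2r.
move=> x; rewrite /= in_itv/= => /andP[ex xe].
rewrite (@prim_diff _ f c (d + dl) e x)//; [|exact: ltW|lra].
by apply: Rint_le_norm; apply: L1_oo Lf => //; lra.
Qed.

(** By telescoping, the integral of the quotient is a difference of two averages of the primitive,
    near [d] and near [c], and these converge by continuity. *)
Lemma int_dq_cvg c d f : L1 `]c, d + dl[ f -> c <= d ->
  \int[mu]_(x in `]c, d[) dq (prim f c) n x @[n --> \oo] --> \int[mu]_(x in `]c, d[) f x.
Proof.
move=> Lf cd; have dl0 : 0 < dl := lt_le_trans (h0 0) (hdl 0).
have cdl : c < d + dl by lra.
have Lp : L1 `]c, d + dl[ (prim f c).
  have := L2_L1 (moo _ _) (muoo _ _) (prim_L2 0 Lf cdl).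
  by congr L1; apply/funext => x; rewrite add0r.
have -> : (fun n => \int[mu]_(x in `]c, d[) dq (prim f c) n x) = fun n =>
   (h_ n)^-1 * (\int[mu]_(x in `]d, d + h_ n[) prim f c x) -
   (h_ n)^-1 * (\int[mu]_(x in `]c, c + h_ n[) prim f c x).
  apply/funext => n; rewrite -mulrBr -telescope_int// mulrC /dq RintegralZr//.
  apply: L1B => //; first exact: L1_h.
  by apply: L1_oo Lp => //; lra.
have -> : \int[mu]_(x in `]c, d[) f x = prim f c d - prim f c c by rewrite prim0 subr0.
by apply: cvgB; apply: (prim_avg_cvg Lf) => //; rewrite ?lexx.
Qed.

Lemma dq_prim c d f n x : L1 `]c, d + dl[ f -> `]c, d[ x ->
  dq (prim f c) n x = (h_ n)^-1 * \int[mu]_(t in `]x, x + h_ n[) f t.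
Proof.
move=> Lf; rewrite /= in_itv/= => /andP[cx xd]; have := h0 n; have := hdl n => ? ?.
by rewrite /dq mulrC; congr (_ * _); apply: (prim_diff Lf); lra.
Qed.

Lemma dq_mbl c d f n : L1 `]c, d + dl[ f -> c < d -> mblfun `]c, d[ (dq (prim f c) n).
Proof.
move=> Lf cd; have dl0 : 0 < dl := lt_le_trans (h0 0) (hdl 0).
have cdl : c < d + dl by lra.
have Lp : L1 `]c, d + dl[ (prim f c).
  have := L2_L1 (moo _ _) (muoo _ _) (prim_L2 0 Lf cdl).
  by congr L1; apply/funext => x; rewrite add0r.
apply: measurable_funM => //; apply: measurable_funB.
  exact: L1_meas (L1_h n Lp).
by apply: L1_meas; apply: L1_oo Lp => //; lra.
Qed.

(** Jensen's inequality for the mean of f over ]x, x + h[. It supplies a bound, varying with n,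
    whose integrals are known to converge. *)
Lemma dq_sqr_le c d f n x : L2 `]c, d + dl[ f -> `]c, d[ x ->
  dq (prim f c) n x ^+ 2 <= dq (prim (fun t => f t ^+ 2) c) n x.
Proof.
move=> L2f cdx; have [_ L1f2] := L2f; have L1f := L2_L1 (moo _ _) (muoo _ _) L2f.
rewrite (dq_prim n L1f cdx) (dq_prim n L1f2 cdx).
have hp := h0 n; have := hdl n => hd.
have xx : x <= x + h_ n by rewrite lerDl ltW.
have sub g : L1 `]c, d + dl[ g -> L1 `]x, x + h_ n[ g.
  move: cdx; rewrite /= in_itv/= => /andP[cx xd].
  by move=> Lg; apply: L1_oo Lg; lra.
pose I1 := \int[mu]_(t in `]x, x + h_ n[) f t.
pose I2 := \int[mu]_(t in `]x, x + h_ n[) (f t ^+ 2); rewrite -/I1 -/I2.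
suff : I1 ^+ 2 <= I2 * h_ n.
  move=> H; rewrite exprMn expr2 -mulrA ler_wpM2l ?invr_ge0 ?(ltW hp)//.
  by rewrite mulrC ler_pdivrMr.
apply: quad_disc; first exact: ltW.
move=> t; have := @Rintegral_ge0 _ _ R mu `]x, x + h_ n[ (fun y => (f y + t) ^+ 2) (fun y _ => sqr_ge0 _).
suff -> : \int[mu]_(y in `]x, x + h_ n[) (f y + t) ^+ 2 = I2 + 2 * t * I1 + t ^+ 2 * h_ n by [].
under eq_Rintegral do rewrite sqrrD mulr2n.
have Lx := sub _ L1f; have Lx2 := sub _ L1f2.
rewrite (@eq_Rintegral _ _ _ mu _ (fun y => f y ^+ 2 + (2 * t) * f y + t ^+ 2)); last by move=> y _; ring.
have Lc : L1 `]x, x + h_ n[ (fun=> t ^+ 2) by exact: L1_cst.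
have Lz := L1Z (moo x (x + h_ n)) (2 * t) Lx.
rewrite (RintegralD (moo _ _) (L1D (moo _ _) Lx2 Lz) Lc) (RintegralD (moo _ _) Lx2 Lz).
rewrite (RintegralZl _ (moo _ _) Lx) Rintegral_cst// muooE//.
by have -> : x + h_ n - x = h_ n by ring.
Qed.

(** The bound on (dq - f)^2 is twice the quotient of the primitive of f^2 plus 2 f^2. It moves with
    n, but converges a.e. and, by [int_dq_cvg], in integral, so [generalized_dct] applies and no
    maximal function is involved. *)
Lemma dq_L2_cvg c d f : L2 `]c, d + dl[ f -> c < d ->
  \int[mu]_(x in `]c, d[) (dq (prim f c) n x - f x) ^+ 2 @[n --> \oo] --> (0 : R).
Proof.
move=> L2f cd; have [mf L1f2] := L2f; have L1f := L2_L1 (moo _ _) (muoo _ _) L2f.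
have dl0 : 0 < dl := lt_le_trans (h0 0) (hdl 0).
have cdl : c < d + dl by lra.
have [mfcd L1cd] : L2 `]c, d[ f by apply: L2_oo L2f => //; lra.
have subcd x : `]c, d[ x -> `]c, d + dl[ x.
  by rewrite /= !in_itv/= => /andP[-> /=] ?; lra.
have dqae g : L1 `]c, d + dl[ g -> {ae mu, forall x, `]c, d[ x -> dq (prim g c) n x @[n --> \oo] --> g x}.
  by move=> Lg; apply: (aeS _ (FTC1_ae Lg)) => x h /subcd /h; exact: dq_cvg.
pose dq2 := dq (prim (fun t => f t ^+ 2) c).
have dq20 n x : `]c, d[ x -> 0 <= dq2 n x.
  move=> cdx; rewrite /dq2 (dq_prim n L1f2 cdx) mulr_ge0 ?invr_ge0 ?(ltW (h0 n))//.
  by apply: Rintegral_ge0 => t _; exact: sqr_ge0.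
have Lp2 : L1 `]c, d + dl[ (prim (fun t => f t ^+ 2) c).
  have := L2_L1 (moo _ _) (muoo _ _) (prim_L2 0 L1f2 cdl).
  by congr L1; apply/funext => x; rewrite add0r.
have Ldq2 n : L1 `]c, d[ (dq2 n).
  have : L1 `]c, d[ (fun x => (h_ n)^-1 * (prim (fun t => f t ^+ 2) c (x + h_ n) - prim (fun t => f t ^+ 2) c x)).
    apply: L1Z => //; apply: L1B => //; first exact: L1_h.
    by apply: L1_oo Lp2 => //; lra.
  by congr L1; apply/funext => x; rewrite mulrC.
apply: (@generalized_dct `]c, d[ (fun n x => (dq (prim f c) n x - f x) ^+ 2)
   (fun n x => 2 * `|dq2 n x| + 2 * f x ^+ 2) (fun x => 4 * f x ^+ 2)) => //.
- by move=> n; apply: measurable_funX; apply: measurable_funB => //; exact: dq_mbl.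
- by move=> n x; exact: sqr_ge0.
- by move=> n; apply: L1D => //; apply: L1Z => //; exact: L1_norm.
- exact: L1Z.
- move=> n; apply: aeT => x cdx; have := dq_sqr_le n L2f cdx; rewrite -/dq2.
  rewrite ger0_norm ?dq20//; have := sqr_ge0 (dq (prim f c) n x + f x).
  by rewrite sqrrD sqrrB !mulr2n; lra.
- by move=> x; rewrite mulr_ge0// sqr_ge0.
- by move=> n x; rewrite addr_ge0// mulr_ge0// sqr_ge0.
- apply: (aeS _ (dqae _ L1f)) => x h cdx; have := h cdx => H.
  have H1 : dq (prim f c) n x - f x @[n --> \oo] --> f x - f x by apply: cvgB => //; exact: cvg_cst.
  by have := cvg_sqr H1; rewrite subrr expr0n.
- apply: (aeS _ (dqae _ L1f2)) => x h cdx; have := h cdx => H.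
  have -> : 4 * f x ^+ 2 = 2 * f x ^+ 2 + 2 * f x ^+ 2 by ring.
  apply: cvgD; last exact: cvg_cst.
  apply: cvgMr; rewrite -[X in _ --> X](@ger0_norm _ (f x ^+ 2)) ?sqr_ge0//.
  exact: cvg_norm.
- have E : (fun n => \int[mu]_(x in `]c, d[) (2 * `|dq2 n x| + 2 * f x ^+ 2)) =
     fun n => 2 * \int[mu]_(x in `]c, d[) dq2 n x + 2 * \int[mu]_(x in `]c, d[) (f x ^+ 2).
    apply/funext => n; rewrite RintegralD//; [|by apply: L1Z => //; exact: L1_norm|exact: L1Z].
    rewrite (RintegralZl _ (moo c d) (L1_norm (Ldq2 n))).
    rewrite (RintegralZl _ (moo c d) L1cd); congr (2 * _ + _).
    by apply: eq_Rintegral => x; rewrite inE => cdx; rewrite ger0_norm// dq20.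
  rewrite E RintegralZl//.
  have -> : 4 * \int[mu]_(x in `]c, d[) f x ^+ 2 = 2 * \int[mu]_(x in `]c, d[) f x ^+ 2 + 2 * \int[mu]_(x in `]c, d[) f x ^+ 2 by ring.
  apply: cvgD; last exact: cvg_cst.
  by apply: cvgMr; apply: int_dq_cvg => //; exact: ltW.
Qed.

End ShiftLimit.

Lemma cvg_sumr {R : realType} (m : nat) (f_ : 'I_m -> nat -> R) (l : 'I_m -> R) :
  (forall i, f_ i n @[n --> \oo] --> l i) ->
  \sum_(i < m) f_ i n @[n --> \oo] --> \sum_(i < m) l i.
Proof.
move=> h; elim: (index_enum _) => [|i s IH].
  by under eq_fun do rewrite big_nil; rewrite big_nil; exact: cvg_cst.
by under eq_fun do rewrite big_cons; rewrite big_cons; apply: cvgD.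
Qed.

(** * Cauchy-Schwarz and products of L^2-convergent sequences *)

Section L2products.
Context {R : realType}.
Local Notation mu := (@lebesgue_measure R).
Variable D : set R.
Hypothesis mD : mbl D.
Implicit Types (f g w : R -> R).

Lemma cauchy_schwarz f g : L2 D f -> L2 D g ->
  (\int[mu]_(x in D) (f x * g x)) ^+ 2 <=
  (\int[mu]_(x in D) f x ^+ 2) * (\int[mu]_(x in D) g x ^+ 2).
Proof.
move=> Lf Lg; have Lfg := L2M mD Lf Lg; have [_ Lf2] := Lf; have [_ Lg2] := Lg.
apply: quad_disc; first by apply: Rintegral_ge0 => x _; exact: sqr_ge0.
move=> t; have := @Rintegral_ge0 _ _ R mu D (fun y => (f y + t * g y) ^+ 2) (fun y _ => sqr_ge0 _).
rewrite (@eq_Rintegral _ _ _ mu _ (fun y => f y ^+ 2 + (2 * t) * (f y * g y) + t ^+ 2 * g y ^+ 2)); last by move=> y _; ring.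
have L1a := L1Z mD (2 * t) Lfg; have L1b := L1Z mD (t ^+ 2) Lg2.
rewrite (RintegralD mD (L1D mD Lf2 L1a) L1b) (RintegralD mD Lf2 L1a).
by rewrite (RintegralZl _ mD Lfg) (RintegralZl _ mD Lg2).
Qed.

Lemma cvg_sqrt0 (u : nat -> R) : u n ^+ 2 @[n --> \oo] --> (0 : R) -> u n @[n --> \oo] --> (0 : R).
Proof.
move=> /cvgr0Pnorm_le h; apply/cvgr0Pnorm_le => e e0.
apply: filterS (h (e ^+ 2) (exprn_gt0 _ e0)) => n.
by rewrite normrX => h2; rewrite -(@ler_pXn2r _ 2) ?nnegrE ?(ltW e0)//.
Qed.

Lemma L2cvg_mul (f_ w_ : nat -> R -> R) f w :
  (forall n, L2 D (f_ n)) -> (forall n, L2 D (w_ n)) -> L2 D f -> L2 D w ->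
  \int[mu]_(x in D) (f_ n x - f x) ^+ 2 @[n --> \oo] --> (0 : R) ->
  \int[mu]_(x in D) (w_ n x - w x) ^+ 2 @[n --> \oo] --> (0 : R) ->
  \int[mu]_(x in D) (f_ n x * w_ n x) @[n --> \oo] --> \int[mu]_(x in D) (f x * w x).
Proof.
move=> Lf_ Lw_ Lf Lw hf hw.
have Ldf n := L2B mD (Lf_ n) Lf; have Ldw n := L2B mD (Lw_ n) Lw.
suff : (\int[mu]_(x in D) (f_ n x * w_ n x) - \int[mu]_(x in D) (f x * w x)) @[n --> \oo] --> (0 : R).
  by move=> h; apply/subr_cvg0.
apply: cvg_sqrt0.
pose a n := \int[mu]_(x in D) (f_ n x - f x) ^+ 2.
pose b n := \int[mu]_(x in D) (w_ n x - w x) ^+ 2.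
pose F := \int[mu]_(x in D) f x ^+ 2; pose W := \int[mu]_(x in D) w x ^+ 2.
(* The error splits into three cross terms X + Y + Z; the factor 3 comes from (X + Y + Z)^2 <= 3
   (X^2 + Y^2 + Z^2), each square being bounded by Cauchy-Schwarz. *)
have H : (3 * (a n * b n + F * b n + a n * W)) @[n --> \oo] --> (0 : R).
  have -> : (0 : R) = 3 * (0 * 0 + F * 0 + 0 * W) by ring.
  apply: cvgMr; apply: cvgD; first apply: cvgD.
  - exact: cvgM.
  - exact: cvgMr.
  - exact: cvgMl.
apply: (squeeze_cvgr _ (cvg_cst 0) H); apply: nearW => n; rewrite sqr_ge0/=.
have -> : \int[mu]_(x in D) (f_ n x * w_ n x) - \int[mu]_(x in D) (f x * w x) =
   \int[mu]_(x in D) ((f_ n x - f x) * (w_ n x - w x)) + \int[mu]_(x in D) (f x * (w_ n x - w x)) +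
   \int[mu]_(x in D) ((f_ n x - f x) * w x).
  have L1a := L2M mD (Ldf n) (Ldw n); have L1b := L2M mD Lf (Ldw n); have L1c := L2M mD (Ldf n) Lw.
  rewrite -(RintegralB mD (L2M mD (Lf_ n) (Lw_ n)) (L2M mD Lf Lw)).
  rewrite -(RintegralD mD L1a L1b) -(RintegralD mD (L1D mD L1a L1b) L1c).
  by apply: eq_Rintegral => x _; ring.
have := cauchy_schwarz (Ldf n) (Ldw n); have := cauchy_schwarz Lf (Ldw n).
have := cauchy_schwarz (Ldf n) Lw; rewrite -/(a n) -/(b n) -/F -/W.
set X := \int[mu]_(x in D) _; set Y := \int[mu]_(x in D) _; set Z := \int[mu]_(x in D) _.
have := sqr_ge0 (X - Y); have := sqr_ge0 (Y - Z); have := sqr_ge0 (X - Z).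
nra.
Qed.

End L2products.

(** * The energy identity in the interior *)

Section Energy.
Context {R : realType}.
Local Notation mu := (@lebesgue_measure R).
Implicit Types (x y : R).

Lemma ae_ex (c d : R) (P : R -> Prop) : c < d -> {ae mu, forall x, `]c, d[ x -> P x} ->
  exists2 x, `]c, d[ x & P x.
Proof.
move=> cd [N [mN N0 PN]]; apply: contrapT => h.
have : (mu `]c, d[ <= mu N)%E.
  apply: le_measure; rewrite ?inE//.
  by move=> x cdx; apply: PN => /= Px; apply: h; exists x => //; exact: Px.
by rewrite N0 lebesgue_measure_itv/= lte_fin cd -EFinD lee_fin leNgt subr_gt0 cd.
Qed.

Variables (a b : R) (m : nat).
Variables (u g F : 'I_m -> R -> R) (A A1 : 'I_m -> 'I_m -> R -> R).
Variables (c0 : 'I_m -> R) (A0 : 'I_m -> 'I_m -> R) (L : R).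
Hypothesis ab : a < b.
Hypothesis Lu : forall i, L2 `]a, b[ (u i).
Hypothesis Lg : forall i, L2 `]a, b[ (g i).
Hypothesis FE : forall i x, `]a, b[ x -> F i x = c0 i + prim (g i) a x.
Hypothesis mA1 : forall i j, mblfun `]a, b[ (A1 i j).
Hypothesis bA1 : forall i j, {ae mu, forall x, `]a, b[ x -> `|A1 i j x| <= L}.
Hypothesis AE : forall i j x, `]a, b[ x -> A i j x = A0 i j + prim (A1 i j) a x.
Hypothesis Asym : forall i j x, `]a, b[ x -> A i j x = A j i x.
Hypothesis FA : {ae mu, forall x, `]a, b[ x -> forall i, F i x = \sum_(j < m) A i j x * u j x}.

Let q x := \sum_(i < m) u i x * F i x.
(** The derivative of [q] with u' eliminated: formally A u' = g - A1 u, so by symmetry (u . F)' = u'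
    . A u + u . g = 2 u . g - u . A1 u. *)
Let p x := \sum_(i < m) (u i x * g i x + u i x * g i x - \sum_(j < m) u i x * A1 i j x * u j x).

Let L1g i : L1 `]a, b[ (g i). Proof. exact: L2_L1. Qed.
Let L2A1 i j : L2 `]a, b[ (A1 i j). Proof. exact: L2_bounded (bA1 i j). Qed.
Let L1A1 i j : L1 `]a, b[ (A1 i j). Proof. exact: L2_L1. Qed.

Lemma energy_p_L1 : L1 `]a, b[ p.
Proof.
apply: L1_sum => // i _; apply: L1B => //; first by apply: L1D => //; exact: L2M.
apply: L1_sum => // j _; apply: L2M => //.
have := L2_bdd (moo a b) (Lu i) (mA1 i j) (bA1 i j).
by congr L2; apply/funext => x; rewrite mulrC.
Qed.

Let LF i : L2 `]a, b[ (F i).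
Proof.
have LP := prim_L2 (c0 i) (L1g i) ab; apply: (L2_ae (moo a b) LP).
- apply: eq_measurable_fun (L2_meas LP) => x; rewrite inE => xab; exact/esym/FE.
- by apply: aeT => x xab; rewrite FE.
Qed.

Lemma energy_q_L1 : L1 `]a, b[ q.
Proof. by apply: L1_sum => // i _; exact: L2M. Qed.

Section Local.
Variables (c d : R).
Hypotheses (ac : a < c) (cd : c < d) (db : d < b).
(** The largest step: translates of ]c, d[ by at most b - d stay inside ]a, b[. *)
Let dl := b - d.
Let h_ (n : nat) := dl * n.+1%:R^-1.
Let dl0 : 0 < dl. Proof. by rewrite /dl subr_gt0. Qed.
Let h0 n : 0 < h_ n. Proof. by rewrite mulr_gt0// invr_gt0. Qed.
Let hdl n : h_ n <= dl. Proof. by rewrite /h_ ler_piMr ?(ltW dl0)// invf_le1// ler1n. Qed.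
Let hcvg : h_ n @[n --> \oo] --> (0 : R).
Proof. by rewrite -[X in _ --> X](mulr0 dl); apply: cvgMr; exact: cvg_harmonic. Qed.
Let cb : d + dl = b. Proof. by rewrite /dl addrC subrK. Qed.
Let subD x : `]c, d[ x -> `]a, b[ x.
Proof. by rewrite /= !in_itv/= => /andP[cx xd]; rewrite (lt_trans ac cx) (lt_trans xd db). Qed.
Let subDs n x : `]c, d[ x -> `]a, b[ (x + h_ n).
Proof. by move=> /(h_within h0 hdl n); rewrite cb /= !in_itv/= => /andP[cx ->]; rewrite andbT (lt_trans ac). Qed.
Let resL1 f : L1 `]a, b[ f -> L1 `]c, d + dl[ f.
Proof. by rewrite cb; apply: L1_oo => //; exact: ltW. Qed.
Let resL2 f : L2 `]a, b[ f -> L2 `]c, d + dl[ f.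
Proof. by rewrite cb; apply: L2_oo => //; exact: ltW. Qed.
Let resL2' f : L2 `]a, b[ f -> L2 `]c, d[ f.
Proof. by apply: L2_oo => //; exact: ltW. Qed.

Let dqE (G : R -> R) k (g0 : R -> R) n x : L1 `]a, b[ g0 ->
  (forall y, `]a, b[ y -> G y = k + prim g0 a y) -> `]c, d[ x ->
  dq h_ G n x = dq h_ (prim g0 c) n x.
Proof.
move=> Lg0 GE xcd; rewrite /dq (GE _ (subDs n xcd)) (GE _ (subD xcd)).
move: (xcd); rewrite /= in_itv/= => /andP[cx xd]; have := h0 n; have := hdl n => h1 h2.
have ac' := ac; have cd' := cd; have db' := db.
have hx : x + h_ n <= b by move: h1; rewrite /dl; lra.
have E1 : prim g0 a (x + h_ n) - prim g0 a x = \int[mu]_(t in `]x, x + h_ n[) g0 t.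
  by apply: (prim_diff Lg0) => //; lra.
have Lc : L1 `]c, b[ g0 by apply: L1_oo Lg0 => //; exact: ltW.
have E2 : prim g0 c (x + h_ n) - prim g0 c x = \int[mu]_(t in `]x, x + h_ n[) g0 t.
  by apply: (prim_diff Lc) => //; lra.
by congr (_ / _); rewrite E2 -E1; ring.
Qed.

Let L2dq g0 n : L1 `]a, b[ g0 -> L2 `]c, d[ (dq h_ (prim g0 c) n).
Proof.
move=> Lg0; have Lc := resL1 Lg0.
have cdl : c < d + dl by rewrite cb (lt_trans cd db).
have dd : d <= d + dl by rewrite lerDl ltW.
have LP : L2 `]c, d + dl[ (prim g0 c).
  by have := prim_L2 0 Lc cdl; congr L2; apply/funext => x; rewrite add0r.
have := L2Z (moo c d) (h_ n)^-1 (L2B (moo c d) (L2_h h0 hdl n LP) (L2_oo (lexx c) dd LP)).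
by congr L2; apply/funext => x; rewrite mulrC.
Qed.

Let u_shift i : \int[mu]_(x in `]c, d[) (u i (x + h_ n) - u i x) ^+ 2 @[n --> \oo] --> (0 : R).
Proof. by apply: (L2_shift_cvg h0 hdl hcvg) => //; [exact: ltW|exact: resL2]. Qed.

Let L2us i n : L2 `]c, d[ (fun x => u i (x + h_ n)).
Proof. by apply: (L2_h h0 hdl); exact: resL2. Qed.

Let cst_L2_cvg f : \int[mu]_(x in `]c, d[) (f x - f x) ^+ 2 @[n --> \oo] --> (0 : R).
Proof.
rewrite (_ : \int[mu]_(x in _) _ = 0); first exact: cvg_cst.
by apply: Rint_zero => x _; rewrite subrr expr0n.
Qed.

Let term1 i : \int[mu]_(x in `]c, d[) (u i x * dq h_ (prim (g i) c) n x) @[n --> \oo] -->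
   \int[mu]_(x in `]c, d[) (u i x * g i x).
Proof.
apply: (@L2cvg_mul R `]c, d[ (moo c d) (fun=> u i)); [by move=> _; exact: resL2'|by move=> n; exact: L2dq|exact: resL2'|exact: resL2'| |].
- exact: cst_L2_cvg.
- by apply: (dq_L2_cvg h0 hdl hcvg) => //; exact: resL2.
Qed.

Let term2 i : \int[mu]_(x in `]c, d[) (u i (x + h_ n) * dq h_ (prim (g i) c) n x) @[n --> \oo] -->
   \int[mu]_(x in `]c, d[) (u i x * g i x).
Proof.
apply: (@L2cvg_mul R `]c, d[ (moo c d)); [by move=> n; exact: L2us|by move=> n; exact: L2dq|exact: resL2'|exact: resL2'| |].
- exact: u_shift.
- by apply: (dq_L2_cvg h0 hdl hcvg) => //; exact: resL2.
Qed.

Let dqA_le i j n x : `]c, d[ x -> `|dq h_ (prim (A1 i j) c) n x| <= L.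
Proof.
move=> xcd; rewrite (dq_prim h0 hdl n (resL1 (L1A1 i j)) xcd).
have hp := h0 n; have hx : x <= x + h_ n by rewrite lerDl ltW.
have xab := subD xcd; have xhab := subDs n xcd.
move: xab xhab; rewrite /= !in_itv/= => /andP[ax xb] /andP[axh xhb].
have sub y : `]x, x + h_ n[ y -> `]a, b[ y.
  by rewrite /= !in_itv/= => /andP[xy yx]; rewrite (lt_trans ax xy) (lt_trans yx xhb).
rewrite normrM (@ger0_norm _ (h_ n)^-1) ?invr_ge0 ?(ltW hp)// mulrC ler_pdivrMr//.
have := @Rint_bdd R x (x + h_ n) L (A1 i j) hx _ _.
have -> : x + h_ n - x = h_ n by ring.
apply; first by apply: measurable_funS (mA1 i j).
by apply: (aeS _ (bA1 i j)) => y h /sub /h.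
Qed.

Let L2udqA i j n : L2 `]c, d[ (fun x => u i x * dq h_ (prim (A1 i j) c) n x).
Proof.
have := @L2_bdd R _ (moo c d) L _ (dq h_ (prim (A1 i j) c) n) (resL2' (Lu i)).
rewrite (_ : (fun x => _ * u i x) = (fun x => u i x * dq h_ (prim (A1 i j) c) n x)); last first.
  by apply/funext => x; rewrite mulrC.
by apply; [exact: L2_meas (L2dq _ _)|apply: aeT => x; exact: dqA_le].
Qed.

Let L2uA i j : L2 `]c, d[ (fun x => u i x * A1 i j x).
Proof.
apply: resL2'; have := L2_bdd (moo a b) (Lu i) (mA1 i j) (bA1 i j).
by congr L2; apply/funext => x; rewrite mulrC.
Qed.

(** The quotients of A are bounded by [L] and converge a.e., so multiplied by u_i they converge in
    L^2, with (2 L u_i)^2 as dominating function; the translate of u_j is the second L^2 factor. *)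
Let term3 i j : \int[mu]_(x in `]c, d[) ((u i x * dq h_ (prim (A1 i j) c) n x) * u j (x + h_ n)) @[n --> \oo] -->
   \int[mu]_(x in `]c, d[) (u i x * A1 i j x * u j x).
Proof.
apply: (@L2cvg_mul R `]c, d[ (moo c d)); [by move=> n; exact: L2udqA|by move=> n; exact: L2us|exact: L2uA|exact: resL2'| |exact: u_shift].
have [mu_i Lu2] := resL2' (Lu i).
have L0 : {ae mu, forall x, `]c, d[ x -> `|A1 i j x| <= L}.
  by apply: (aeS _ (bA1 i j)) => x h /subD /h.
have [|||||_ _] := @Rdct R `]c, d[ (fun n x => (u i x * dq h_ (prim (A1 i j) c) n x - u i x * A1 i j x) ^+ 2)
  (fun=> 0) (fun x => (2 * L) ^+ 2 * u i x ^+ 2) (moo c d).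
- by move=> n; apply: measurable_funX; exact: L2_meas (L2B (moo c d) (L2udqA i j n) (L2uA i j)).
- exact: measurable_cst.
- have cdl : c < d + dl by rewrite cb (lt_trans cd db).
  apply: (aeS _ (FTC1_ae (resL1 (L1A1 i j)))) => x h xcd.
  have xcd' : `]c, d + dl[ x.
    by move: xcd; rewrite /= !in_itv/= => /andP[-> xd]; rewrite (lt_le_trans xd)// lerDl ltW.
  have H := dq_cvg h0 hcvg (h xcd').
  have H2 : u i x * dq h_ (prim (A1 i j) c) n x - u i x * A1 i j x @[n --> \oo] --> u i x * A1 i j x - u i x * A1 i j x.
    by apply: cvgB; [exact: cvgMr|exact: cvg_cst].
  by have := cvg_sqr H2; rewrite subrr expr0n.
- exact: L1Z.
- apply: (aeS _ L0) => x h xcd n; have := h xcd => {}h.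
  have K : `|dq h_ (prim (A1 i j) c) n x - A1 i j x| <= 2 * L.
    by apply: le_trans (ler_normB _ _) _; have := dqA_le i j n xcd; lra.
  have L2 : 0 <= 2 * L by apply: le_trans K.
  rewrite -mulrBr exprMn normrM !normrX real_normK ?num_real// mulrC.
  by apply: ler_wpM2r; [exact: sqr_ge0|rewrite lerXn2r ?nnegrE].
by rewrite Rint_zero.
Qed.

(** Exact product rule. By symmetry u(x+h) . F(x) = u(x) . A(x) u(x+h), hence q(x+h) - q(x) = (u(x)
    + u(x+h)) . (F(x+h) - F(x)) - u(x) . (A(x+h) - A(x)) u(x+h). No increment of u appears on the
    right. *)
Let identity n : {ae mu, forall x, `]c, d[ x -> dq h_ q n x =
  \sum_(i < m) (u i x * dq h_ (prim (g i) c) n x + u i (x + h_ n) * dq h_ (prim (g i) c) n x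
    - \sum_(j < m) (u i x * dq h_ (prim (A1 i j) c) n x) * u j (x + h_ n))}.
Proof.
have FAs := ae_shift (h_ n) FA.
apply: (aeS2 _ FA FAs) => x h1 h2 xcd.
have {}h1 := h1 (subD xcd); have {}h2 := h2 (subDs n xcd).
under eq_bigr => i _.
  rewrite -(dqE n (L1g i) (FE i) xcd).
  under eq_bigr => j _ do rewrite -(dqE n (L1A1 i j) (AE i j) xcd).
  over.
rewrite /dq; set h := h_ n; rewrite /q.
have hn0 : h != 0 by rewrite gt_eqF// h0.
apply: (mulIf hn0); rewrite divfK// mulr_suml.
rewrite -sumrB.
have S : \sum_(i < m) u i (x + h) * F i x = \sum_(i < m) \sum_(j < m) u i x * A i j x * u j (x + h).
  under eq_bigr do rewrite h1 mulr_sumr.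
  rewrite exchange_big/=; apply: eq_bigr => i _; apply: eq_bigr => j _.
  by rewrite (Asym i j (subD xcd)); ring.
have S2 : \sum_(i < m) u i x * F i (x + h) = \sum_(i < m) \sum_(j < m) u i x * A i j (x + h) * u j (x + h).
  by apply: eq_bigr => i _; rewrite h2 mulr_sumr; apply: eq_bigr => j _; ring.
transitivity (\sum_(i < m) (u i (x + h) * F i (x + h) - u i x * F i x
   + (u i x * F i (x + h) - u i (x + h) * F i x -
    \sum_(j < m) (u i x * A i j (x + h) * u j (x + h) - u i x * A i j x * u j (x + h))))).
  rewrite [RHS]big_split/= [X in _ = _ + X](_ : _ = 0) ?addr0//.
  rewrite !sumrB S S2; under [X in _ - X]eq_bigr do rewrite sumrB.
  by rewrite sumrB subrr.
apply: eq_bigr => i _; rewrite mulrBl mulr_suml mulrDl.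
rewrite (eq_bigr (fun j => u i x * ((A i j (x + h) - A i j x) / h) * u j (x + h) * h)); last first.
  by move=> j _; field.
by field.
Qed.

Let q_L1 := energy_q_L1.

(** The integral of the quotient of [q] telescopes to right averages of [q] at [d] and [c]; the two
    differentiability hypotheses make these converge to q(d) and q(c), while the product rule gives
    the integral of [p] in the limit. *)
Lemma energy_local : is_derive c (1 : R) (prim q a) (q c) -> is_derive d (1 : R) (prim q a) (q d) ->
  q d - q c = \int[mu]_(x in `]c, d[) p x.
Proof.
move=> qc qd.
have qavg x : c <= x -> x <= d -> is_derive x (1 : R) (prim q a) (q x) ->
   (h_ n)^-1 * \int[mu]_(t in `]x, x + h_ n[) q t @[n --> \oo] --> q x.
  move=> cx xd dx; have := dq_cvg h0 hcvg dx.
  rewrite (_ : (fun n => dq h_ (prim q a) n x) = fun n => (h_ n)^-1 * \int[mu]_(t in `]x, x + h_ n[) q t)//.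
  apply/funext => n; rewrite /dq mulrC; congr (_ * _).
  have := hdl n; have := h0 n; rewrite /dl => h1 h2.
  have ac' := ac; have cd' := cd; have db' := db.
  by apply: (prim_diff q_L1); lra.
have H1 : (h_ n)^-1 * \int[mu]_(t in `]d, d + h_ n[) q t - (h_ n)^-1 * \int[mu]_(t in `]c, c + h_ n[) q t @[n --> \oo] --> q d - q c.
  by apply: cvgB; apply: qavg => //; exact: ltW.
have Ldq n : L1 `]c, d[ (dq h_ q n).
  have Lcd := resL1 q_L1.
  have : L1 `]c, d[ (fun x => (h_ n)^-1 * (q (x + h_ n) - q x)).
    apply: L1Z => //; apply: L1B => //; first exact: (L1_h h0 hdl).
    by apply: L1_oo Lcd => //; rewrite lerDl ltW.
  by congr L1; apply/funext => x; rewrite mulrC.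
have Lt1 i n : L1 `]c, d[ (fun x => u i x * dq h_ (prim (g i) c) n x).
  by apply: L2M => //; [exact: resL2'|exact: L2dq].
have Lt2 i n : L1 `]c, d[ (fun x => u i (x + h_ n) * dq h_ (prim (g i) c) n x).
  by apply: L2M => //; exact: L2dq.
have Lt3 i j n : L1 `]c, d[ (fun x => u i x * dq h_ (prim (A1 i j) c) n x * u j (x + h_ n)).
  by apply: L2M.
have Lt12 i n := L1D (moo c d) (Lt1 i n) (Lt2 i n).
have Lt3s i n : L1 `]c, d[ (fun x => \sum_(j < m) u i x * dq h_ (prim (A1 i j) c) n x * u j (x + h_ n)).
  by apply: L1_sum => // j _; exact: Lt3.
have Lug i : L1 `]c, d[ (fun x => u i x * g i x) by apply: L2M => //; exact: resL2'.
have LuAu i j : L1 `]c, d[ (fun x => u i x * A1 i j x * u j x) by apply: L2M => //; exact: resL2'.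
have LuAus i : L1 `]c, d[ (fun x => \sum_(j < m) u i x * A1 i j x * u j x).
  by apply: L1_sum => // j _; exact: LuAu.
have Ei n : \int[mu]_(x in `]c, d[) dq h_ q n x = \sum_(i < m)
    (\int[mu]_(x in `]c, d[) (u i x * dq h_ (prim (g i) c) n x)
   + \int[mu]_(x in `]c, d[) (u i (x + h_ n) * dq h_ (prim (g i) c) n x)
   - \sum_(j < m) \int[mu]_(x in `]c, d[) ((u i x * dq h_ (prim (A1 i j) c) n x) * u j (x + h_ n))).
  rewrite (Rint_ae (moo c d) (L1_meas (Ldq n)) _ (identity n)); last first.
    by apply: L1_meas; apply: L1_sum => // i _; exact: L1B.
  rewrite Rint_sum//; last by move=> i _; exact: L1B.
  apply: eq_bigr => i _.
  rewrite (RintegralB (moo c d) (Lt12 i n) (Lt3s i n)) (RintegralD (moo c d) (Lt1 i n) (Lt2 i n)).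
  by rewrite Rint_sum.
have Ep : \int[mu]_(x in `]c, d[) p x = \sum_(i < m)
    (\int[mu]_(x in `]c, d[) (u i x * g i x) + \int[mu]_(x in `]c, d[) (u i x * g i x)
   - \sum_(j < m) \int[mu]_(x in `]c, d[) (u i x * A1 i j x * u j x)).
  rewrite Rint_sum//; last by move=> i _; apply: L1B => //; exact: L1D.
  apply: eq_bigr => i _.
  rewrite (RintegralB (moo c d) (L1D (moo c d) (Lug i) (Lug i)) (LuAus i)) (RintegralD (moo c d) (Lug i) (Lug i)).
  by rewrite Rint_sum.
have H2 : \int[mu]_(x in `]c, d[) dq h_ q n x @[n --> \oo] --> \int[mu]_(x in `]c, d[) p x.
  rewrite Ep; under eq_fun do rewrite Ei.
  apply: cvg_sumr => i; apply: cvgB; first by apply: cvgD; [exact: term1|exact: term2].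
  by apply: cvg_sumr => j; exact: term3.
have E n : \int[mu]_(x in `]c, d[) dq h_ q n x =
  (h_ n)^-1 * \int[mu]_(t in `]d, d + h_ n[) q t - (h_ n)^-1 * \int[mu]_(t in `]c, c + h_ n[) q t.
  have Lcd := resL1 q_L1.
  rewrite -mulrBr -(telescope_int h0 hdl)//; last exact: ltW.
  rewrite mulrC /dq RintegralZr//; apply: L1B => //; first exact: (L1_h h0 hdl).
  by apply: L1_oo Lcd => //; rewrite lerDl ltW.
rewrite -(cvg_lim (@Rhausdorff R) H1) -(cvg_lim (@Rhausdorff R) H2).
by under eq_fun do rewrite -E.
Qed.

End Local.

(** Almost every point satisfies the hypothesis of [energy_local]; one such point [x0] fixes the
    constant, and every other one is compared with it. *)
Lemma energy_AC : exists C, {ae mu, forall x, `]a, b[ x -> q x = C + prim p a x}.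
Proof.
have good := FTC1_ae energy_q_L1.
have [x0 x0ab good0] := ae_ex ab good.
exists (q x0 - prim p a x0); apply: (aeS _ good) => x h xab; have {}h := h xab.
move: xab x0ab; rewrite /= !in_itv/= => /andP[ax xb] /andP[ax0 x0b].
have Lp := energy_p_L1.
have [xx|xx|->] := ltgtP x x0; last by ring.
- have := energy_local ax xx x0b h good0.
  by rewrite -(prim_diff Lp (ltW ax) (ltW xx) (ltW x0b)) => H; lra.
- have := energy_local ax0 xx xb good0 h.
  by rewrite -(prim_diff Lp (ltW ax0) (ltW xx) (ltW xb)) => H; lra.
Qed.

End Energy.

(** * Square integrability against behaviour at an end point *)

Section EndpointLemmas.
Context {R : realType}.
Local Notation mu := (@lebesgue_measure R).
Implicit Types (x y : R).
Variables (a b : R).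
Hypothesis ab : a < b.

Lemma shrink_int (f : R -> R) (c_ d_ : nat -> R) : L1 `]a, b[ f ->
  (forall n, a <= c_ n) -> (forall n, d_ n <= b) ->
  (forall x, `]a, b[ x -> \forall n \near \oo, ~ (c_ n < x < d_ n)) ->
  \int[mu]_(x in `]c_ n, d_ n[) f x @[n --> \oo] --> (0 : R).
Proof.
move=> Lf ac db sh; have mf := L1_meas Lf.
have [|||||_ _] := @Rdct R `]a, b[ (fun n x => f x * (\1_(`]c_ n, d_ n[%classic : set R) x : R))
  (fun=> 0) (fun x => `|f x|) (moo _ _).
- by move=> n; apply: measurable_funM => //; exact: measurable_indic.
- exact: measurable_cst.
- apply: aeT => x xab; apply: cvg_near_cst; apply: filterS (sh x xab) => n nx.
  by rewrite indicE memNset ?mulr0//= in_itv/=.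
- exact: L1_norm.
- by apply: aeT => x _ n; rewrite normrM ler_piMr// indicE; case: (_ \in _); rewrite ?normr1 ?normr0.
rewrite [X in _ --> X]Rint_zero//.
by under eq_fun do rewrite -Rint_indic//.
Qed.

Lemma prim_end (f : R -> R) (e r : R) : L1 `]a, b[ f -> (e == a) || (e == b) -> 0 < r ->
  exists2 eta, 0 < eta & forall x, `]a, b[ x -> `|x - e| < eta -> `|prim f a x - prim f a e| <= r.
Proof.
move=> Lf eab r0; have := prim_cont_within Lf ab.
move/subspace_continuousP => /(_ e) h.
have {h} : prim f a x @[x --> within `[a, b] (nbhs e)] --> prim f a e.
  by apply: h; rewrite /= in_itv/=; case/orP : eab => /eqP ->; rewrite lexx ltW.
move/cvgrPdist_le => /(_ r r0) [eta /= eta0 h]; exists eta => // x xab xe.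
rewrite distrC; apply: h; first by rewrite /= distrC.
exact: (subset_itv_oo_cc xab).
Qed.

(** Cauchy-Schwarz against the constant 1: the primitive of an L^2 function is Hölder of exponent
    1/2 at the ends. *)
Lemma prim_end_sqrt (f : R -> R) (e x : R) : L2 `]a, b[ f -> (e == a) || (e == b) -> `]a, b[ x ->
  (prim f a x - prim f a e) ^+ 2 <= `|x - e| * \int[mu]_(t in `]a, b[) f t ^+ 2.
Proof.
move=> L2f eab; rewrite /= in_itv/= => /andP[ax xb]; have [_ Lf2] := L2f.
have L1f := L2_L1 (moo _ _) (muoo _ _) L2f.
have key y z : a <= y -> y < z -> z <= b ->
    (\int[mu]_(t in `]y, z[) f t) ^+ 2 <= (z - y) * \int[mu]_(t in `]a, b[) f t ^+ 2.
  move=> ay yz zb.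
  have L2yz : L2 `]y, z[ f by apply: L2_oo L2f.
  have L2c : L2 `]y, z[ (fun=> 1 : R) by apply: cont_L2; exact: cst_continuous.
  have := cauchy_schwarz (moo y z) L2c L2yz.
  rewrite (@eq_Rintegral _ _ _ mu `]y, z[ f); last by move=> t _; rewrite mul1r.
  rewrite (@eq_Rintegral _ _ _ mu `]y, z[ (fun=> 1) (fun=> 1 ^+ 2)); last by move=> t _; rewrite expr1n.
  rewrite Rintegral_cst// mul1r muooE ?(ltW yz)// => h; apply: le_trans h _.
  rewrite ler_wpM2l ?subr_ge0 ?(ltW yz)//.
  have Ly : L1 `]y, b[ (fun t => f t ^+ 2) by apply: L1_oo Lf2.
  rewrite [leRHS](@Rint_split _ a y b)//; last by rewrite (le_trans (ltW yz)).
  rewrite [X in _ <= _ + X](@Rint_split _ y z b)// ?(ltW yz)//.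
  rewrite addrCA lerDl addr_ge0//; apply: Rintegral_ge0 => t _; exact: sqr_ge0.
case/orP : eab => /eqP ->.
  rewrite prim0 subr0 ger0_norm ?subr_ge0 ?(ltW ax)//.
  exact: (key a x (lexx a) ax (ltW xb)).
rewrite -sqrrN opprB (prim_diff L1f (ltW ax) (ltW xb) (lexx b)).
rewrite distrC ger0_norm ?subr_ge0 ?(ltW xb)//.
exact: (key x b (ltW ax) xb (lexx b)).
Qed.

(* [dx / |x - e|] is not integrable at the end point [e]. *)
Lemma not_integrable_end (s : R -> R) (e eta kappa : R) :
  L1 `]a, b[ s -> (forall x, 0 <= s x) -> (e == a) || (e == b) -> 0 < eta -> 0 < kappa ->
  ~ {ae mu, forall x, `]a, b[ x -> `|x - e| < eta -> kappa <= `|x - e| * s x}.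
Proof.
move=> Ls s0 eab eta0 k0 h.
pose t0 := Num.min eta (b - a).
have t00 : 0 < t0 by rewrite lt_min eta0 subr_gt0 ab.
have t0e : t0 <= eta by rewrite ge_min lexx.
have t0b : t0 <= b - a by rewrite ge_min lexx orbT.
pose t n := t0 * n.+1%:R^-1.
have tp n : 0 < t n by rewrite mulr_gt0// invr_gt0.
have tle n : t n <= t0 by rewrite /t ler_piMr ?(ltW t00)// invf_le1// ler1n.
have tcvg : t n @[n --> \oo] --> (0 : R).
  by rewrite -[X in _ --> X](mulr0 t0); apply: cvgMr; exact: cvg_harmonic.
(* The windows consist of the points at distance between t/2 and t from [e]. On each of them s >=
   kappa / t over a length t/2, so the integral is at least kappa / 2, although the windows leave
   every fixed point as t tends to 0. *)
have [c [d [ac db dc hI sh]]] : exists c d : nat -> R, [/\ forall n, a <= c n, forall n, d n <= b,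
    forall n, d n - c n = t n / 2,
    forall n x, c n < x -> x < d n -> `|x - e| < t n &
    forall x, `]a, b[ x -> \forall n \near \oo, ~ (c n < x < d n)].
  case/orP : eab => /eqP ->.
    exists (fun n => a + t n / 2), (fun n => a + t n); split.
    - by move=> n; have := tp n; lra.
    - by move=> n; have := tle n; lra.
    - by move=> n; lra.
    - by move=> n x h1 h2; have := tp n => ?; rewrite ger0_norm; lra.
    - move=> x; rewrite /= in_itv/= => /andP[ax xb].
      have xa0 : 0 < x - a by rewrite subr_gt0.
      move/cvgr0Pnorm_lt : tcvg => /(_ _ xa0); apply: filterS => n.
      by rewrite gtr0_norm// => h1 /andP[_ h2]; lra.
  exists (fun n => b - t n), (fun n => b - t n / 2); split.
  - by move=> n; have := tle n; lra.
  - by move=> n; have := tp n; lra.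
  - by move=> n; lra.
  - by move=> n x h1 h2; have := tp n => ?; rewrite ler0_norm; lra.
  - move=> x; rewrite /= in_itv/= => /andP[ax xb].
    have xa0 : 0 < b - x by rewrite subr_gt0.
    move/cvgr0Pnorm_lt : tcvg => /(_ _ xa0); apply: filterS => n.
    by rewrite gtr0_norm// => h1 /andP[h2 _]; lra.
have := shrink_int Ls ac db sh => /cvgr0Pnorm_lt /(_ (kappa / 2)).
rewrite divr_gt0// => /(_ isT) [N _ /(_ N (leqnn N))] /=.
rewrite ger0_norm; last by apply: Rintegral_ge0 => x _; exact: s0.
apply/negP; rewrite -leNgt.
have cd : c N <= d N by have := dc N; have := tp N; lra.
have -> : kappa / 2 = kappa / t N * (d N - c N) by rewrite dc; field; rewrite gt_eqF.
rewrite -(muooE cd) -Rintegral_cst//.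
have LcN : L1 `]c N, d N[ s by apply: L1_oo Ls.
apply: Rint_ae_le => //; first exact: L1_cst.
apply: (aeS _ h) => x hx; rewrite /= in_itv/= => /andP[cx xd].
have xt := hI N x cx xd.
have {}hx : kappa <= `|x - e| * s x.
  apply: hx; last by rewrite (lt_le_trans xt)// (le_trans (tle N)).
  by rewrite /= in_itv/= (le_lt_trans (ac N))// (lt_le_trans xd).
rewrite ler_pdivrMr// mulrC; apply: le_trans hx _.
by rewrite ler_wpM2r// ltW.
Qed.

(** Form in which non-integrability is used: by Cauchy-Schwarz eps^2 <= |u|^2 |w|^2 with |w|^2 =
    O(|x - e|), so |u|^2 would be bounded below by a multiple of 1 / |x - e|. *)
Lemma not_bounded_below_end (m : nat) (u w : 'I_m -> R -> R) (e eta eps K : R) :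
  (forall i, L2 `]a, b[ (u i)) -> (e == a) || (e == b) -> 0 < eta -> 0 < eps ->
  (forall i x, `]a, b[ x -> w i x ^+ 2 <= K * `|x - e|) ->
  ~ {ae mu, forall x, `]a, b[ x -> `|x - e| < eta -> eps <= \sum_(i < m) `|u i x| * w i x}.
Proof.
move=> Lu eab eta0 eps0 hw h.
pose s x := \sum_(i < m) u i x ^+ 2.
have Ls : L1 `]a, b[ s by apply: L1_sum => // i _; case: (Lu i).
have s0 x : 0 <= s x by apply: sumr_ge0 => i _; exact: sqr_ge0.
(* The absolute value and the summand 1 keep this positive for every sign of [K] and for m = 0. *)
pose K' := m%:R * `|K| + 1.
have K'0 : 0 < K' by rewrite ltr_wpDl// mulr_ge0.
apply: (@not_integrable_end s e eta (eps ^+ 2 / K')) => //; first by rewrite divr_gt0// exprn_gt0.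
apply: (aeS _ h) => x hx xab xe; have {}hx := hx xab xe.
rewrite ler_pdivrMr//.
have : eps ^+ 2 <= (\sum_(i < m) `|u i x| * w i x) ^+ 2.
  by rewrite ler_pXn2r ?nnegrE// ?(ltW eps0)// (le_trans (ltW eps0) hx).
move/le_trans; apply.
have cs : (\sum_(i < m) `|u i x| * w i x) ^+ 2 <= (\sum_(i < m) u i x ^+ 2) * (\sum_(i < m) w i x ^+ 2).
  apply: quad_disc; first by apply: sumr_ge0 => i _; exact: sqr_ge0.
  move=> t; rewrite 2!mulr_sumr -!big_split/=; apply: sumr_ge0 => i _.
  rewrite (_ : _ + _ = (`|u i x| + t * w i x) ^+ 2) ?sqr_ge0//.
  by rewrite -(real_normK (num_real (u i x))); ring.
apply: le_trans cs _; rewrite -/(s x).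
rewrite [leRHS](_ : _ = s x * (K' * `|x - e|)); last by ring.
apply: ler_wpM2l => //.
have : \sum_(i < m) w i x ^+ 2 <= m%:R * `|K| * `|x - e|.
  apply: (@le_trans _ _ (\sum_(i < m) `|K| * `|x - e|)).
    apply: ler_sum => i _; apply: le_trans (hw i x xab) _.
    by rewrite ler_wpM2r// ler_norm.
  by rewrite sumr_const card_ord -[leLHS]mulr_natl mulrA.
by have := normr_ge0 (x - e); rewrite /K'; lra.
Qed.

End EndpointLemmas.

Lemma sqr_add_le {R : realType} (X Y G H d : R) : X ^+ 2 <= G * d -> Y ^+ 2 <= H * d ->
  (X + Y) ^+ 2 <= (2 * G + 2 * H) * d.
Proof. by move=> h1 h2; have := sqr_ge0 (X - Y); nra. Qed.

(** * End values of F and of the energy *)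

Section Boundary.
Context {R : realType}.
Local Notation mu := (@lebesgue_measure R).
Implicit Types (x y : R).
Variables (a b : R) (m : nat).
Variables (u g F : 'I_m -> R -> R) (A A1 : 'I_m -> 'I_m -> R -> R).
Variables (c0 : 'I_m -> R) (A0 : 'I_m -> 'I_m -> R) (L : R).
Hypothesis ab : a < b.
Hypothesis Lu : forall i, L2 `]a, b[ (u i).
Hypothesis Lg : forall i, L2 `]a, b[ (g i).
Hypothesis FE : forall i x, `[a, b] x -> F i x = c0 i + prim (g i) a x.
Hypothesis mA1 : forall i j, mblfun `]a, b[ (A1 i j).
Hypothesis bA1 : forall i j, {ae mu, forall x, `]a, b[ x -> `|A1 i j x| <= L}.
Hypothesis AE : forall i j x, `[a, b] x -> A i j x = A0 i j + prim (A1 i j) a x.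
Hypothesis Asym : forall i j x, `[a, b] x -> A i j x = A j i x.
Hypothesis FA : {ae mu, forall x, `]a, b[ x -> forall i, F i x = \sum_(j < m) A i j x * u j x}.

Let q x := \sum_(i < m) u i x * F i x.
Let p x := \sum_(i < m) (u i x * g i x + u i x * g i x - \sum_(j < m) u i x * A1 i j x * u j x).

Let oc x : `]a, b[ x -> `[a, b] x. Proof. exact: subset_itv_oo_cc. Qed.
Let L1g i : L1 `]a, b[ (g i). Proof. exact: L2_L1. Qed.
Let L2A1 i j : L2 `]a, b[ (A1 i j). Proof. exact: L2_bounded (bA1 i j). Qed.
Let L1A1 i j : L1 `]a, b[ (A1 i j). Proof. exact: L2_L1. Qed.
Let endc e : (e == a) || (e == b) -> `[a, b] e.
Proof. by rewrite /= in_itv/=; case/orP => /eqP ->; rewrite lexx ltW. Qed.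

(** A bound of the square by |x - e| is enough: it forces |u|^2 >= kappa / |x - e|, which is already
    not integrable. The entries of A can thus be treated exactly like those of F, whose derivatives
    are only in L^2. *)
Let A_lip e i j x : (e == a) || (e == b) -> `]a, b[ x ->
  (A i j x - A i j e) ^+ 2 <= (\int[mu]_(t in `]a, b[) A1 i j t ^+ 2) * `|x - e|.
Proof.
move=> eab xab; rewrite (AE _ _ (oc xab)) (AE _ _ (endc eab)) mulrC.
rewrite [X in X ^+ 2](_ : _ = prim (A1 i j) a x - prim (A1 i j) a e); last by ring.
exact: prim_end_sqrt.
Qed.

Let F_hol e i x : (e == a) || (e == b) -> `]a, b[ x ->
  (F i x - F i e) ^+ 2 <= (\int[mu]_(t in `]a, b[) g i t ^+ 2) * `|x - e|.
Proof.
move=> eab xab; rewrite (FE _ (oc xab)) (FE _ (endc eab)) mulrC.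
rewrite [X in X ^+ 2](_ : _ = prim (g i) a x - prim (g i) a e); last by ring.
exact: prim_end_sqrt.
Qed.

Let F_cont e i r : (e == a) || (e == b) -> 0 < r ->
  exists2 eta, 0 < eta & forall x, `]a, b[ x -> `|x - e| < eta -> `|F i x - F i e| <= r.
Proof.
move=> eab r0; have [eta eta0 h] := prim_end ab (L1g i) eab r0; exists eta => // x xab xe.
rewrite (FE _ (oc xab)) (FE _ (endc eab)).
rewrite [X in `|X|](_ : _ = prim (g i) a x - prim (g i) a e); last by ring.
exact: h.
Qed.

Let lincomb_cont e (v : 'I_m -> R) r : (e == a) || (e == b) -> 0 < r ->
  exists2 eta, 0 < eta & forall x, `]a, b[ x -> `|x - e| < eta ->
    `|\sum_(i < m) v i * (F i x - F i e)| <= r.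
Proof.
move=> eab r0; have V0 : 0 < m%:R * (\sum_(i < m) `|v i| + 1) + 1 :> R.
  by rewrite ltr_wpDl// mulr_ge0// addr_ge0// sumr_ge0.
set V := _ + 1 in V0; have r1 : 0 < r / V by rewrite divr_gt0.
have /choice[eta heta] i : exists eta, 0 < eta /\ forall x, `]a, b[ x -> `|x - e| < eta -> `|F i x - F i e| <= r / V.
  by have [eta eta0 h] := F_cont i eab r1; exists eta.
exists (\big[Num.min/1]_(i < m) eta i).
  by elim/big_ind : _ => // [x y x0 y0|i _]; [rewrite lt_min x0|case: (heta i)].
move=> x xab xe; apply: le_trans (ler_norm_sum _ _ _) _.
apply: (@le_trans _ _ (\sum_(i < m) (\sum_(j < m) `|v j| + 1) * (r / V))).
  apply: ler_sum => i _; rewrite normrM ler_pM//.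
    rewrite (bigD1 i)//= -addrA lerDl addr_ge0// sumr_ge0//.
  case: (heta i) => _; apply => //; apply: lt_le_trans xe _.
  exact: bigmin_le_cond.
rewrite sumr_const card_ord -mulr_natl mulrA mulrA ler_pdivrMr// mulrC ler_wpM2l ?(ltW r0)//.
by rewrite /V lerDl.
Qed.

(* [F = A u] with [A] Lipschitz and [u] in [L^2]: a component of [F(e)] along
   [ker A(e)] would force [|u| >= c / |x - e|]. *)
Lemma trace_orth_ker e (v : 'I_m -> R) : (e == a) || (e == b) ->
  (forall j, \sum_(i < m) v i * A i j e = 0) -> \sum_(i < m) v i * F i e = 0.
Proof.
move=> eab vA; apply/eqP; apply: contraT => nz.
set r := \sum_(i < m) _ in nz.
have r0 : 0 < `|r| / 2 by rewrite divr_gt0// normr_gt0.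
have [eta eta0 heta] := lincomb_cont v eab r0.
pose w j x := `|\sum_(i < m) v i * (A i j x - A i j e)|.
pose K := \sum_(j < m) (\sum_(i < m) v i ^+ 2) * (\sum_(i < m) \int[mu]_(t in `]a, b[) A1 i j t ^+ 2).
have I0 i j : 0 <= \int[mu]_(t in `]a, b[) A1 i j t ^+ 2 by apply: Rintegral_ge0 => t _; exact: sqr_ge0.
have V0 : 0 <= \sum_(i < m) v i ^+ 2 by apply: sumr_ge0 => i _; exact: sqr_ge0.
exfalso; apply: (@not_bounded_below_end _ _ _ ab m u w e eta (`|r| / 2) K) => //.
- move=> j x xab; rewrite /w real_normK ?num_real//.
  have cs : (\sum_(i < m) v i * (A i j x - A i j e)) ^+ 2 <=
     (\sum_(i < m) v i ^+ 2) * (\sum_(i < m) (A i j x - A i j e) ^+ 2).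
    apply: quad_disc; first by apply: sumr_ge0 => i _; exact: sqr_ge0.
    move=> t; rewrite 2!mulr_sumr -!big_split/=; apply: sumr_ge0 => i _.
    rewrite (_ : _ + _ = (v i + t * (A i j x - A i j e)) ^+ 2) ?sqr_ge0//.
    by ring.
  apply: le_trans cs _; apply: (@le_trans _ _ ((\sum_(i < m) v i ^+ 2) * (\sum_(i < m) \int[mu]_(t in `]a, b[) A1 i j t ^+ 2) * `|x - e|)).
    rewrite -mulrA ler_wpM2l// mulr_suml; apply: ler_sum => i _; exact: A_lip.
  rewrite ler_wpM2r// /K [leRHS](bigD1 j)//= lerDl; apply: sumr_ge0 => k _.
  by rewrite mulr_ge0// sumr_ge0.
- apply: (aeS _ FA) => x FAx xab xe; have {}FAx := FAx xab.
  (* As v is orthogonal to the columns of A(e), v . F(x) = v . (A(x) - A(e)) u(x). The left side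
     stays away from 0 near [e], while the factor of u is small. *)
  have h1 : \sum_(i < m) v i * F i x = \sum_(j < m) (\sum_(i < m) v i * (A i j x - A i j e)) * u j x.
    under eq_bigr do rewrite FAx mulr_sumr.
    rewrite exchange_big/=; apply: eq_bigr => j _.
    under [in RHS]eq_bigr do rewrite mulrBr.
    by rewrite sumrB vA subr0 mulr_suml; apply: eq_bigr => i _; rewrite mulrA.
  have h2 := heta x xab xe.
  have h3 : `|\sum_(i < m) v i * F i x| <= \sum_(i < m) `|u i x| * w i x.
    rewrite h1; apply: le_trans (ler_norm_sum _ _ _) _.
    by apply: ler_sum => j _; rewrite normrM mulrC.
  apply: le_trans h3; move: h2; under eq_bigr do rewrite mulrBr.
  rewrite sumrB -/r; set s := \sum_(i < m) _.
  by move: (ler_normB r s); have := ler_distD s 0 r; rewrite !sub0r !normrN (distrC s); lra.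
Qed.

(** The continuous representative C + prim p of [q] has a limit at [e]. If it differed from xi .
    F(e), the expansion of [q] around xi would leave u . w bounded away from 0 with |w|^2 = O(|x -
    e|), which [not_bounded_below_end] excludes. *)
Lemma energy_end e C (xi : 'I_m -> R) : (e == a) || (e == b) ->
  {ae mu, forall x, `]a, b[ x -> q x = C + prim p a x} ->
  (forall i, F i e = \sum_(j < m) A i j e * xi j) ->
  C + prim p a e = \sum_(i < m) xi i * F i e.
Proof.
move=> eab qC Fxi; apply/eqP; rewrite -subr_eq0; apply: contraT => nz.
have Lp : L1 `]a, b[ p.
  exact: (energy_p_L1 Lu Lg mA1 bA1).
set r := _ - _ in nz.
have r0 : 0 < `|r| / 3 by rewrite divr_gt0// normr_gt0.
have [eta1 eta10 heta1] := lincomb_cont xi eab r0.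
have [eta2 eta20 heta2] := prim_end ab Lp eab r0.
pose w j x := `|F j x - F j e| + `|\sum_(i < m) xi i * (A j i x - A j i e)|.
have I0 (f : R -> R) : 0 <= \int[mu]_(t in `]a, b[) f t ^+ 2 by apply: Rintegral_ge0 => t _; exact: sqr_ge0.
have V0 : 0 <= \sum_(i < m) xi i ^+ 2 by apply: sumr_ge0 => i _; exact: sqr_ge0.
pose Kj j := 2 * (\int[mu]_(t in `]a, b[) g j t ^+ 2) + 2 * ((\sum_(i < m) xi i ^+ 2) * (\sum_(i < m) \int[mu]_(t in `]a, b[) A1 j i t ^+ 2)).
have Kj0 j : 0 <= Kj j by rewrite addr_ge0// mulr_ge0// mulr_ge0// sumr_ge0.
exfalso; apply: (@not_bounded_below_end _ _ _ ab m u w e (Num.min eta1 eta2) (`|r| / 3) (\sum_j Kj j)) => //.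
- by rewrite lt_min eta10.
- move=> j x xab.
  have cs : (\sum_(i < m) xi i * (A j i x - A j i e)) ^+ 2 <=
     (\sum_(i < m) xi i ^+ 2) * (\sum_(i < m) (A j i x - A j i e) ^+ 2).
    apply: quad_disc; first by apply: sumr_ge0 => i _; exact: sqr_ge0.
    move=> t; rewrite 2!mulr_sumr -!big_split/=; apply: sumr_ge0 => i _.
    rewrite (_ : _ + _ = (xi i + t * (A j i x - A j i e)) ^+ 2) ?sqr_ge0//.
    by ring.
  have h1 : (\sum_(i < m) xi i ^+ 2) * (\sum_(i < m) (A j i x - A j i e) ^+ 2) <=
     (\sum_(i < m) xi i ^+ 2) * (\sum_(i < m) \int[mu]_(t in `]a, b[) A1 j i t ^+ 2) * `|x - e|.
    rewrite -mulrA ler_wpM2l// mulr_suml; apply: ler_sum => i _; exact: A_lip.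
  have h2 := F_hol j eab xab.
  apply: (@le_trans _ _ (Kj j * `|x - e|)); last first.
    by rewrite ler_wpM2r// [leRHS](bigD1 j)//= lerDl sumr_ge0.
  rewrite /w /Kj; move: cs h1 h2; rewrite -!(real_normK (num_real (\sum_(i < m) xi i * _))) -!(real_normK (num_real (F j x - F j e))).
  move: (`|F j x - F j e|) (`|\sum_(i < m) xi i * _|) => X Y.
  by move=> c1 c2 c3; exact: (sqr_add_le c3 (le_trans c1 c2)).
- apply: (aeS2 _ FA qC) => x FAx qx xab xe; have {}FAx := FAx xab; have {}qx := qx xab.
  have xe1 : `|x - e| < eta1 by rewrite (lt_le_trans xe)// ge_min lexx.
  have xe2 : `|x - e| < eta2 by rewrite (lt_le_trans xe)// ge_min lexx orbT.
  have H1 := heta1 x xab xe1; have H2 := heta2 x xab xe2.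
  (* By F(x) = A(x) u(x), F(e) = A(e) xi and symmetry, u enters only multiplied by (F(x) - F(e)) -
     (A(x) - A(e)) xi, which is small. *)
  have Eq : q x = \sum_(i < m) xi i * F i e + \sum_(i < m) xi i * (F i x - F i e)
     + \sum_(i < m) u i x * ((F i x - F i e) - \sum_(j < m) xi j * (A i j x - A i j e)).
    have Fx : \sum_(i < m) xi i * F i x = \sum_(i < m) \sum_(j < m) u i x * (xi j * A i j x).
      under eq_bigr do rewrite FAx mulr_sumr.
      rewrite exchange_big/=; apply: eq_bigr => i _; apply: eq_bigr => j _.
      by rewrite (Asym j i (oc xab)); ring.
    have E1 : \sum_(i < m) xi i * F i e + \sum_(i < m) xi i * (F i x - F i e) = \sum_(i < m) xi i * F i x.
      by rewrite -big_split/=; apply: eq_bigr => i _; ring.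
    rewrite E1 Fx -big_split/=; apply: eq_bigr => i _.
    have E2 : \sum_(j < m) u i x * (xi j * A i j x) = u i x * \sum_(j < m) xi j * (A i j x - A i j e) + u i x * F i e.
      rewrite -mulrDr Fxi -big_split/= mulr_sumr; apply: eq_bigr => j _; ring.
    by rewrite E2; ring.
  have H3 : `|\sum_(i < m) u i x * ((F i x - F i e) - \sum_(j < m) xi j * (A i j x - A i j e))|
     <= \sum_(i < m) `|u i x| * w i x.
    apply: le_trans (ler_norm_sum _ _ _) _; apply: ler_sum => i _.
    by rewrite normrM ler_wpM2l// /w ler_normB.
  apply: le_trans H3; rewrite qx in Eq; move: Eq H1 H2.
  set S1 := \sum_(i < m) xi i * F i e; set S2 := \sum_(i < m) xi i * (F i x - F i e).
  set S3 := \sum_(i < m) u i x * _ => Eq H1 H2.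
  have Er : r = S2 + S3 - (prim p a x - prim p a e).
    by rewrite /r -/S1; move: Eq; move: (prim p a x) (prim p a e) => *; lra.
  have : `|r| <= `|S2| + `|S3| + `|prim p a x - prim p a e|.
    by rewrite Er; apply: le_trans (ler_normB _ _) _; rewrite lerD2r ler_normD.
  lra.
Qed.

End Boundary.

(** * Weak solution of the boundary value problem *)

Section Existence.
Context {R : realType}.
Local Notation mu := (@lebesgue_measure R).
Implicit Types (x y t : R).
Variables (a b : R) (m : nat).
Variables (A A1 B : 'I_m -> 'I_m -> R -> R) (A0 : 'I_m -> 'I_m -> R) (L M mu0 : R).
Hypothesis ab : a < b.
Hypothesis mA1 : forall i j, mblfun `]a, b[ (A1 i j).
Hypothesis bA1 : forall i j, {ae mu, forall x, `]a, b[ x -> `|A1 i j x| <= L}.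
Hypothesis AE : forall i j x, `[a, b] x -> A i j x = A0 i j + prim (A1 i j) a x.
Hypothesis Asym : forall i j x, `[a, b] x -> A i j x = A j i x.
Hypothesis mB : forall i j, mblfun `]a, b[ (B i j).
Hypothesis bB : forall i j, {ae mu, forall x, `]a, b[ x -> `|B i j x| <= M}.
Hypothesis mu0_gt0 : 0 < mu0.
Hypothesis coercive : {ae mu, forall x, `]a, b[ x -> forall v : 'I_m -> R,
  2 * mu0 * \sum_(i < m) v i ^+ 2 <=
  \sum_(i < m) \sum_(j < m) v i * (B i j x + B j i x + A1 i j x) * v j}.

Variables (Na Nb : ('I_m -> R) -> Prop).
Hypothesis Na0 : Na (fun=> 0).
Hypothesis NaD : forall v w t, Na v -> Na w -> Na (fun i => v i + t * w i).
Hypothesis Nb0 : Nb (fun=> 0).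
Hypothesis NbD : forall v w t, Nb v -> Nb w -> Nb (fun i => v i + t * w i).
Hypothesis Na_form : forall v, Na v -> 0 <= \sum_(i < m) \sum_(j < m) v i * A i j a * v j.
Hypothesis Nb_form : forall v, Nb v -> \sum_(i < m) \sum_(j < m) v i * A i j b * v j <= 0.

Let oc x : `]a, b[ x -> `[a, b] x. Proof. exact: subset_itv_oo_cc. Qed.
Let ca : `[a, b] a. Proof. by rewrite /= in_itv/= lexx ltW. Qed.
Let cb : `[a, b] b. Proof. by rewrite /= in_itv/= lexx ltW. Qed.
Let L2A1 i j : L2 `]a, b[ (A1 i j). Proof. exact: L2_bounded (bA1 i j). Qed.
Let L1A1 i j : L1 `]a, b[ (A1 i j). Proof. exact: L2_L1. Qed.
Let L2A i j : L2 `]a, b[ (A i j).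
Proof.
have LP := prim_L2 (A0 i j) (L1A1 i j) ab; apply: (L2_ae (moo a b) LP).
- by apply: eq_measurable_fun (L2_meas LP) => x; rewrite inE => xab; exact/esym/AE/oc.
- by apply: aeT => x xab; rewrite AE//; exact: oc.
Qed.
Let mA i j : mblfun `]a, b[ (A i j). Proof. exact: L2_meas. Qed.
Let bA i j : {ae mu, forall x, `]a, b[ x -> `|A i j x| <= `|A0 i j| + \int[mu]_(t in `]a, b[) `|A1 i j t|}.
Proof.
apply: aeT => x xab; rewrite AE; last exact: oc.
apply: le_trans (ler_normD _ _) _; rewrite lerD2l; apply: prim_norm_le => //.
by move: xab; rewrite /= in_itv/= => /andP[_ /ltW].
Qed.

Lemma L2_coefA i j f : L2 `]a, b[ f -> L2 `]a, b[ (fun x => A i j x * f x).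
Proof. by move=> Lf; exact: (L2_bdd (moo a b) Lf (mA i j) (bA i j)). Qed.
Lemma L2_coefA1 i j f : L2 `]a, b[ f -> L2 `]a, b[ (fun x => A1 i j x * f x).
Proof. by move=> Lf; exact: (L2_bdd (moo a b) Lf (mA1 i j) (bA1 i j)). Qed.
Lemma L2_coefB i j f : L2 `]a, b[ f -> L2 `]a, b[ (fun x => B i j x * f x).
Proof. by move=> Lf; exact: (L2_bdd (moo a b) Lf (mB i j) (bB i j)). Qed.

Let V : Type := (('I_m -> R -> R) * ('I_m -> R -> R))%type.
Let lc (u : V) t (v : V) : V := (fun i x => u.1 i x + t * v.1 i x, fun i x => u.2 i x + t * v.2 i x).

Let admissible (v : V) := [/\ forall i, C1 (v.1 i) (v.2 i),
  Na (fun i => v.1 i a) & Nb (fun i => v.1 i b)].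

(** The operator T~ v = - (A v)' + (B^T + A') v in its simplified form - A v' + B^T v, where A' has
    cancelled. *)
Let Lt (v : V) i x : R := - \sum_(j < m) A i j x * v.2 j x + \sum_(j < m) B j i x * v.1 j x.

Let C1_L2 v i : admissible v -> L2 `]a, b[ (v.1 i) /\ L2 `]a, b[ (v.2 i).
Proof.
move=> [vC _ _]; split; apply: cont_L2; first exact: C1_cont (vC i).
by case: (vC i).
Qed.

Let Lt_L2 v i : admissible v -> L2 `]a, b[ (Lt v i).
Proof.
move=> Pv; apply: L2D => //; first apply: L2N => //.
- by apply: L2_sum => // j _; apply: L2_coefA; case: (C1_L2 j Pv).
- by apply: L2_sum => // j _; apply: L2_coefB; case: (C1_L2 j Pv).
Qed.

Let Lt_lin u v t i x : Lt (lc u t v) i x = Lt u i x + t * Lt v i x.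
Proof.
rewrite /Lt/= mulrDr mulrN !mulr_sumr.
under eq_bigr do rewrite mulrDr mulrCA.
under [X in _ + X]eq_bigr do rewrite mulrDr mulrCA.
by rewrite !big_split/=; ring.
Qed.

Lemma C1_lin (v dv w dw : R -> R) t : C1 v dv -> C1 w dw ->
  C1 (fun x => v x + t * w x) (fun x => dv x + t * dw x).
Proof.
move=> [hv cv] [hw cw]; split => x; last first.
  by apply: cvgD; [exact: cv|apply: cvgMr; exact: cw].
have := is_deriveD (hv x) (isdM (is_derive_cst t x 1) (hw x)).
by rewrite /cst mul0r add0r.
Qed.

Let admissible_lin u v t : admissible u -> admissible v -> admissible (lc u t v).
Proof.
move=> [uC uN uN'] [vC vN vN']; split.
- by move=> i; exact: (C1_lin t (uC i) (vC i)).
- exact: (NaD t uN vN).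
- exact: (NbD t uN' vN').
Qed.

Let bilin (v w : V) := \sum_(i < m) \int[mu]_(x in `]a, b[) (Lt v i x * Lt w i x).

Variables (al0 be0 : 'I_m -> R).
(** Affine lifting of the boundary data. The function [f] below is T_1 h, and the solution is sought
    as h - w with w representing v |-> <f, v> through T~ v. *)
Let h i x := al0 i + (be0 i - al0 i) / (b - a) * (x - a).
Let dh i (x : R) := (be0 i - al0 i) / (b - a).

Lemma affine_C1 (p r s : R) : C1 (fun x => p + r * (x - s)) (fun=> r).
Proof.
split => [x|]; last exact: cst_continuous.
have := is_deriveD (is_derive_cst p x 1) (isdM (is_derive_cst r x 1)
  (is_deriveB (is_derive_id x (1 : R)) (is_derive_cst s x 1))).
by rewrite /cst mul0r !add0r subr0 mulr1.
Qed.

Let hC i : C1 (h i) (dh i). Proof. exact: affine_C1. Qed.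
Let ha i : h i a = al0 i. Proof. by rewrite /h subrr mulr0 addr0. Qed.
Let hb i : h i b = be0 i.
Proof. by rewrite /h divfK ?subr_eq0 ?gt_eqF// addrC subrK. Qed.
Let h_L2 i : L2 `]a, b[ (h i). Proof. by apply: cont_L2; exact: C1_cont (hC i). Qed.
Let dh_L2 i : L2 `]a, b[ (dh i). Proof. by apply: cont_L2; case: (hC i). Qed.

Let f i x := \sum_(j < m) (A1 i j x * h j x + A i j x * dh j x + B i j x * h j x).
Let f_L2 i : L2 `]a, b[ (f i).
Proof.
apply: L2_sum => // j _; apply: L2D => //; last exact: L2_coefB.
by apply: L2D => //; [exact: L2_coefA1|exact: L2_coefA].
Qed.

Let lin (v : V) := \sum_(i < m) \int[mu]_(x in `]a, b[) (f i x * v.1 i x).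

Let IBP_A i j (v dv w dw : R -> R) : C1 v dv -> C1 w dw ->
  \int[mu]_(x in `]a, b[) (A1 i j x * (v x * w x) + A i j x * (dv x * w x + v x * dw x)) =
  A i j b * (v b * w b) - A i j a * (v a * w a).
Proof.
move=> vC wC; have vw := C1M vC wC.
have cvw := C1_cont vw; have cdvw := vw.2.
have := IBP (A0 i j) ab (L1A1 i j) vw.
rewrite -(AE _ _ cb) -[A0 i j in RHS](_ : A i j a = _); last by rewrite AE// prim0 addr0.
move=> <-; rewrite RintegralD//; first last.
- by apply: L2M => //; exact: cont_L2.
- by apply: L2M => //; exact: cont_L2.
congr (_ + _); apply: eq_Rintegral => x; rewrite inE => xab; rewrite AE//; exact: oc.
Qed.

Let L1_lt_sqr v i : admissible v -> L1 `]a, b[ (fun x => Lt v i x ^+ 2).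
Proof. by move=> Pv; case: (Lt_L2 i Pv). Qed.

Let L1_sqr v i : admissible v -> L1 `]a, b[ (fun x => v.1 i x ^+ 2).
Proof. by move=> Pv; case: (C1_L2 i Pv) => -[]. Qed.

Let mbl_lt_v v : admissible v -> L1 `]a, b[ (fun x => \sum_(i < m) Lt v i x * v.1 i x).
Proof.
move=> Pv; apply: L1_sum => // i _; apply: L2M => //; first exact: Lt_L2.
by case: (C1_L2 i Pv).
Qed.

(** Pointwise 2 T~v . v + (v . A v)' = v . (B + B^T + A') v, with [G] standing for (v . A v)'. Its
    integral is v(b) . A(b) v(b) - v(a) . A(a) v(a), which is <= 0 by the choice of [Na] and
    [Nb]. *)
Let coercive_v v : admissible v ->
  mu0 * (\int[mu]_(x in `]a, b[) \sum_(i < m) v.1 i x ^+ 2) <=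
  \int[mu]_(x in `]a, b[) \sum_(i < m) Lt v i x * v.1 i x.
Proof.
move=> Pv; have [vC vN vN'] := Pv.
have Lv i : L2 `]a, b[ (v.1 i) by case: (C1_L2 i Pv).
have Ldv i : L2 `]a, b[ (v.2 i) by case: (C1_L2 i Pv).
pose G x := \sum_(i < m) \sum_(j < m) (A1 i j x * (v.1 i x * v.1 j x)
  + A i j x * (v.2 i x * v.1 j x + v.1 i x * v.2 j x)).
have cvv i j : continuous (fun x => v.1 i x * v.1 j x) by exact: C1_cont (C1M (vC i) (vC j)).
have cdvv i j : continuous (fun x => v.2 i x * v.1 j x + v.1 i x * v.2 j x) by case: (C1M (vC i) (vC j)).
have LGij i j : L1 `]a, b[ (fun x => A1 i j x * (v.1 i x * v.1 j x)
  + A i j x * (v.2 i x * v.1 j x + v.1 i x * v.2 j x)).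
  by apply: L1D => //; apply: L2M => //; exact: cont_L2.
have LGi i : L1 `]a, b[ (fun x => \sum_(j < m) (A1 i j x * (v.1 i x * v.1 j x)
  + A i j x * (v.2 i x * v.1 j x + v.1 i x * v.2 j x))) by apply: L1_sum => // j _; exact: LGij.
have LG : L1 `]a, b[ G by apply: L1_sum.
have IG : \int[mu]_(x in `]a, b[) G x <= 0.
  rewrite Rint_sum//.
  under eq_bigr => i _ do rewrite Rint_sum//.
  under eq_bigr => i _ do under eq_bigr => j _ do rewrite IBP_A//.
  under eq_bigr => i _ do rewrite sumrB.
  rewrite sumrB subr_le0; apply: (@le_trans _ _ 0).
    have := Nb_form vN'; congr (_ <= _); apply: eq_bigr => i _; apply: eq_bigr => j _; ring.
  have := Na_form vN; congr (_ <= _); apply: eq_bigr => i _; apply: eq_bigr => j _; ring.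
have LS : L1 `]a, b[ (fun x => \sum_(i < m) v.1 i x ^+ 2) by apply: L1_sum => // i _; exact: L1_sqr.
have Llt := mbl_lt_v Pv.
suff H : \int[mu]_(x in `]a, b[) (2 * mu0 * \sum_(i < m) v.1 i x ^+ 2) <=
    \int[mu]_(x in `]a, b[) (2 * (\sum_(i < m) Lt v i x * v.1 i x) + G x).
  move: H; rewrite (RintegralZl _ (moo a b) LS) (RintegralD (moo a b) (L1Z (moo a b) 2 Llt) LG).
  by rewrite (RintegralZl _ (moo a b) Llt); lra.
apply: Rint_ae_le => //; [exact: L1Z|by apply: L1D => //; exact: L1Z|].
apply: (aeS _ coercive) => x hx xab; apply: le_trans (hx xab (fun i => v.1 i x)) _.
rewrite le_eqVlt; apply/orP; left; apply/eqP.
have S1 : \sum_(i < m) Lt v i x * v.1 i x =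
   \sum_(i < m) \sum_(j < m) (- (A i j x * v.2 j x * v.1 i x) + B j i x * v.1 j x * v.1 i x).
  apply: eq_bigr => i _; rewrite /Lt mulrDl mulNr !mulr_suml -sumrN -big_split/=.
  by apply: eq_bigr => j _.
have S2 : \sum_(i < m) \sum_(j < m) A i j x * (v.2 i x * v.1 j x) =
   \sum_(i < m) \sum_(j < m) A i j x * v.2 j x * v.1 i x.
  rewrite exchange_big/=; apply: eq_bigr => i _; apply: eq_bigr => j _.
  by rewrite (Asym j i (oc xab)); ring.
have S3 : \sum_(i < m) \sum_(j < m) v.1 i x * B i j x * v.1 j x =
   \sum_(i < m) \sum_(j < m) B j i x * v.1 j x * v.1 i x.
  by rewrite exchange_big/=; apply: eq_bigr => i _; apply: eq_bigr => j _; ring.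
rewrite S1 /G.
transitivity (\sum_(i < m) \sum_(j < m) v.1 i x * B i j x * v.1 j x
  + \sum_(i < m) \sum_(j < m) (B j i x * v.1 j x * v.1 i x + A1 i j x * (v.1 i x * v.1 j x))).
  by rewrite -big_split/=; apply: eq_bigr => i _; rewrite -big_split/=; apply: eq_bigr => j _; ring.
rewrite S3.
transitivity (2 * (\sum_(i < m) \sum_(j < m) (- (A i j x * v.2 j x * v.1 i x) + B j i x * v.1 j x * v.1 i x))
  + \sum_(i < m) \sum_(j < m) (A1 i j x * (v.1 i x * v.1 j x) + A i j x * v.2 j x * v.1 i x)
  + \sum_(i < m) \sum_(j < m) A i j x * (v.2 i x * v.1 j x)).
  rewrite S2 mulr_sumr -!big_split/=; apply: eq_bigr => i _.
  by rewrite mulr_sumr -!big_split/=; apply: eq_bigr => j _; ring.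
rewrite -addrA -big_split/=; congr (_ + _); apply: eq_bigr => i _.
by rewrite -big_split/=; apply: eq_bigr => j _; ring.
Qed.

Let bilinE v : admissible v -> bilin v v = \int[mu]_(x in `]a, b[) \sum_(i < m) Lt v i x ^+ 2.
Proof.
move=> Pv; rewrite Rint_sum//; last by move=> i _; exact: L1_lt_sqr.
Qed.

(** Young's inequality 2 mu0 T~v . v <= |T~v|^2 + mu0^2 |v|^2 combined with [coercive_v], which
    bounds the integral of the left side below by 2 mu0^2 |v|^2. *)
Let energy v : admissible v ->
  mu0 ^+ 2 * (\int[mu]_(x in `]a, b[) \sum_(i < m) v.1 i x ^+ 2) <= bilin v v.
Proof.
move=> Pv; have Llt := mbl_lt_v Pv.
have LS : L1 `]a, b[ (fun x => \sum_(i < m) v.1 i x ^+ 2) by apply: L1_sum => // i _; exact: L1_sqr.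
have LS2 : L1 `]a, b[ (fun x => \sum_(i < m) Lt v i x ^+ 2) by apply: L1_sum => // i _; exact: L1_lt_sqr.
have : \int[mu]_(x in `]a, b[) (2 * mu0 * \sum_(i < m) Lt v i x * v.1 i x) <=
   \int[mu]_(x in `]a, b[) (\sum_(i < m) Lt v i x ^+ 2 + mu0 ^+ 2 * \sum_(i < m) v.1 i x ^+ 2).
  apply: Rint_ae_le => //; [exact: L1Z|by apply: L1D => //; exact: L1Z|].
  apply: aeT => x _; rewrite 2!mulr_sumr -big_split/=; apply: ler_sum => i _.
  by rewrite -subr_ge0 (_ : _ - _ = (Lt v i x - mu0 * v.1 i x) ^+ 2) ?sqr_ge0//; ring.
rewrite (RintegralZl _ (moo a b) Llt) (RintegralD (moo a b) LS2 (L1Z (moo a b) _ LS)).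
rewrite (RintegralZl _ (moo a b) LS) -bilinE//.
have := coercive_v Pv; have m0 := mu0_gt0.
set X := \int[mu]_(x in _) _; set Y := \int[mu]_(x in _) _ => h1 h2.
have h3 : mu0 * (mu0 * X) <= mu0 * Y by rewrite ler_wpM2l// ltW.
by rewrite expr2; move: h2; rewrite expr2; lra.
Qed.

Let lin_bound v : admissible v ->
  2 * lin v <= bilin v v + (mu0 ^+ 2)^-1 * \int[mu]_(x in `]a, b[) \sum_(i < m) f i x ^+ 2.
Proof.
move=> Pv; have Lv i : L2 `]a, b[ (v.1 i) by case: (C1_L2 i Pv).
have LS : L1 `]a, b[ (fun x => \sum_(i < m) v.1 i x ^+ 2) by apply: L1_sum => // i _; exact: L1_sqr.
have Lf : L1 `]a, b[ (fun x => \sum_(i < m) f i x ^+ 2) by apply: L1_sum => // i _; case: (f_L2 i).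
have Lfv i : L1 `]a, b[ (fun x => f i x * v.1 i x) by exact: L2M.
have m2 : 0 < mu0 ^+ 2 by rewrite exprn_gt0.
apply: le_trans (lerD (energy Pv) (lexx _)).
rewrite -(RintegralZl _ (moo a b) LS) -(RintegralZl _ (moo a b) Lf).
rewrite -(RintegralD (moo a b) (L1Z (moo a b) _ LS) (L1Z (moo a b) _ Lf)).
rewrite /lin -Rint_sum// -(RintegralZl _ (moo a b)); last by apply: L1_sum.
apply: Rint_ae_le => //; first by apply: L1Z => //; apply: L1_sum.
  by apply: L1D => //; exact: L1Z.
apply: aeT => x _; rewrite 3!mulr_sumr -big_split/=; apply: ler_sum => i _.
rewrite -subr_ge0 (_ : _ - _ = (mu0 * v.1 i x - mu0^-1 * f i x) ^+ 2) ?sqr_ge0//.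
by field; rewrite gt_eqF.
Qed.

(** The limit is taken of T~ v_n, which is Cauchy in L^2 because [bilin] is the L^2 product of the
    images under T~; the approximate Euler-Lagrange equations then pass to the limit. *)
Let exists_w : exists w : 'I_m -> R -> R, (forall i, L2 `]a, b[ (w i)) /\
  forall v, admissible v -> \sum_(i < m) \int[mu]_(x in `]a, b[) (w i x * Lt v i x) = lin v.
Proof.
have adm0 : admissible (fun _ _ => 0, fun _ _ => 0).
  split=> // i; split => [x|]; last exact: cst_continuous.
  exact: is_derive_cst.
have LtM v w i : admissible v -> admissible w -> L1 `]a, b[ (fun x => Lt v i x * Lt w i x).
  by move=> Pv Pw; apply: L2M => //; exact: Lt_L2.
have Lfv v i : admissible v -> L1 `]a, b[ (fun x => f i x * v.1 i x).
  by move=> Pv; apply: L2M => //; case: (C1_L2 i Pv).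
have [|||||||v_ [Pv cauchy EL]] := @minimizing_sequence R V lc admissible bilin lin
  ((mu0 ^+ 2)^-1 * \int[mu]_(x in `]a, b[) \sum_(i < m) f i x ^+ 2).
- by exists (fun _ _ => 0, fun _ _ => 0).
- by move=> u v t; exact: admissible_lin.
- by move=> u v _ _; apply: eq_bigr => i _; apply: eq_Rintegral => x _; rewrite mulrC.
- move=> u v w t Pu Pv Pw; rewrite /bilin mulr_sumr -big_split/=; apply: eq_bigr => i _.
  rewrite -(RintegralZl _ (moo a b) (LtM _ _ i Pv Pw)).
  rewrite -(RintegralD (moo a b) (LtM _ _ i Pu Pw) (L1Z (moo a b) _ (LtM _ _ i Pv Pw))).
  by apply: eq_Rintegral => x _; rewrite Lt_lin; ring.
- move=> u Pu; apply: sumr_ge0 => i _; apply: Rintegral_ge0 => x _.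
  by rewrite -expr2 sqr_ge0.
- move=> u v t Pu Pv; rewrite /lin mulr_sumr -big_split/=; apply: eq_bigr => i _.
  rewrite -(RintegralZl _ (moo a b) (Lfv _ i Pv)).
  rewrite -(RintegralD (moo a b) (Lfv _ i Pu) (L1Z (moo a b) _ (Lfv _ i Pv))).
  by apply: eq_Rintegral => x _ /=; ring.
- by move=> u Pu; exact: lin_bound.
have cau i n k : (n <= k)%N ->
  \int[mu]_(x in `]a, b[) (Lt (v_ k) i x - Lt (v_ n) i x) ^+ 2 <= 4 * 8^-1 ^+ n.
  move=> nk; apply: le_trans (cauchy n k nk); rewrite /bilin (bigD1 i)//=.
  rewrite [X in X <= _](_ : _ = \int[mu]_(x in `]a, b[) (Lt (lc (v_ k) (-1) (v_ n)) i x * Lt (lc (v_ k) (-1) (v_ n)) i x)).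
    rewrite lerDl; apply: sumr_ge0 => j _; apply: Rintegral_ge0 => x _.
    by rewrite -expr2 sqr_ge0.
  by apply: eq_Rintegral => x _; rewrite Lt_lin -expr2; congr (_ ^+ 2); ring.
have /choice[w hw] i : exists w, L2 `]a, b[ w /\
    forall n, \int[mu]_(x in `]a, b[) (w x - Lt (v_ n) i x) ^+ 2 <= 4 * 8^-1 ^+ n.
  have [w Lw hw] := L2_complete (fun n => Lt_L2 i (Pv n)) (fun n k nk => cau i n k nk).
  by exists w.
exists w; split => [i|v Pv']; first by case: (hw i).
have geo (c : R) : c * 8^-1 ^+ n @[n --> \oo] --> (0 : R).
  by apply: (@cvg_geometric R c 8^-1); rewrite ger0_norm// invf_lt1// ltr1n.
have lim1 : bilin (v_ n) v @[n --> \oo] --> \sum_(i < m) \int[mu]_(x in `]a, b[) (w i x * Lt v i x).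
  apply: cvg_sumr => i; have [Lw hwi] := hw i.
  apply: (@L2cvg_mul R `]a, b[ (moo a b) (fun n => Lt (v_ n) i) (fun=> Lt v i)).
  - by move=> n; exact: Lt_L2.
  - by move=> _; exact: Lt_L2.
  - exact: Lw.
  - exact: Lt_L2.
  - apply: (squeeze_cvgr _ (cvg_cst 0) (geo 4)); apply: nearW => n.
    rewrite Rintegral_ge0 => [/=|x _]; last exact: sqr_ge0.
    by apply: le_trans (hwi n); rewrite le_eqVlt; apply/orP; left; apply/eqP; apply: eq_Rintegral => x _; ring.
  - rewrite (_ : \int[mu]_(x in _) _ = 0); first exact: cvg_cst.
    by apply: Rint_zero => x _; rewrite subrr expr0n.
have lim2 : bilin (v_ n) v @[n --> \oo] --> lin v.
  apply/subr_cvg0; apply: cvg_sqrt0.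
  apply: (squeeze_cvgr _ (cvg_cst 0) (geo (bilin v v))); apply: nearW => n.
  by rewrite sqr_ge0/= mulrC; exact: EL.
by rewrite -(cvg_lim (@Rhausdorff R) lim1) -(cvg_lim (@Rhausdorff R) lim2).
Qed.

(** With u = h - w, integrating (v . A h)' gives <u, T~ v> = v(a) . A(a) al0 - v(b) . A(b) be0 for
    every admissible v. Compactly supported v yield the equation for A u; v with arbitrary
    admissible end values then yield the boundary conditions. *)
Lemma real_existence : exists (u : 'I_m -> R -> R) (c0 : 'I_m -> R),
  [/\ forall i, L2 `]a, b[ (u i),
   {ae mu, forall x, `]a, b[ x -> forall i,
     c0 i + prim (fun t => - \sum_(j < m) B i j t * u j t) a x = \sum_(j < m) A i j x * u j x},
   forall v, Na v -> \sum_(i < m) v i * c0 i = \sum_(i < m) \sum_(j < m) v i * A i j a * al0 j &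
   forall v, Nb v -> \sum_(i < m) v i * (c0 i + prim (fun t => - \sum_(j < m) B i j t * u j t) a b)
     = \sum_(i < m) \sum_(j < m) v i * A i j b * be0 j].
Proof.
have [w [Lw wE]] := exists_w.
pose u i x := h i x - w i x.
have Lu i : L2 `]a, b[ (u i) by exact: L2B.
pose g i x := - \sum_(j < m) B i j x * u j x.
have Lg i : L2 `]a, b[ (g i).
  by apply: L2N => //; apply: L2_sum => // j _; exact: L2_coefB.
have L1g i : L1 `]a, b[ (g i) by exact: L2_L1.
have weak v : admissible v -> \sum_(i < m) \int[mu]_(x in `]a, b[) (u i x * Lt v i x) =
    \sum_(i < m) \sum_(j < m) v.1 i a * A i j a * al0 j - \sum_(i < m) \sum_(j < m) v.1 i b * A i j b * be0 j.
  move=> Pv; have [vC _ _] := Pv.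
  have Lv i : L2 `]a, b[ (v.1 i) by case: (C1_L2 i Pv).
  have Llt i := Lt_L2 i Pv.
  have -> : \sum_(i < m) \int[mu]_(x in `]a, b[) (u i x * Lt v i x) =
      \sum_(i < m) \int[mu]_(x in `]a, b[) (h i x * Lt v i x) - lin v.
    rewrite -wE// -sumrB; apply: eq_bigr => i _.
    rewrite -(RintegralB (moo a b) (L2M (moo a b) (h_L2 i) (Llt i)) (L2M (moo a b) (Lw i) (Llt i))).
    by apply: eq_Rintegral => x _; rewrite mulrBl.
  rewrite /lin -!Rint_sum//; [|by move=> i _; exact: L2M..].
  have L1a : L1 `]a, b[ (fun x => \sum_(i < m) h i x * Lt v i x) by apply: L1_sum => // i _; exact: L2M.
  have L1b : L1 `]a, b[ (fun x => \sum_(i < m) f i x * v.1 i x) by apply: L1_sum => // i _; exact: L2M.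
  rewrite -(RintegralB (moo a b) L1a L1b).
  pose G i j x := A1 i j x * (v.1 i x * h j x) + A i j x * (v.2 i x * h j x + v.1 i x * dh j x).
  have LGij i j : L1 `]a, b[ (G i j).
    have cC := C1M (vC i) (hC j); have c1 := C1_cont cC; have c2 := cC.2.
    by apply: L1D => //; apply: L2M => //; exact: cont_L2.
  rewrite (@eq_Rintegral _ _ _ mu _ (fun x => -1 * \sum_(i < m) \sum_(j < m) G i j x)); last first.
    move=> x; rewrite inE => xab.
    have S1 : \sum_(i < m) h i x * Lt v i x = \sum_(i < m) \sum_(j < m)
        (- (A i j x * v.2 i x * h j x) + B i j x * v.1 i x * h j x).
      under eq_bigr do rewrite /Lt mulrDr mulrN !mulr_sumr -sumrN -big_split/=.
      rewrite exchange_big/=; apply: eq_bigr => i _; apply: eq_bigr => j _.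
      by rewrite (Asym j i (oc xab)); ring.
    rewrite S1 mulN1r -sumrB -sumrN; apply: eq_bigr => i _.
    rewrite /f mulr_suml -sumrB -sumrN; apply: eq_bigr => j _; rewrite /G; ring.
  rewrite RintegralZl//; last by apply: L1_sum => // i _; apply: L1_sum.
  rewrite Rint_sum//; last by move=> i _; apply: L1_sum.
  rewrite mulN1r -sumrN -sumrB; apply: eq_bigr => i _.
  rewrite Rint_sum// -sumrN -sumrB; apply: eq_bigr => j _.
  by rewrite /G IBP_A// ha hb; ring.
have split_test v : (forall i, C1 (v.1 i) (v.2 i)) ->
   \sum_(i < m) \int[mu]_(x in `]a, b[) (u i x * Lt v i x) =
   - \sum_(i < m) (\int[mu]_(x in `]a, b[) ((\sum_(j < m) A i j x * u j x) * v.2 i x)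
      + \int[mu]_(x in `]a, b[) (g i x * v.1 i x)).
  move=> vC; have Lv i : L2 `]a, b[ (v.1 i) by apply: cont_L2; exact: C1_cont (vC i).
  have Ldv i : L2 `]a, b[ (v.2 i) by apply: cont_L2; case: (vC i).
  have LAu i : L2 `]a, b[ (fun x => \sum_(j < m) A i j x * u j x).
    by apply: L2_sum => // j _; exact: L2_coefA.
  have Llt i : L2 `]a, b[ (Lt v i).
    by apply: L2D => //; [apply: L2N => //|]; apply: L2_sum => // j _; [exact: L2_coefA|exact: L2_coefB].
  have La i := L2M (moo a b) (LAu i) (Ldv i); have Lb i := L2M (moo a b) (Lg i) (Lv i).
  under [in RHS]eq_bigr => i _ do rewrite -(RintegralD (moo a b) (La i) (Lb i)).
  rewrite -!Rint_sum//; first last.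
  - by move=> i _; exact: L2M.
  - by move=> i _; exact: (L1D (moo a b) (La i) (Lb i)).
  rewrite -mulN1r -RintegralZl//; last by apply: L1_sum => // i _; exact: L1D.
  apply: eq_Rintegral => x; rewrite inE => xab; rewrite mulN1r -sumrN.
  transitivity (\sum_(i < m) \sum_(j < m) (- (A i j x * u j x * v.2 i x) + B i j x * u j x * v.1 i x)).
    under eq_bigr do rewrite /Lt mulrDr mulrN !mulr_sumr -sumrN -big_split/=.
    rewrite exchange_big/=; apply: eq_bigr => i _; apply: eq_bigr => j _.
    by rewrite (Asym j i (oc xab)); ring.
  apply: eq_bigr => i _; rewrite /g mulNr !mulr_suml opprB -sumrB.
  by apply: eq_bigr => j _; ring.
have rep k : exists c, {ae mu, forall x, `]a, b[ x -> \sum_(j < m) A k j x * u j x = c + prim (g k) a x}.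
  have LAu : L2 `]a, b[ (fun x => \sum_(j < m) A k j x * u j x).
    by apply: L2_sum => // j _; exact: L2_coefA.
  apply: weak_deriv_prim => //; first exact: L2_L1.
  move=> phi tphi; have pC := test_C1 tphi.
  (* The test function sits in the k-th component alone; it vanishes at both ends, so it is
     admissible because [Na] and [Nb] contain 0. *)
  pose v : V := (fun i x => (i == k)%:R * phi x, fun i x => (i == k)%:R * derive1 phi x).
  have vC i : C1 (v.1 i) (v.2 i).
    have c0 : C1 (fun=> 0 : R) (fun=> 0).
      by split => [x|]; [exact: is_derive_cst|exact: cst_continuous].
    have := C1_lin (i == k)%:R c0 pC.
    by congr C1; apply/funext => x; rewrite add0r.
  case: (tphi) => _ [c [d [ac [db hphi]]]].
  have pa : phi a = 0 by apply: hphi; left.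
  have pb : phi b = 0 by apply: hphi; right.
  have Pv : admissible v.
    split => //.
    - by rewrite (_ : (fun i => _) = fun=> 0)//; apply/funext => i; rewrite /v/= pa mulr0.
    - by rewrite (_ : (fun i => _) = fun=> 0)//; apply/funext => i; rewrite /v/= pb mulr0.
  have za : \sum_(i < m) \sum_(j < m) v.1 i a * A i j a * al0 j = 0.
    by rewrite big1// => i _; rewrite big1// => j _; rewrite /v/= pa mulr0 !mul0r.
  have zb : \sum_(i < m) \sum_(j < m) v.1 i b * A i j b * be0 j = 0.
    by rewrite big1// => i _; rewrite big1// => j _; rewrite /v/= pb mulr0 !mul0r.
  have := weak v Pv; rewrite split_test// za zb subr0.
  rewrite (bigD1 k)//= big1 ?addr0; last first.
    move=> i ik; rewrite !Rint_zero ?addr0// => x _; rewrite /v/= (negbTE ik) mul0r mulr0//.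
  move=> /eqP; rewrite oppr_eq0 addr_eq0 => /eqP.
  rewrite (@eq_Rintegral _ _ _ mu _ (fun x => (\sum_(j < m) A k j x * u j x) * derive1 phi x)); last first.
    by move=> x _; rewrite /v/= eqxx mul1r.
  move=> ->; congr (- _); apply: eq_Rintegral => x _.
  by rewrite /v/= eqxx mul1r.
have /choice[c0 hc0] := rep.
have FA := ae_all hc0.
have bc v : admissible v -> \sum_(i < m) v.1 i b * (c0 i + prim (g i) a b) - \sum_(i < m) v.1 i a * c0 i =
   \sum_(i < m) \sum_(j < m) v.1 i b * A i j b * be0 j - \sum_(i < m) \sum_(j < m) v.1 i a * A i j a * al0 j.
  move=> Pv; have [vC _ _] := Pv; apply: oppr_inj; rewrite [RHS]opprB -weak// split_test//; congr (- _).
  rewrite -sumrB; apply: eq_bigr => i _.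
  have Ldv : L2 `]a, b[ (v.2 i) by apply: cont_L2; case: (vC i).
  have LAu : L2 `]a, b[ (fun x => \sum_(j < m) A i j x * u j x).
    by apply: L2_sum => // j _; exact: L2_coefA.
  have Lp := prim_L2 (c0 i) (L1g i) ab.
  have := IBP (c0 i) ab (L1g i) (vC i).
  rewrite (mulrC _ (v.1 i b)) (mulrC _ (v.1 i a)) => <-; rewrite addrC; congr (_ + _).
  apply: Rint_ae => //; try (apply: L1_meas; exact: L2M).
  by apply: (aeS _ (hc0 i)) => x hx xab; rewrite hx.
(* Affine functions realise every admissible pair of end values. Putting 0 at one end separates the
   two boundary conditions. *)
have aff (al be : 'I_m -> R) : Na al -> Nb be -> exists2 v, admissible v &
    (forall i, v.1 i a = al i) /\ (forall i, v.1 i b = be i).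
  move=> Hal Hbe.
  pose v : V := (fun i x => al i + (be i - al i) / (b - a) * (x - a), fun i _ => (be i - al i) / (b - a)).
  have va i : v.1 i a = al i by rewrite /v/= subrr mulr0 addr0.
  have vb i : v.1 i b = be i by rewrite /v/= divfK ?subr_eq0 ?gt_eqF// addrC subrK.
  exists v => //; split.
  - by move=> i; exact: affine_C1.
  - by rewrite (_ : (fun i => _) = al)//; apply/funext.
  - by rewrite (_ : (fun i => _) = be)//; apply/funext.
exists u, c0; split => //.
- by apply: (aeS _ FA) => x hx xab i; rewrite hx.
- move=> al Hal; have [v Pv [va vb]] := aff _ _ Hal Nb0.
  have := bc v Pv; under eq_bigr do rewrite vb mul0r.
  rewrite big1// sub0r; under eq_bigr do rewrite va.
  rewrite [X in _ = X - _]big1 ?sub0r; last by move=> i _; rewrite big1// => j _; rewrite vb !mul0r.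
  move=> /oppr_inj ->; apply: eq_bigr => i _; apply: eq_bigr => j _; by rewrite va.
- move=> be Hbe; have [v Pv [va vb]] := aff _ _ Na0 Hbe.
  have := bc v Pv; under [X in _ - X = _]eq_bigr do rewrite va mul0r.
  rewrite [X in _ - X = _]big1// subr0; under eq_bigr do rewrite vb.
  rewrite [X in _ = _ - X]big1 ?subr0; last by move=> i _; rewrite big1// => j _; rewrite va !mul0r.
  move=> ->; apply: eq_bigr => i _; apply: eq_bigr => j _; by rewrite vb.
Qed.

End Existence.

(** Where k is nonzero at a point of [a, b], end points included, it is nonzero on an open
    subinterval of ]a, b[ touching or containing that point, and such an interval has positive
    measure. *)
Lemma within_ae0 {R : realType} (a b : R) (k : R -> R) : a < b ->
  {within `[a, b], continuous k} ->
  {ae @lebesgue_measure R, forall x, `]a, b[ x -> k x = 0} ->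
  forall x, `[a, b] x -> k x = 0.
Proof.
move=> ab /subspace_continuousP kc k0 x xab; apply/eqP/negPn/negP => kx.
have kx0 : 0 < `|k x| by rewrite normr_gt0.
have /cvgrPdist_lt/(_ _ kx0)[eta /= eta0 h] := kc x xab.
move: (xab); rewrite /= in_itv/= => /andP[ax xb].
pose c := Num.max a (x - eta); pose d := Num.min b (x + eta).
have cd : c < d by rewrite gt_max !lt_min; do !(apply/andP; split); lra.
have [||y ycd ky] := @ae_ex R c d (fun y => k y = 0) => //.
  apply: aeS k0 => y ky; rewrite /= in_itv/= => /andP[cy yd]; apply: ky.
  rewrite /= in_itv/=; move: cy yd; rewrite gt_max lt_min => /andP[-> _] /andP[-> _] //.
move: ycd; rewrite /= in_itv/= gt_max lt_min => /andP[/andP[ay xy] /andP[yb yx]].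
have : `|k x - k y| < `|k x|.
  by apply: h; [rewrite /= ltr_norml; lra|rewrite /= in_itv/= !ltW].
by rewrite ky subr0 ltxx.
Qed.

(** * Lipschitz functions as primitives of bounded functions *)

Section LipschitzFunctions.
Context {R : realType}.
Local Notation mu := (@lebesgue_measure R).
Implicit Types (x y t : R).
Variables (a b : R) (f : R -> R) (L : R).
Hypothesis ab : a < b.
Hypothesis fL : forall x y, `[a, b] x -> `[a, b] y -> `|f x - f y| <= L * `|x - y|.

Let oc x : `]a, b[ x -> `[a, b] x. Proof. exact: subset_itv_oo_cc. Qed.
Let ca : `[a, b] a. Proof. by rewrite /= in_itv/= lexx ltW. Qed.
Let cb : `[a, b] b. Proof. by rewrite /= in_itv/= lexx ltW. Qed.

Let L0 : 0 <= L.
Proof.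
have := fL ca cb; rewrite distrC [`|a - b|]distrC (@gtr0_norm _ (b - a)) ?subr_gt0// => h.
have ba : 0 < b - a by rewrite subr_gt0.
by rewrite -(pmulr_lge0 _ ba); apply: le_trans (normr_ge0 _) h.
Qed.

Let f_within : {within `[a, b], continuous f}.
Proof.
apply/subspace_continuousP => x xab; apply/cvgrPdist_le => e e0.
have L1p : 0 < L + 1 by rewrite ltr_wpDl.
exists (e / (L + 1)) => /=; first by rewrite divr_gt0.
move=> y /= xy yab; apply: le_trans (fL xab yab) _.
apply: (@le_trans _ _ ((L + 1) * (e / (L + 1)))); last by rewrite mulrC divfK// gt_eqF.
by rewrite ler_pM// ?(ltW xy)// lerDl.
Qed.

Let f_mbl : mblfun `]a, b[ f.
Proof.
apply: (@measurable_funS _ _ _ _ `[a, b]%classic); first exact: measurable_itv.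
  exact: subset_itv_oo_cc.
by apply: subspace_continuous_measurable_fun => //; exact: measurable_itv.
Qed.

Let f_L2 : L2 `]a, b[ f.
Proof.
apply: (@L2_bounded _ _ _ (`|f a| + L * (b - a))) => //.
apply: aeT => x xab; have := fL (oc xab) ca.
move: xab; rewrite /= in_itv/= => /andP[ax xb].
rewrite [`|x - a|]gtr0_norm ?subr_gt0// => h.
rewrite -[f x](subrK (f a)) addrC; apply: le_trans (ler_normD _ _) _.
by rewrite lerD2l; apply: le_trans h _; rewrite ler_wpM2l// lerD2r ltW.
Qed.

Definition C1c (v : (R -> R) * (R -> R)) := C1 v.1 v.2 /\
  exists c d, [/\ a < c, c < d, d < b & forall x, (x < c) || (d < x) -> v.1 x = 0].

Let C1c_dv v c d : C1 v.1 v.2 -> (forall x, (x < c) || (d < x) -> v.1 x = 0) ->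
  forall x, (x < c) || (d < x) -> v.2 x = 0.
Proof.
move=> [vC _] v0 x xcd.
have z0 : is_derive x (1 : R) (fun=> 0 : R) 0 by exact: is_derive_cst.
have h : is_derive x (1 : R) v.1 0.
  apply: isd_near z0; case/orP : xcd => [xc|dx]; near=> y; apply/esym/v0; apply/orP.
    by left; near: y; exact: lt_nbhsl.
  by right; near: y; exact: lt_nbhsr.
by case: (vC x) => _ <-; case: h.
Unshelve. all: by end_near. Qed.

(** Discrete integration by parts moves the difference quotient from v to f, where the Lipschitz
    bound applies; for small steps the strips left over at the two ends miss the support of v. *)
Lemma lipschitz_weak_bound v : C1c v ->
  `|\int[mu]_(x in `]a, b[) (f x * v.2 x)| <= L * \int[mu]_(x in `]a, b[) `|v.1 x|.
Proof.
move=> [vC [c [d [ac cd db v0]]]]; have v1c := C1_cont vC; have v2c := vC.2.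
have dv0 := C1c_dv vC v0.
(* The step is at most b - b1, so that translates of ]a, b1[ stay in ]a, b[, and at most c - a, so
   that the left strip lies before the support; the right strip starts at b1 > d. *)
pose b1 := (d + b) / 2; pose dl := Num.min (b - b1) (c - a).
have db1 : d < b1 by rewrite /b1; lra.
have b1b : b1 < b by rewrite /b1; lra.
have dl0 : 0 < dl by rewrite lt_min !subr_gt0 ac b1b.
have dl1 : b1 + dl <= b by rewrite addrC -lerBrDr ge_min lexx.
have dl2 : a + dl <= c by rewrite addrC -lerBrDr ge_min lexx orbT.
pose h_ n := dl * n.+1%:R^-1.
have h0 n : 0 < h_ n by rewrite mulr_gt0// invr_gt0.
have hdl n : h_ n <= dl by rewrite /h_ ler_piMr ?(ltW dl0)// invf_le1// ler1n.
have hcvg : h_ n @[n --> \oo] --> (0 : R).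
  by rewrite -[X in _ --> X](mulr0 dl); apply: cvgMr; exact: cvg_harmonic.
have ab1 : a < b1 by lra.
have vprim x : a <= x -> v.1 x = prim v.2 a x.
  rewrite le_eqVlt => /orP[/eqP <-|ax]; first by rewrite prim0 v0// ac.
  by rewrite /prim (FTC2_C1 ax vC) [v.1 a]v0 ?ac// subr0.
have Lv2 : L2 `]a, b1 + dl[ v.2 by exact: cont_L2.
have Lf : L2 `]a, b1 + dl[ f by apply: L2_oo f_L2.
have Lf1 : L2 `]a, b1[ f by apply: L2_oo f_L2 => //; exact: ltW.
have Lv1 x y : L2 `]x, y[ v.1 by exact: cont_L2.
have Ldq n : L2 `]a, b1[ (dq h_ v.1 n).
  have := L2Z (moo a b1) (h_ n)^-1 (L2B (moo a b1) (L2_h h0 hdl n (Lv1 a (b1 + dl))) (Lv1 a b1)).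
  by congr L2; apply/funext => x; rewrite mulrC.
have lim : \int[mu]_(x in `]a, b1[) (f x * dq h_ v.1 n x) @[n --> \oo] --> \int[mu]_(x in `]a, b1[) (f x * v.2 x).
  apply: (@L2cvg_mul R `]a, b1[ (moo a b1) (fun=> f)) => //.
  - exact: cont_L2.
  - rewrite (_ : \int[mu]_(x in _) _ = 0); first exact: cvg_cst.
    by apply: Rint_zero => x _; rewrite subrr expr0n.
  - have h1 := dq_L2_cvg h0 hdl hcvg Lv2 ab1.
    suff E : (fun n => \int[mu]_(x in `]a, b1[) (dq h_ v.1 n x - v.2 x) ^+ 2) =
      (fun n => \int[mu]_(x in `]a, b1[) (dq h_ (prim v.2 a) n x - v.2 x) ^+ 2) by rewrite E.
    apply/funext => n; apply: eq_Rintegral => x.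
    rewrite inE/= in_itv/= => /andP[ax xb]; rewrite /dq !vprim//; first exact: ltW.
    by rewrite ler_wpDr ?(ltW ax) ?(ltW (h0 n)).
have bnd n : `|\int[mu]_(x in `]a, b1[) (f x * dq h_ v.1 n x)| <= L * \int[mu]_(x in `]a, b[) `|v.1 x|.
  pose q x := f x * v.1 x.
  have Lq : L1 `]a, b1 + dl[ q by apply: L2M.
  have := telescope_int h0 hdl n (ltW ab1) Lq.
  rewrite [\int[mu]_(x in `]b1, _[) _]Rint_zero; last first.
    move=> x; rewrite /= in_itv/= => /andP[ax xh]; rewrite /q v0 ?mulr0//; apply/orP; right.
    exact: lt_trans db1 ax.
  rewrite [\int[mu]_(x in `]a, a + _[) _]Rint_zero ?subr0; last first.
    move=> x; rewrite /= in_itv/= => /andP[ax xh]; rewrite /q v0 ?mulr0//; apply/orP; left.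
    by apply: lt_le_trans xh _; apply: le_trans dl2; rewrite lerD2l.
  have Lvs : L2 `]a, b1[ (fun x => v.1 (x + h_ n)) by exact: (L2_h h0 hdl n (Lv1 a (b1 + dl))).
  have Lfs : L2 `]a, b1[ (fun x => f (x + h_ n)) by exact: (L2_h h0 hdl n Lf).
  have Ldf := L2B (moo a b1) Lfs Lf1; have Ldv := L2B (moo a b1) Lvs (Lv1 a b1).
  have La := L2M (moo a b1) Ldf Lvs; have Lb := L2M (moo a b1) Lf1 Ldv.
  rewrite (@eq_Rintegral _ _ _ mu _ (fun x => (f (x + h_ n) - f x) * v.1 (x + h_ n) + f x * (v.1 (x + h_ n) - v.1 x))); last first.
    by move=> x _; rewrite /q; ring.
  rewrite (RintegralD (moo a b1) La Lb) => /eqP; rewrite addrC addr_eq0 => /eqP E.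
  have -> : \int[mu]_(x in `]a, b1[) (f x * dq h_ v.1 n x) =
      - ((h_ n)^-1 * \int[mu]_(x in `]a, b1[) ((f (x + h_ n) - f x) * v.1 (x + h_ n))).
    rewrite -mulrN -E -(RintegralZl _ (moo a b1) Lb); apply: eq_Rintegral => x _.
    by rewrite /dq mulrA mulrC.
  rewrite normrN normrM ger0_norm ?invr_ge0 ?(ltW (h0 n))// mulrC ler_pdivrMr//.
  apply: le_trans (Rint_le_norm La) _.
  have Lvn : L1 `]a, b1 + dl[ (fun x => `|v.1 x|).
    by apply: L1_norm; apply: cont_L1.
  have Lvsn : L1 `]a, b1[ (fun x => `|v.1 (x + h_ n)|) by exact: (L1_h h0 hdl n Lvn).
  apply: (@le_trans _ _ (\int[mu]_(x in `]a, b1[) (L * h_ n * `|v.1 (x + h_ n)|))).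
    apply: Rint_ae_le => //; [exact: L1_norm|exact: L1Z|].
    apply: aeT => x xab; rewrite normrM ler_wpM2r//.
    have xh := h_within h0 hdl n xab.
    apply: le_trans (fL _ _) _.
    - by move: xh; rewrite /= !in_itv/= => /andP[/ltW -> /ltW xh]; exact: le_trans xh dl1.
    - by move: xab; rewrite /= !in_itv/= => /andP[/ltW -> /ltW xb]; exact: le_trans xb (ltW b1b).
    - by rewrite addrAC subrr add0r gtr0_norm.
  rewrite (RintegralZl _ (moo a b1) Lvsn) mulrAC ler_wpM2r ?(ltW (h0 n))// ler_wpM2l//.
  apply: le_trans (Rint_h_le h0 hdl n Lvn (fun x => normr_ge0 _) (ltW ab1)) _.
  have Lvab : L1 `]a, b[ (fun x => `|v.1 x|) by apply: L1_norm; exact: cont_L1.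
  rewrite [leRHS](@Rint_split _ a (b1 + dl) b)//; last by lra.
  by rewrite lerDl; exact: Rintegral_ge0.
have Lfv : L1 `]a, b[ (fun x => f x * v.2 x) by apply: L2M => //; exact: cont_L2.
rewrite (@Rint_split _ a b1 b)//; [|exact: ltW|exact: ltW].
rewrite [X in _ + X]Rint_zero ?addr0; last first.
  move=> x; rewrite /= in_itv/= => /andP[bx _]; rewrite dv0 ?mulr0//; apply/orP; right.
  exact: lt_trans db1 bx.
have lim' : `|\int[mu]_(x in `]a, b1[) (f x * dq h_ v.1 n x)| @[n --> \oo] --> `|\int[mu]_(x in `]a, b1[) (f x * v.2 x)| by exact: cvg_norm lim.
  rewrite -(cvg_lim (@Rhausdorff R) lim').
by apply: limr_le; [apply/cvg_ex; eexists; exact: lim'|exact: nearW].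
Qed.

(** Riesz representation of v |-> - int f v' on test functions with the L^2 product. The functional
    is bounded below by 2 L |v| <= v^2 + L^2, which gives the constant L^2 (b - a), and here the
    minimising sequence itself converges to the representative. *)
Let exists_weak_deriv : exists2 g, L2 `]a, b[ g & forall v, C1c v ->
  \int[mu]_(x in `]a, b[) (g x * v.1 x) = - \int[mu]_(x in `]a, b[) (f x * v.2 x).
Proof.
pose lc (u : (R -> R) * (R -> R)) (t : R) (v : (R -> R) * (R -> R)) :=
  ((fun x => u.1 x + t * v.1 x), (fun x => u.2 x + t * v.2 x)).
pose bil (u v : (R -> R) * (R -> R)) := \int[mu]_(x in `]a, b[) (u.1 x * v.1 x).
pose lin (v : (R -> R) * (R -> R)) := - \int[mu]_(x in `]a, b[) (f x * v.2 x).
have Lc u : C1c u -> L2 `]a, b[ u.1 by move=> [/C1_cont cu _]; exact: cont_L2.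
have Lfc u : C1c u -> L1 `]a, b[ (fun x => f x * u.2 x).
  by move=> [[_ cu] _]; apply: L2M => //; exact: cont_L2.
have LM u v : C1c u -> C1c v -> L1 `]a, b[ (fun x => u.1 x * v.1 x).
  by move=> Pu Pv; apply: L2M => //; exact: Lc.
have lcC u v t : C1c u -> C1c v -> C1c (lc u t v).
  move=> [[u1 u2] [c [d [ac cd db u0]]]] [[v1 v2] [c' [d' [ac' cd' db' v0]]]].
  split; first split=> x.
  - by have := is_deriveD (u1 x) (is_deriveZ t (v1 x)).
  - by apply: cvgD; [exact: u2|apply: cvgM; [exact: cvg_cst|exact: v2]].
  exists (Num.min c c'), (Num.max d d'); split.
  - by rewrite lt_min ac ac'.
  - by rewrite gt_min !lt_max cd.
  - by rewrite gt_max db db'.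
  move=> x; rewrite lt_min gt_max => xcd /=; rewrite u0 ?v0 ?mulr0 ?addr0//.
    by case/orP : xcd => /andP[xc xd]; rewrite ?xc ?xd ?orbT.
  by case/orP : xcd => /andP[xc xd]; rewrite ?xc ?xd ?orbT.
have [|||||||v_ [Pv cauchy EL]] := @minimizing_sequence R _ lc C1c bil lin (L ^+ 2 * (b - a)).
- exists (fun=> 0, fun=> 0); split; first by split=> x; [exact: is_derive_cst|exact: cst_continuous].
  by exists ((2 * a + b) / 3), ((a + 2 * b) / 3); have ab' := ab; split => //; lra.
- by move=> u v t; exact: lcC.
- by move=> u v _ _; apply: eq_Rintegral => x _; rewrite mulrC.
- move=> u v w t Pu Pv Pw; rewrite /bil -(RintegralZl _ (moo a b) (LM _ _ Pv Pw)).
  rewrite -(RintegralD (moo a b) (LM _ _ Pu Pw) (L1Z (moo a b) _ (LM _ _ Pv Pw))).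
  by apply: eq_Rintegral => x _ /=; ring.
- by move=> u Pu; apply: Rintegral_ge0 => x _; rewrite -expr2 sqr_ge0.
- move=> u v t Pu Pv; rewrite /lin mulrN -opprD; congr (- _).
  rewrite -(RintegralZl _ (moo a b) (Lfc _ Pv)).
  rewrite -(RintegralD (moo a b) (Lfc _ Pu) (L1Z (moo a b) _ (Lfc _ Pv))).
  by apply: eq_Rintegral => x _ /=; ring.
- move=> u Pu; have Lu := Lc _ Pu; have Lun := L1_norm (L2_L1 (moo a b) (muoo a b) Lu).
  have Lc1 := L1_cst (moo a b) (L ^+ 2) (muoo a b).
  have h := le_trans (ler_norm _) (lipschitz_weak_bound Pu).
  have {}h : lin u <= L * \int[mu]_(x in `]a, b[) `|u.1 x|.
    by apply: le_trans (lipschitz_weak_bound Pu); rewrite -normrN ler_norm.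
  apply: (@le_trans _ _ (2 * (L * \int[mu]_(x in `]a, b[) `|u.1 x|))).
    by rewrite ler_wpM2l.
  rewrite mulrA -(RintegralZl _ (moo a b) Lun) -(muooE (ltW ab)) -(Rintegral_cst _ (moo a b)) /bil.
  rewrite -(RintegralD (moo a b) (LM _ _ Pu Pu) Lc1).
  apply: Rint_ae_le => //; [exact: L1Z|by apply: L1D => //; exact: LM|].
  by apply: aeT => x _; rewrite -expr2 -(real_normK (num_real (u.1 x))); have := sqr_ge0 (`|u.1 x| - L); lra.
have [g Lg hg] : exists2 g, L2 `]a, b[ g &
    forall n, \int[mu]_(x in `]a, b[) (g x - (v_ n).1 x) ^+ 2 <= 4 * 8^-1 ^+ n.
  apply: L2_complete => [n|n m nm]; first exact: Lc.
  apply: le_trans (cauchy n m nm); rewrite le_eqVlt; apply/orP; left; apply/eqP.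
  by apply: eq_Rintegral => x _ /=; ring.
exists g => // v Pv'.
have geo (c : R) : c * 8^-1 ^+ n @[n --> \oo] --> (0 : R).
  by apply: (@cvg_geometric R c 8^-1); rewrite ger0_norm// invf_lt1// ltr1n.
have lim1 : bil (v_ n) v @[n --> \oo] --> \int[mu]_(x in `]a, b[) (g x * v.1 x).
  apply: (@L2cvg_mul R `]a, b[ (moo a b) (fun n => (v_ n).1) (fun=> v.1)) => //.
  - by move=> n; exact: Lc.
  - by move=> _; exact: Lc.
  - exact: Lc.
  - apply: (squeeze_cvgr _ (cvg_cst 0) (geo 4)); apply: nearW => n.
    rewrite Rintegral_ge0 => [/=|x _]; last exact: sqr_ge0.
    by apply: le_trans (hg n); rewrite le_eqVlt; apply/orP; left; apply/eqP; apply: eq_Rintegral => x _; ring.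
  - rewrite (_ : \int[mu]_(x in _) _ = 0); first exact: cvg_cst.
    by apply: Rint_zero => x _; rewrite subrr expr0n.
have lim2 : bil (v_ n) v @[n --> \oo] --> lin v.
  apply/subr_cvg0; apply: cvg_sqrt0.
  apply: (squeeze_cvgr _ (cvg_cst 0) (geo (bil v v))); apply: nearW => n.
  by rewrite sqr_ge0/= mulrC; exact: EL.
by rewrite -[RHS]/(lin v) -(cvg_lim (@Rhausdorff R) lim1) -(cvg_lim (@Rhausdorff R) lim2).
Qed.

(** One-dimensional Rademacher theorem. The du Bois-Reymond lemma makes f a primitive of its weak
    derivative g, first a.e. and then everywhere by continuity; where g is the classical derivative
    it inherits the bound [L] from the difference quotients. *)
Lemma lipschitz_prim : exists g : R -> R,
  [/\ mblfun `]a, b[ g,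
      {ae mu, forall x, `]a, b[ x -> `|g x| <= L},
      forall x, `[a, b] x -> f x = f a + prim g a x &
      {ae mu, forall x, `]a, b[ x -> derive1 f x = g x}].
Proof.
have [g L2g hg] := exists_weak_deriv.
have Lg := L2_L1 (moo a b) (muoo a b) L2g.
have [||c hc] := @weak_deriv_prim R a b f g ab _ Lg.
- exact: L2_L1.
- move=> phi tphi; apply/eqP; rewrite eq_sym eqr_oppLR; apply/eqP.
  apply: (hg (phi, derive1 phi)); split; first exact: test_C1 tphi.
  case: tphi => _ [c [d [ac [db h]]]].
  (* A test function need not come with c < d, as [C1c] demands; enlarging the support interval to
     contain the middle third ensures it. *)
  exists (Num.min c ((2 * a + b) / 3)), (Num.max d ((a + 2 * b) / 3)); have ab' := ab; split.
  - by rewrite lt_min ac/=; lra.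
  - by rewrite gt_min !lt_max; apply/orP; right; apply/orP; right; lra.
  - by rewrite gt_max db/=; lra.
  by move=> x; rewrite lt_min gt_max => /orP[/andP[xc _]|/andP[xd _]]; apply: h; [left|right].
have E x : `[a, b] x -> f x = c + prim g a x.
  move=> xab; apply/eqP; rewrite -subr_eq0; apply/eqP.
  apply: (@within_ae0 R a b (fun x => f x - (c + prim g a x))) => //.
    move=> y; apply: cvgB; first exact: f_within.
    by apply: cvgD; [exact: cvg_cst|exact: prim_cont_within].
  by apply: aeS hc => y h yab; rewrite h// subrr.
have fa : f a = c by rewrite E// prim0 addr0.
have dfg : {ae mu, forall x, `]a, b[ x -> is_derive x (1 : R) f (g x)}.
  apply: aeS (FTC1_ae Lg) => x h xab.
  have h2 : is_derive x (1 : R) (fun y => c + prim g a y) (g x).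
    by rewrite -[g x]add0r; apply: is_deriveD; exact: h.
  apply: isd_near h2; near=> y; apply/esym/E; apply: oc.
  near: y; apply: open_nbhs_nbhs; split => //; exact: itv_open.
exists g; split => //.
- exact: L2_meas L2g.
- apply: aeS dfg => x h xab.
  have [_ dn] := (xab, h); move: (xab); rewrite /= in_itv/= => /andP[ax xb].
  pose h_ n := (b - x) * n.+1%:R^-1.
  have bx : 0 < b - x by rewrite subr_gt0.
  have h0 n : 0 < h_ n by rewrite mulr_gt0// invr_gt0.
  have hdl n : h_ n <= b - x by rewrite /h_ ler_piMr ?(ltW bx)// invf_le1// ler1n.
  have hcvg : h_ n @[n --> \oo] --> (0 : R).
    by rewrite -[X in _ --> X](mulr0 (b - x)); apply: cvgMr; exact: cvg_harmonic.
  have lim : `|dq h_ f n x| @[n --> \oo] --> `|g x| by apply: cvg_norm; exact: (dq_cvg h0 hcvg (h xab)).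
  rewrite -(cvg_lim (@Rhausdorff R) lim); apply: limr_le.
    by apply/cvg_ex; eexists; exact: lim.
  apply: nearW => n; rewrite /dq normrM normfV (gtr0_norm (h0 n)) ler_pdivrMr//.
  apply: le_trans (fL _ _) _.
  + by rewrite /= in_itv/=; have := h0 n; have := hdl n; move=> ? ?; apply/andP; split; lra.
  + exact: oc.
  + by rewrite addrAC subrr add0r gtr0_norm.
- by move=> x xab; rewrite E// fa.
- by apply: aeS dfg => x h xab; rewrite derive1E; apply: derive_val; exact: h.
Unshelve. all: by end_near. Qed.

End LipschitzFunctions.

(** * Uniqueness for the real system *)

Section Uniqueness.
Context {R : realType}.
Local Notation mu := (@lebesgue_measure R).
Implicit Types (x y t : R).
Variables (a b : R) (m : nat).
Variables (A A1 B : 'I_m -> 'I_m -> R -> R) (A0 : 'I_m -> 'I_m -> R) (L M mu0 : R).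
Hypothesis ab : a < b.
Hypothesis mA1 : forall i j, mblfun `]a, b[ (A1 i j).
Hypothesis bA1 : forall i j, {ae mu, forall x, `]a, b[ x -> `|A1 i j x| <= L}.
Hypothesis AE : forall i j x, `[a, b] x -> A i j x = A0 i j + prim (A1 i j) a x.
Hypothesis Asym : forall i j x, `[a, b] x -> A i j x = A j i x.
Hypothesis mB : forall i j, mblfun `]a, b[ (B i j).
Hypothesis bB : forall i j, {ae mu, forall x, `]a, b[ x -> `|B i j x| <= M}.
Hypothesis mu0_gt0 : 0 < mu0.
Hypothesis coercive : {ae mu, forall x, `]a, b[ x -> forall v : 'I_m -> R,
  2 * mu0 * \sum_(i < m) v i ^+ 2 <=
  \sum_(i < m) \sum_(j < m) v i * (B i j x + B j i x + A1 i j x) * v j}.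

Variables (u : 'I_m -> R -> R) (c0 : 'I_m -> R).
Let g i x := - \sum_(j < m) B i j x * u j x.
Let F i x := c0 i + prim (g i) a x.
Hypothesis Lu : forall i, L2 `]a, b[ (u i).
Hypothesis FA : {ae mu, forall x, `]a, b[ x -> forall i, F i x = \sum_(j < m) A i j x * u j x}.

Lemma L2_rhs i : L2 `]a, b[ (g i).
Proof. by apply: L2N => //; apply: L2_sum => // j _; apply: L2_bdd (bB i j). Qed.

Lemma real_trace e (v : 'I_m -> R) : (e == a) || (e == b) ->
  (forall j, \sum_(i < m) v i * A i j e = 0) -> \sum_(i < m) v i * F i e = 0.
Proof.
move=> eab; apply: (@trace_orth_ker R a b m u g F A A1 c0 A0 L) => //.
exact: L2_rhs.
Qed.

Lemma real_uniqueness (xia xib : 'I_m -> R) :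
  (forall i, F i a = \sum_(j < m) A i j a * xia j) -> \sum_(i < m) xia i * F i a <= 0 ->
  (forall i, F i b = \sum_(j < m) A i j b * xib j) -> 0 <= \sum_(i < m) xib i * F i b ->
  {ae mu, forall x, `]a, b[ x -> forall i, u i x = 0}.
Proof.
move=> Fa Fa0 Fb Fb0; have Lg := L2_rhs; have oc := @subset_itv_oo_cc _ R a b.
pose p x := \sum_(i < m) (u i x * g i x + u i x * g i x - \sum_(j < m) u i x * A1 i j x * u j x).
have [C hC] : exists C, {ae mu, forall x, `]a, b[ x -> \sum_(i < m) u i x * F i x =
    C + prim p a x}.
  by apply: (@energy_AC R a b m u g F A A1 c0 A0 L) => // *; [apply: AE; exact: oc|apply: Asym; exact: oc].
have Ea := @energy_end R a b m u g F A A1 c0 A0 L ab Lu Lg _ mA1 bA1 AE Asym FA a C xia.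
have Eb := @energy_end R a b m u g F A A1 c0 A0 L ab Lu Lg _ mA1 bA1 AE Asym FA b C xib.
move: Ea Eb; rewrite !eqxx orbT => /(_ (fun _ _ _ => erefl) isT hC Fa) Ea /(_ (fun _ _ _ => erefl) isT hC Fb) Eb.
rewrite prim0 addr0 -/p in Ea; rewrite -/p in Eb.
have Lp : L1 `]a, b[ p by apply: (energy_p_L1 Lu Lg mA1 bA1).
(* The energy is >= 0 at [b] and <= 0 at [a], so the integral of [p] is >= 0; coercivity says p <= -
   2 mu0 |u|^2, which forces u = 0. *)
have p0 : 0 <= \int[mu]_(x in `]a, b[) p x.
  by rewrite -[X in 0 <= X]/(prim p a b); lra.
have Ls : L1 `]a, b[ (fun x => \sum_(i < m) u i x ^+ 2).
  by apply: L1_sum => // i _; case: (Lu i).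
have pE x (v : 'I_m -> R) : v = u^~ x -> p x =
    - \sum_(i < m) \sum_(j < m) v i * (B i j x + B j i x + A1 i j x) * v j.
  move=> ->; rewrite /p /g.
  have -> : \sum_(i < m) \sum_(j < m) u i x * (B i j x + B j i x + A1 i j x) * u j x =
      \sum_(i < m) \sum_(j < m) u i x * B i j x * u j x +
      \sum_(i < m) \sum_(j < m) u i x * B i j x * u j x +
      \sum_(i < m) \sum_(j < m) u i x * A1 i j x * u j x.
    rewrite [X in _ + X + _]exchange_big -!big_split/=; apply: eq_bigr => i _.
    by rewrite -!big_split/=; apply: eq_bigr => j _; ring.
  rewrite sumrB big_split/= !opprD; congr (_ + _ + _); rewrite -sumrN; apply: eq_bigr => i _;
    by rewrite mulrN mulr_sumr; congr (- _); apply: eq_bigr => j _; rewrite mulrA.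
have h : {ae mu, forall x, `]a, b[ x -> \sum_(i < m) u i x ^+ 2 = 0}.
  apply: Rint_eq0 => //.
    by apply: aeT => x _; apply: sumr_ge0 => i _; exact: sqr_ge0.
  rewrite -(pmulr_rle0 _ (_ : 0 < 2 * mu0)) ?mulr_gt0// -(RintegralZl _ (moo a b) Ls).
  apply: (@le_trans _ _ (\int[mu]_(x in `]a, b[) (- p x))); last first.
    rewrite (_ : \int[mu]_(x in _) _ = - \int[mu]_(x in `]a, b[) p x) ?oppr_le0//.
    rewrite -mulN1r -(RintegralZl (-1) (moo a b) Lp).
    by apply: eq_Rintegral => x _; rewrite mulN1r.
  apply: Rint_ae_le => //; [exact: L1Z|exact: L1N|].
  by apply: aeS coercive => x hx xab; rewrite (pE x (u^~ x))// opprK; exact: hx.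
apply: aeS h => x h xab i; apply/eqP; rewrite -sqrf_eq0.
have /psumr_eq0P := h xab => /(_ (fun j _ => sqr_ge0 _)) -> //.
Qed.

End Uniqueness.

(** * Complex vectors and matrices in real coordinates *)

Section Realification.
Context {R : realType}.
Local Notation C := R[i].
Local Notation Re := complex.Re.
Local Notation Im := complex.Im.

Lemma ReM (x y : C) : Re (x * y) = Re x * Re y - Im x * Im y.
Proof. by case: x y => [? ?] []. Qed.

Lemma ImM (x y : C) : Im (x * y) = Re x * Im y + Im x * Re y.
Proof. by case: x y => [? ?] []. Qed.

Lemma Re_sum I (s : seq I) (P : pred I) (F : I -> C) :
  Re (\sum_(i <- s | P i) F i) = \sum_(i <- s | P i) Re (F i).
Proof. exact: raddf_sum. Qed.

Lemma Im_sum I (s : seq I) (P : pred I) (F : I -> C) :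
  Im (\sum_(i <- s | P i) F i) = \sum_(i <- s | P i) Im (F i).
Proof. exact: raddf_sum. Qed.

Lemma conjE (x : C) : Num.conj x = Complex (Re x) (- Im x).
Proof. by case: x. Qed.

Lemma complex_ext (x y : C) : Re x = Re y -> Im x = Im y -> x = y.
Proof. by case: x y => [? ?] [? ?] /= -> ->. Qed.

Definition rlv {r} (v : 'cV[C]_r) (k : 'I_(r + r)) : R :=
  match fintype.split k with inl i => Re (v i 0) | inr i => Im (v i 0) end.

Definition cpx {r} (f : 'I_(r + r) -> R) : 'cV[C]_r :=
  \col_i Complex (f (lshift r i)) (f (rshift r i)).

(* The real matrix [[Re M, - Im M], [Im M, Re M]] of the real-linear map v |-> M v. *)
Definition rlm {r} (M : 'M[C]_r) (k l : 'I_(r + r)) : R :=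
  match fintype.split k, fintype.split l with
  | inl i, inl j => Re (M i j) | inl i, inr j => - Im (M i j)
  | inr i, inl j => Im (M i j) | inr i, inr j => Re (M i j) end.

Section Dim.
Variable r : nat.
Implicit Types (v w : 'cV[C]_r) (M N : 'M[C]_r) (k l : 'I_(r + r)).

Lemma rlv_l v i : rlv v (lshift r i) = Re (v i 0).
Proof. by rewrite /rlv (unsplitK (inl _ i)). Qed.
Lemma rlv_r v i : rlv v (rshift r i) = Im (v i 0).
Proof. by rewrite /rlv (unsplitK (inr _ i)). Qed.

Lemma rlm_ll M i j : rlm M (lshift r i) (lshift r j) = Re (M i j).
Proof. by rewrite /rlm !(unsplitK (inl _ _)). Qed.
Lemma rlm_lr M i j : rlm M (lshift r i) (rshift r j) = - Im (M i j).
Proof. by rewrite /rlm (unsplitK (inl _ _)) (unsplitK (inr _ _)). Qed.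
Lemma rlm_rl M i j : rlm M (rshift r i) (lshift r j) = Im (M i j).
Proof. by rewrite /rlm (unsplitK (inl _ _)) (unsplitK (inr _ _)). Qed.
Lemma rlm_rr M i j : rlm M (rshift r i) (rshift r j) = Re (M i j).
Proof. by rewrite /rlm !(unsplitK (inr _ _)). Qed.

Lemma cpxK (f : 'I_(r + r) -> R) k : rlv (cpx f) k = f k.
Proof.
by rewrite -(splitK k); case: (fintype.split k) => i; rewrite /= ?rlv_l ?rlv_r mxE.
Qed.

Lemma rlvK v : cpx (rlv v) = v.
Proof. by apply/colP => i; rewrite mxE rlv_l rlv_r; case: (v i 0). Qed.

Lemma rlv_inj v w : (forall k, rlv v k = rlv w k) -> v = w.
Proof. by move=> h; rewrite -(rlvK v) -(rlvK w); congr cpx; apply/funext. Qed.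

Lemma rlvD v w k : rlv (v + w) k = rlv v k + rlv w k.
Proof. by rewrite /rlv; case: (fintype.split k) => i; rewrite mxE raddfD. Qed.

Lemma rlvN v k : rlv (- v) k = - rlv v k.
Proof. by rewrite /rlv; case: (fintype.split k) => i; rewrite mxE raddfN. Qed.

Lemma rlv0 k : rlv 0 k = 0.
Proof. by rewrite /rlv; case: (fintype.split k) => i; rewrite mxE. Qed.

Lemma rlmD M N k l : rlm (M + N) k l = rlm M k l + rlm N k l.
Proof.
by rewrite /rlm; case: (fintype.split k) (fintype.split l) => i [] j; rewrite mxE raddfD// opprD.
Qed.

Lemma rlm_ctr M k l : rlm (ctr M) k l = rlm M l k.
Proof.
by rewrite /rlm; case: (fintype.split k) (fintype.split l) => i [] j; rewrite !mxE conjE//= opprK.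
Qed.

Lemma rlv_mul M v k : rlv (M *m v) k = \sum_l rlm M k l * rlv v l.
Proof.
rewrite big_split_ord/= -big_split/= -(splitK k); case: (fintype.split k) => i;
  rewrite /= ?rlv_l ?rlv_r mxE ?Re_sum ?Im_sum; apply: eq_bigr => j _;
  by rewrite ?rlm_ll ?rlm_lr ?rlm_rl ?rlm_rr ?rlv_l ?rlv_r ?ReM ?ImM ?mulNr; ring.
Qed.

Lemma rlv_dot v w : \sum_k rlv v k * rlv w k = Re ((ctr v *m w) 0 0).
Proof.
rewrite big_split_ord/= -big_split/= mxE Re_sum; apply: eq_bigr => j _.
by rewrite !rlv_l !rlv_r !mxE conjE ReM/=; ring.
Qed.

Lemma rlm_form v M w :
  \sum_k \sum_l rlv v k * rlm M k l * rlv w l = Re ((ctr v *m M *m w) 0 0).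
Proof.
rewrite -mulmxA -rlv_dot; apply: eq_bigr => k _.
by rewrite rlv_mul mulr_sumr; apply: eq_bigr => l _; rewrite mulrA.
Qed.

Lemma sqnormv_rlv v : sqnormv v = \sum_k rlv v k ^+ 2.
Proof.
rewrite big_split_ord/= -big_split/=; apply: eq_bigr => j _.
by rewrite rlv_l rlv_r.
Qed.

Lemma rlvZ (c : C) v k : rlv (c *: v) k = \sum_l rlm c%:M k l * rlv v l.
Proof. by rewrite -rlv_mul mul_scalar_mx. Qed.

End Dim.
End Realification.

(** * Spectral theorem and signs of eigenvalues *)

Section Spectral.
Context {R : realType}.
Local Notation C := R[i].

Lemma ctrM m n p (M : 'M[C]_(m, n)) (N : 'M[C]_(n, p)) : ctr (M *m N) = ctr N *m ctr M.
Proof. by rewrite /ctr trmx_mul map_mxM. Qed.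

Lemma ctrK m n (M : 'M[C]_(m, n)) : ctr (ctr M) = M.
Proof. by apply/matrixP => i j; rewrite !mxE conjCK. Qed.

(** The unitary factors cancel in the characteristic polynomial, which becomes the product of the X
    - d_i. The list [eigvals] is determined only up to order, so the counts are compared through a
    permutation. *)
Lemma count_eigvals r (M P : 'M[C]_r) (d : 'I_r -> R) : P *m ctr P = 1%:M ->
  M = ctr P *m diag_mx (\row_i Complex (d i) 0) *m P ->
  npos M = #|[pred i | 0 < d i]| /\ nneg M = #|[pred i | d i < 0]|.
Proof.
move=> PPc E.
have cP : char_poly M = \prod_(i < r) ('X - (Complex (d i) 0)%:P).
  rewrite {1}E /char_poly.
  pose Pp := map_mx polyC P; pose Pc := map_mx polyC (ctr P).
  have PcP : Pc *m Pp = 1%:M by rewrite -map_mxM (mulmx1C PPc) map_mx1.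
  set D := diag_mx _.
  have -> : char_poly_mx (ctr P *m D *m P) = Pc *m char_poly_mx D *m Pp.
    rewrite /char_poly_mx mulmxBr mulmxBl !map_mxM -/Pc -/Pp; congr (_ - _).
    by rewrite mul_mx_scalar -scalemxAl PcP scale_scalar_mx mulr1.
  rewrite !det_mulmx mulrAC -det_mulmx PcP det1 mul1r -/(char_poly _).
  rewrite char_poly_trig ?diag_mx_is_trig//; apply: eq_bigr => i _.
  by rewrite !mxE eqxx mulr1n.
have eP : perm_eq (eigvals M) [seq Complex (d i) 0 | i <- enum 'I_r].
  rewrite /eigvals; case: closed_field_poly_normal => s /= hs.
  apply: prod_XsubC_eq; rewrite big_map big_enum/= -cP hs.
  by rewrite (monicP (char_poly_monic M)) scale1r.
have cnt (p : pred C) : count p (eigvals M) = #|[pred i | p (Complex (d i) 0)]|.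
  rewrite (permP eP p) -sum1_count big_map big_enum_cond/= -sum1_card.
  by apply: eq_bigl => i.
by rewrite /npos /nneg !cnt; split; apply: eq_card => i; rewrite !inE ltcE/= eqxx.
Qed.

Lemma hermitian_spectral r (M : 'M[C]_r) : ctr M = M ->
  exists P (d : 'I_r -> R), [/\ P *m ctr P = 1%:M, ctr P *m P = 1%:M &
    M = ctr P *m diag_mx (\row_i Complex (d i) 0) *m P].
Proof.
move=> Mh.
have Mherm : M \is hermsymmx.
  by apply/is_hermitianmxP; rewrite expr0 scale1r; exact/esym.
have /orthomx_spectralP E := hermitian_normalmx Mherm.
have /mxOverP dreal := hermitian_spectral_diag_real Mherm.
have PU := spectral_unitarymx M; have PPc : spectralmx M *m ctr (spectralmx M) = 1%:M.
  exact/unitarymxP.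
rewrite (invmx_unitary PU) in E.
pose d i := complex.Re (spectral_diag M 0 i).
have dE : spectral_diag M = \row_i Complex (d i) 0.
  by apply/rowP => i; rewrite mxE; have := dreal 0 i => /RRe_real => <-.
exists (spectralmx M), d; split; [exact: PPc|exact: mulmx1C PPc|by rewrite -dE].
Qed.

Lemma count_eigvalsN r (M : 'M[C]_r) : ctr M = M ->
  npos (- M) = nneg M /\ nneg (- M) = npos M.
Proof.
move=> /hermitian_spectral[P [d [PPc _ E]]].
have EN : - M = ctr P *m diag_mx (\row_i Complex (- d i) 0) *m P.
  rewrite E -mulNmx -mulmxN; congr (_ *m _ *m _); apply/matrixP => i j; rewrite !mxE.
  by apply: complex_ext; rewrite raddfN !raddfMn/= ?mulNrn// ?oppr0 ?mul0rn ?oppr0.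
have [-> ->] := count_eigvals PPc E; have [-> ->] := count_eigvals PPc EN.
by split; apply: eq_card => i; rewrite !inE ?oppr_gt0 ?oppr_lt0.
Qed.

End Spectral.

(** * Complex solution pairs *)

Section Solutions.
Context {R : realType}.
Local Notation C := R[i].
Local Notation Re := complex.Re.
Local Notation Im := complex.Im.
Local Notation mu := (@lebesgue_measure R).
Implicit Types (x y t : R).

(** Whereas [u] matters only up to null sets, [F] is the continuous representative of A u on the
    closed interval, so that F(a) and F(b) make sense. The second clause is F' = - B u in integrated
    form. *)
Definition sol (a b : R) r (A B : R -> 'M[C]_r) (u F : R -> 'cV[C]_r) : Prop :=
  [/\ forall k, L2 `]a, b[ (fun x => rlv (u x) k),
      forall k x, `[a, b] x ->
        rlv (F x) k = rlv (F a) k + prim (fun t => rlv (- (B t *m u t)) k) a x &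
      {ae mu, forall x, `]a, b[ x -> F x = A x *m u x}].

Variables (a b : R) (r : nat) (A Ad B : R -> 'M[C]_r) (L M mu0 : R).
Hypothesis ab : a < b.
Hypothesis mAd : forall k l, mblfun `]a, b[ (fun x => rlm (Ad x) k l).
Hypothesis bAd : forall k l, {ae mu, forall x, `]a, b[ x -> `|rlm (Ad x) k l| <= L}.
Hypothesis AE : forall k l x, `[a, b] x ->
  rlm (A x) k l = rlm (A a) k l + prim (fun t => rlm (Ad t) k l) a x.
Hypothesis Aherm : forall x, `[a, b] x -> ctr (A x) = A x.
Hypothesis mB : forall k l, mblfun `]a, b[ (fun x => rlm (B x) k l).
Hypothesis bB : forall k l, {ae mu, forall x, `]a, b[ x -> `|rlm (B x) k l| <= M}.
Hypothesis mu0_gt0 : 0 < mu0.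
Hypothesis coercive : {ae mu, forall x, `]a, b[ x -> forall v : 'cV[C]_r,
  2 * mu0 * sqnormv v <= Re ((ctr v *m (B x + ctr (B x) + Ad x) *m v) 0 0)}.

Let Asym k l x : `[a, b] x -> rlm (A x) k l = rlm (A x) l k.
Proof. by move=> /Aherm h; rewrite -[in LHS]h rlm_ctr. Qed.

Let coercive_real : {ae mu, forall x, `]a, b[ x -> forall v : 'I_(r + r) -> R,
  2 * mu0 * \sum_(i < r + r) v i ^+ 2 <=
  \sum_(i < r + r) \sum_(j < r + r) v i * (rlm (B x) i j + rlm (B x) j i + rlm (Ad x) i j) * v j}.
Proof.
apply: aeS coercive => x h xab v; have {h} := h xab (cpx v).
rewrite sqnormv_rlv -rlm_form (eq_bigr (fun k => v k ^+ 2)) => [h|k _]; last by rewrite cpxK.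
apply: le_trans h _; rewrite le_eqVlt; apply/orP; left; apply/eqP.
by apply: eq_bigr => k _; apply: eq_bigr => l _; rewrite !cpxK !rlmD rlm_ctr.
Qed.

Let rhsE (u : R -> 'cV[C]_r) k :
  (fun t => rlv (- (B t *m u t)) k) = (fun t => - \sum_l rlm (B t) k l * rlv (u t) l).
Proof. by apply/funext => t; rewrite rlvN rlv_mul. Qed.

Let L1rhs (u : R -> 'cV[C]_r) k : (forall k, L2 `]a, b[ (fun x => rlv (u x) k)) ->
  L1 `]a, b[ (fun t => rlv (- (B t *m u t)) k).
Proof.
move=> Lu; rewrite rhsE; apply: L2_L1 => //.
exact: (@L2_rhs R a b _ (fun k l x => rlm (B x) k l) M mB bB (fun k x => rlv (u x) k) Lu).
Qed.

Lemma sol0 : sol a b A B (fun=> 0) (fun=> 0).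
Proof.
split.
- by move=> k; rewrite (_ : (fun x => _) = fun=> 0); [exact: L2_0|apply/funext => x; rewrite rlv0].
- move=> k x xab; rewrite !rlv0 add0r /prim Rint_zero// => t _.
  by rewrite mulmx0 oppr0 rlv0.
- by apply: aeT => x _; rewrite mulmx0.
Qed.

Lemma sol_lin u F v G (c : C) : sol a b A B u F -> sol a b A B v G ->
  sol a b A B (fun x => u x + c *: v x) (fun x => F x + c *: G x).
Proof.
move=> [Lu FE FA] [Lv GE GA]; split.
- move=> k; rewrite (_ : (fun x => _) = fun x => rlv (u x) k + \sum_l rlm c%:M k l * rlv (v x) l); last first.
    by apply/funext => x; rewrite rlvD rlvZ.
  by apply: L2D => //; apply: L2_sum => // l _; exact: L2Z.
- move=> k x xab; rewrite !rlvD !rlvZ FE//.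
  under eq_bigr do rewrite GE//.
  have Lx : {subset predT <= predT} by [].
  have xb : x <= b by move: xab; rewrite /= in_itv/= => /andP[].
  have Lgx k' : L1 `]a, x[ (fun t => rlv (- (B t *m v t)) k').
    by apply: L1_oo (L1rhs k' Lv).
  have Lfx : L1 `]a, x[ (fun t => rlv (- (B t *m u t)) k).
    by apply: L1_oo (L1rhs k Lu).
  under eq_bigr do rewrite mulrDr; rewrite big_split/= addrACA; congr (_ + _).
  rewrite /prim; under [X in _ + X]eq_bigr do rewrite -(RintegralZl _ (moo a x) (Lgx _)).
  rewrite -Rint_sum//; last by move=> l _; exact: L1Z.
  rewrite -(RintegralD (moo a x))//; last by apply: L1_sum => // l _; exact: L1Z.
  apply: eq_Rintegral => t _; rewrite -rlvZ -rlvD; congr (rlv _ k).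
  by rewrite mulmxDr opprD -scalemxAr scalerN.
- by apply: aeS2 FA GA => x h1 h2 xab; rewrite h1// h2// mulmxDr scalemxAr.
Qed.

Lemma sol_sum (I : Type) (s : seq I) (P : pred I) (c : I -> C) (u F : I -> R -> 'cV[C]_r) :
  (forall i, P i -> sol a b A B (u i) (F i)) ->
  sol a b A B (fun x => \sum_(i <- s | P i) c i *: u i x) (fun x => \sum_(i <- s | P i) c i *: F i x).
Proof.
move=> h; elim: s => [|i s IH].
  have := sol0; congr sol; apply/funext => x; by rewrite big_nil.
have E (w : I -> R -> 'cV[C]_r) : (fun x => \sum_(j <- i :: s | P j) c j *: w j x) =
    if P i then fun x => \sum_(j <- s | P j) c j *: w j x + c i *: w i x
    else fun x => \sum_(j <- s | P j) c j *: w j x.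
  by case: ifP => Pi; apply/funext => x; rewrite big_cons Pi// addrC.
by rewrite !E; case: ifP => // Pi; apply: sol_lin => //; exact: h.
Qed.

(** Recovers complex identities from the real system: c = 1 gives the real parts and c = - i the
    imaginary parts. *)
Lemma Re_dot_scale (v X Y : 'cV[C]_r) :
  (forall c : C, Re ((ctr (c *: v) *m X) 0 0) = Re ((ctr (c *: v) *m Y) 0 0)) ->
  (ctr v *m X) 0 0 = (ctr v *m Y) 0 0.
Proof.
move=> h.
have E (c : C) Z : (ctr (c *: v) *m Z) 0 0 = Num.conj c * (ctr v *m Z) 0 0.
  by rewrite !mxE mulr_sumr; apply: eq_bigr => i _; rewrite !mxE rmorphM mulrA.
apply: complex_ext; first by have := h 1; rewrite scale1r.
have := h (Complex 0 (-1)); rewrite !E conjE !ReM/= !mul0r !sub0r opprK !mul1r.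
by move=> /eqP; rewrite eqr_opp => /eqP.
Qed.

Lemma sol_trace u F e (v : 'cV[C]_r) : sol a b A B u F -> (e == a) || (e == b) ->
  A e *m v = 0 -> (ctr v *m F e) 0 0 = 0.
Proof.
move=> [Lu FE FA] eab Av.
have ec : `[a, b] e by move: eab; rewrite /= in_itv/=; case/orP => /eqP ->; rewrite lexx ltW.
suff : (ctr v *m F e) 0 0 = (ctr v *m (0 : 'cV[C]_r)) 0 0 by move=> ->; rewrite mulmx0 mxE.
apply: Re_dot_scale => c; rewrite -rlv_dot mulmx0 [in RHS]mxE.
have := @real_trace R a b _ (fun k l x => rlm (A x) k l) (fun k l x => rlm (Ad x) k l)
  (fun k l x => rlm (B x) k l) (fun k l => rlm (A a) k l) L M ab mAd bAd AE mB bB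
  (fun k x => rlv (u x) k) (fun k => rlv (F a) k) Lu.
rewrite /=.
have FE' k x : `[a, b] x -> rlv (F x) k =
   rlv (F a) k + prim (fun x0 => - \sum_(j < r + r) rlm (B x0) k j * rlv (u x0) j) a x.
  by move=> xab; rewrite FE// rhsE.
move=> /(_ _ e (rlv (c *: v)) eab) h; under eq_bigr do rewrite FE'//; apply: h.
- apply: aeS FA => x h xab i; rewrite -FE' ?h// ?rlv_mul//.
  exact: subset_itv_oo_cc xab.
- move=> j; under eq_bigr do rewrite mulrC Asym//.
  by rewrite -rlv_mul -scalemxAr Av scaler0 rlv0.
Qed.

Lemma sol_uniq u F (xia xib : 'cV[C]_r) : sol a b A B u F ->
  F a = A a *m xia -> Re ((ctr xia *m F a) 0 0) <= 0 ->
  F b = A b *m xib -> 0 <= Re ((ctr xib *m F b) 0 0) ->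
  {ae mu, forall x, `]a, b[ x -> u x = 0}.
Proof.
move=> [Lu FE FA] Fa Fa0 Fb Fb0.
have FE' k x : `[a, b] x -> rlv (F a) k + prim (fun x0 => - \sum_(j < r + r) rlm (B x0) k j * rlv (u x0) j) a x =
   rlv (F x) k.
  by move=> xab; rewrite [RHS]FE// rhsE.
have ca : `[a, b] a by rewrite /= in_itv/= lexx ltW.
have cb : `[a, b] b by rewrite /= in_itv/= lexx ltW.
have := @real_uniqueness R a b _ (fun k l x => rlm (A x) k l) (fun k l x => rlm (Ad x) k l)
  (fun k l x => rlm (B x) k l) (fun k l => rlm (A a) k l) L M mu0 ab mAd bAd AE Asym mB bB
  mu0_gt0 coercive_real (fun k x => rlv (u x) k) (fun k => rlv (F a) k) Lu.
move=> /(_ _ (rlv xia) (rlv xib)) h.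
apply: (aeS _ (h _ _ _ _ _)).
- by move=> x ux xab; apply: rlv_inj => k; rewrite ux// rlv0.
- apply: aeS FA => x hx xab i; rewrite FE' ?hx// ?rlv_mul//.
  exact: subset_itv_oo_cc xab.
- by move=> k; rewrite FE'// Fa rlv_mul.
- by under eq_bigr do rewrite FE'//; rewrite rlv_dot.
- by move=> k; rewrite FE'// Fb rlv_mul.
- by under eq_bigr do rewrite FE'//; rewrite rlv_dot.
Qed.

(** The real boundary conditions control only real parts. As [Na] and [Nb] are complex subspaces,
    they hold for every complex multiple of v, and [Re_dot_scale] gives the full Hermitian
    products. *)
Lemma sol_exists (Na Nb : 'cV[C]_r -> Prop) (al be : 'cV[C]_r) :
  Na 0 -> (forall v w c, Na v -> Na w -> Na (v + c *: w)) ->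
  Nb 0 -> (forall v w c, Nb v -> Nb w -> Nb (v + c *: w)) ->
  (forall v, Na v -> 0 <= Re ((ctr v *m A a *m v) 0 0)) ->
  (forall v, Nb v -> Re ((ctr v *m A b *m v) 0 0) <= 0) ->
  exists u F, [/\ sol a b A B u F,
    forall v, Na v -> (ctr v *m F a) 0 0 = (ctr v *m (A a *m al)) 0 0 &
    forall v, Nb v -> (ctr v *m F b) 0 0 = (ctr v *m (A b *m be)) 0 0].
Proof.
move=> Na0 NaD Nb0 NbD Naf Nbf.
have cpx0 : cpx (fun=> 0) = 0 :> 'cV[C]_r by apply: rlv_inj => k; rewrite cpxK rlv0.
have cpxD (v w : 'I_(r + r) -> R) t : cpx (fun i => v i + t * w i) = cpx v + Complex t 0 *: cpx w :> 'cV[C]_r.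
  apply/colP => i; rewrite !mxE; apply: complex_ext; rewrite raddfD/= ?ReM ?ImM/=; ring.
have NZ (N : 'cV[C]_r -> Prop) : N 0 -> (forall v w c, N v -> N w -> N (v + c *: w)) ->
    forall c v, N v -> N (c *: v).
  by move=> N0 ND c v Nv; rewrite -[c *: v]add0r; exact: ND.
have formE (N : 'M[C]_r) (v : 'I_(r + r) -> R) : Re ((ctr (cpx v) *m N *m cpx v) 0 0) =
    \sum_(i < r + r) \sum_(j < r + r) v i * rlm N i j * v j.
  by rewrite -rlm_form; apply: eq_bigr => i _; apply: eq_bigr => j _; rewrite !cpxK.
have [] := @real_existence R a b _ (fun k l x => rlm (A x) k l) (fun k l x => rlm (Ad x) k l)
  (fun k l x => rlm (B x) k l) (fun k l => rlm (A a) k l) L M mu0 ab mAd bAd AE Asym mB bB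
  mu0_gt0 coercive_real (fun v => Na (cpx v)) (fun v => Nb (cpx v)) _ _ _ _ _ _ (rlv al) (rlv be).
- by rewrite cpx0.
- by move=> v w t Nv Nw; rewrite cpxD; exact: NaD.
- by rewrite cpx0.
- by move=> v w t Nv Nw; rewrite cpxD; exact: NbD.
- by move=> v /Naf; rewrite formE.
- by move=> v /Nbf; rewrite formE.
move=> u [c0 [Lu FA Fa Fb]].
pose U x : 'cV[C]_r := cpx (u^~ x).
pose F x : 'cV[C]_r := cpx (fun k => c0 k + prim (fun t => - \sum_(j < r + r) rlm (B t) k j * u j t) a x).
have UE : (fun k x => rlv (U x) k) = u by apply/funext => k; apply/funext => x; rewrite cpxK.
have FE k x : rlv (F x) k = c0 k + prim (fun t => rlv (- (B t *m U t)) k) a x.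
  rewrite cpxK rhsE; congr (_ + prim _ _ _); apply/funext => t; congr (- _).
  by apply: eq_bigr => l _; rewrite cpxK.
have FaE k : rlv (F a) k = c0 k by rewrite FE prim0 addr0.
have dotE (N : 'M[C]_r) (v w : 'cV[C]_r) : \sum_(i < r + r) \sum_(j < r + r) rlv v i * rlm N i j * rlv w j =
    Re ((ctr v *m (N *m w)) 0 0) by rewrite rlm_form mulmxA.
exists U, F; split.
- split.
  + by move=> k; have := Lu k; rewrite -UE.
  + by move=> k x xab; rewrite FE FaE.
  + apply: aeS FA => x h xab; apply: rlv_inj => k; rewrite rlv_mul cpxK h//.
    by apply: eq_bigr => l _; rewrite cpxK.
- move=> v Nv; apply: Re_dot_scale => c; rewrite -dotE -Fa; last by rewrite rlvK; exact: NZ.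
  by rewrite -rlv_dot; apply: eq_bigr => k _; rewrite FaE.
- move=> v Nv; apply: Re_dot_scale => c; rewrite -dotE -Fb; last by rewrite rlvK; exact: NZ.
  by rewrite -rlv_dot; apply: eq_bigr => k _; rewrite cpxK.
Qed.

End Solutions.

(** * Coordinates in an orthonormal eigenbasis *)

Section UnitaryDiagonalization.
Context {R : realType}.
Local Notation C := R[i].
Local Notation Re := complex.Re.
Local Notation Im := complex.Im.
Variables (r : nat) (M P : 'M[C]_r) (d : 'I_r -> R).
Hypothesis PPc : P *m ctr P = 1%:M.
Hypothesis PcP : ctr P *m P = 1%:M.
Hypothesis ME : M = ctr P *m diag_mx (\row_i Complex (d i) 0) *m P.

Lemma eigencoord (v : 'cV[C]_r) i : (P *m (M *m v)) i 0 = Complex (d i) 0 * (P *m v) i 0.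
Proof.
rewrite ME !mulmxA PPc mul1mx -mulmxA; set w := P *m v.
by rewrite mul_diag_mx !mxE.
Qed.

Lemma dot_eigencoord (v w : 'cV[C]_r) :
  (ctr v *m w) 0 0 = \sum_i Num.conj ((P *m v) i 0) * (P *m w) i 0.
Proof.
have -> : ctr v *m w = ctr (P *m v) *m (P *m w).
  by rewrite ctrM mulmxA -[_ *m _ *m P]mulmxA PcP mulmx1.
by rewrite mxE; apply: eq_bigr => i _; rewrite !mxE.
Qed.

Lemma form_eigencoord (v : 'cV[C]_r) : Re ((ctr v *m (M *m v)) 0 0) =
  \sum_i d i * (Re ((P *m v) i 0) ^+ 2 + Im ((P *m v) i 0) ^+ 2).
Proof.
rewrite dot_eigencoord Re_sum; apply: eq_bigr => i _.
by rewrite eigencoord conjE !ReM ImM/=; ring.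
Qed.

(** The i-th eigenvector is the i-th column of [ctr P]; testing against it reads off the i-th
    eigencoordinate, which converts the boundary conditions of [sol_exists] into coordinates. *)
Lemma dot_eigenvector i (w : 'cV[C]_r) :
  (ctr (ctr P *m (delta_mx i 0 : 'cV[C]_r)) *m w) 0 0 = (P *m w) i 0.
Proof.
rewrite dot_eigencoord mulmxA PPc mul1mx (bigD1 i)//= big1 => [|j ji]; rewrite mxE.
  by rewrite !eqxx/= rmorph1 mul1r addr0.
by rewrite (negbTE ji)/= rmorph0 mul0r.
Qed.

Lemma eigencoord_delta i j : (P *m (ctr P *m (delta_mx i 0 : 'cV[C]_r))) j 0 = (j == i)%:R.
Proof. by rewrite mulmxA PPc mul1mx mxE andbT. Qed.

Lemma eigencoord_inj (v w : 'cV[C]_r) :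
  (forall i, (P *m v) i 0 = (P *m w) i 0) -> v = w.
Proof.
move=> h; have : P *m v = P *m w by apply/colP => i; exact: h.
by move=> /(congr1 (mulmx (ctr P))); rewrite !mulmxA PcP !mul1mx.
Qed.

Lemma kernel_eigenvector i : d i = 0 -> M *m (ctr P *m (delta_mx i 0 : 'cV[C]_r)) = 0.
Proof.
move=> di; apply: eigencoord_inj => j; rewrite eigencoord eigencoord_delta mulmx0 [RHS]mxE.
by have [->|_] := eqVneq j i; rewrite ?di ?mulr0// mul0r.
Qed.

(* [xi] is the pseudo-inverse of [M] applied to [X]; note that [0^-1 = 0]. *)
Lemma trace_preimage (X : 'cV[C]_r) : (forall i, d i = 0 -> (P *m X) i 0 = 0) ->
  exists xi : 'cV[C]_r, X = M *m xi /\ Re ((ctr xi *m X) 0 0) =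
    \sum_i (d i)^-1 * (Re ((P *m X) i 0) ^+ 2 + Im ((P *m X) i 0) ^+ 2).
Proof.
move=> X0; pose xi : 'cV[C]_r := ctr P *m \col_i (Complex (d i)^-1 0 * (P *m X) i 0).
have xiE i : (P *m xi) i 0 = Complex (d i)^-1 0 * (P *m X) i 0.
  by rewrite mulmxA PPc mul1mx mxE.
exists xi; split.
  apply: eigencoord_inj => i; rewrite eigencoord xiE mulrA.
  have [di|di] := eqVneq (d i) 0; first by rewrite X0// mulr0.
  rewrite (_ : Complex _ 0 * _ = 1) ?mul1r//.
  by apply: complex_ext; rewrite ?ReM ?ImM/= ?divff// !(mul0r, mulr0) ?subr0 ?addr0.
rewrite dot_eigencoord Re_sum; apply: eq_bigr => i _.
by rewrite xiE conjE !ReM ImM/=; ring.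
Qed.

End UnitaryDiagonalization.

(** * Dimension of the solution space *)

Section Dimension.
Context {R : realType}.
Local Notation C := R[i].
Local Notation Re := complex.Re.
Local Notation Im := complex.Im.
Local Notation mu := (@lebesgue_measure R).
Implicit Types (x y t : R).

Variables (a b : R) (r : nat) (A Ad B : R -> 'M[C]_r) (L M mu0 : R).
Hypothesis ab : a < b.
Hypothesis mAd : forall k l, mblfun `]a, b[ (fun x => rlm (Ad x) k l).
Hypothesis bAd : forall k l, {ae mu, forall x, `]a, b[ x -> `|rlm (Ad x) k l| <= L}.
Hypothesis AE : forall k l x, `[a, b] x ->
  rlm (A x) k l = rlm (A a) k l + prim (fun t => rlm (Ad t) k l) a x.
Hypothesis Aherm : forall x, `[a, b] x -> ctr (A x) = A x.
Hypothesis mB : forall k l, mblfun `]a, b[ (fun x => rlm (B x) k l).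
Hypothesis bB : forall k l, {ae mu, forall x, `]a, b[ x -> `|rlm (B x) k l| <= M}.
Hypothesis mu0_gt0 : 0 < mu0.
Hypothesis coercive : {ae mu, forall x, `]a, b[ x -> forall v : 'cV[C]_r,
  2 * mu0 * sqnormv v <= Re ((ctr v *m (B x + ctr (B x) + Ad x) *m v) 0 0)}.

(** A combination vanishing a.e. says nothing directly about end values; but F = A u = 0 a.e. and F
    is continuous, so it vanishes up to the ends. Linear independence is deduced from this. *)
Lemma sol_ends0 u F : sol a b A B u F -> {ae mu, forall x, `]a, b[ x -> u x = 0} ->
  F a = 0 /\ F b = 0.
Proof.
move=> [Lu FE FA] u0.
have z k : {ae mu, forall x, `]a, b[ x -> rlv (- (B x *m u x)) k = 0}.
  by apply: aeS u0 => x h xab; rewrite h// mulmx0 oppr0 rlv0.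
have Lrhs k : L1 `]a, b[ (fun t => rlv (- (B t *m u t)) k).
  rewrite (_ : (fun t => _) = (fun t => - \sum_l rlm (B t) k l * rlv (u t) l)).
    by apply: L2_L1 => //; apply: (@L2_rhs R a b _ (fun k l x => rlm (B x) k l) M mB bB (fun k x => rlv (u x) k) Lu).
  by apply/funext => t; rewrite rlvN rlv_mul.
have Fz k x : `[a, b] x -> rlv (F x) k = 0.
  apply: (@within_ae0 R a b (fun x => rlv (F x) k)) => //.
    have h : {within `[a, b], continuous (fun x => rlv (F a) k + prim (fun t => rlv (- (B t *m u t)) k) a x)}.
      by move=> y; apply: cvgD; [exact: cvg_cst|exact: prim_cont_within].
    by apply: (subspace_eq_continuous _ h) => y; rewrite inE => yab; rewrite [RHS]FE.
  by apply: aeS2 FA u0 => y h1 h2 yab; rewrite h1// h2// mulmx0 rlv0.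
by split; apply: rlv_inj => k; rewrite rlv0 Fz// /= in_itv/= lexx ltW.
Qed.

(** The functionals [cf], indexed by the set [S] of positive eigenvalues at [a] and negative ones at
    [b], are coordinates: [sol_exists] gives a dual family up to nonzero factors, and a solution on
    which they all vanish is 0 by [sol_uniq]. *)
Lemma dim_sol (K : (R -> 'cV[C]_r) -> Prop) :
  (forall u, K u <-> exists F, sol a b A B u F) ->
  dim_ae a b K (npos (A a) + nneg (A b))%N.
Proof.
move=> KE.
have ca : `[a, b] a by rewrite /= in_itv/= lexx ltW.
have cb : `[a, b] b by rewrite /= in_itv/= lexx ltW.
have [P [d [PPc PcP AaE]]] := hermitian_spectral (Aherm ca).
have [Q [e [QQc QcQ AbE]]] := hermitian_spectral (Aherm cb).
rewrite (count_eigvals PPc AaE).1 (count_eigvals QQc AbE).2.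
pose S := [pred s : 'I_r + 'I_r | match s with inl i => 0 < d i | inr i => e i < 0 end].
pose lam (s : 'I_r + 'I_r) := match s with inl i => d i | inr i => e i end.
pose cf (F : R -> 'cV[C]_r) (s : 'I_r + 'I_r) : C :=
  match s with inl i => (P *m F a) i 0 | inr i => (Q *m F b) i 0 end.
have lam0 s : s \in S -> Complex (lam s) 0 != 0 :> C.
  by case: s => i; rewrite inE/= eq_complex/= eqxx andbT => h; [rewrite gt_eqF|rewrite lt_eqF].
have cardS : #|S| = (#|[pred i | (0 < d i)%R]| + #|[pred i | (e i < 0)%R]|)%N.
  by rewrite -!sum1_card big_sumType/=.
rewrite -cardS => {cardS}.
(* Spanned by the eigenvectors of A(a) with eigenvalue >= 0; in particular it contains those with
   positive eigenvalue, against which F(a) is tested. [Nb] is the mirror image at [b]. *)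
pose Na (v : 'cV[C]_r) := forall i, d i < 0 -> (P *m v) i 0 = 0.
pose Nb (v : 'cV[C]_r) := forall i, 0 < e i -> (Q *m v) i 0 = 0.
have Naf v : Na v -> 0 <= Re ((ctr v *m A a *m v) 0 0).
  move=> Nv; rewrite -mulmxA (form_eigencoord PPc PcP AaE); apply: sumr_ge0 => i _.
  have [di|di] := ltP (d i) 0; first by rewrite Nv//= expr0n/= addr0 mulr0.
  by rewrite mulr_ge0// addr_ge0// sqr_ge0.
have Nbf v : Nb v -> Re ((ctr v *m A b *m v) 0 0) <= 0.
  move=> Nv; rewrite -mulmxA (form_eigencoord QQc QcQ AbE); apply: sumr_le0 => i _.
  have [ei|ei] := ltP 0 (e i); first by rewrite Nv//= expr0n/= addr0 mulr0.
  by rewrite mulr_le0_ge0// addr_ge0// sqr_ge0.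
have lin0 (N : 'M[C]_r) (p : pred 'I_r) : forall i, p i -> (N *m (0 : 'cV[C]_r)) i 0 = 0.
  by move=> i _; rewrite mulmx0 mxE.
have linD (N : 'M[C]_r) (p : pred 'I_r) (v w : 'cV[C]_r) c :
    (forall i, p i -> (N *m v) i 0 = 0) -> (forall i, p i -> (N *m w) i 0 = 0) ->
    forall i, p i -> (N *m (v + c *: w)) i 0 = 0.
  move=> hv hw i pi; rewrite mulmxDr -scalemxAr mxE hv// add0r mxE hw//.
  by rewrite mulr0.
(* The datum is the eigenvector of index [s] and it enters through A(a) or A(b); the coordinate
   obtained is therefore the eigenvalue [lam s] and not 1. *)
have /choice[E hE] (s : 'I_r + 'I_r) : exists uF : (R -> 'cV[C]_r) * (R -> 'cV[C]_r),
    sol a b A B uF.1 uF.2 /\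
    forall s', s' \in S -> cf uF.2 s' = (s' == s)%:R * Complex (lam s') 0.
  pose al : 'cV[C]_r := if s is inl i then ctr P *m delta_mx i 0 else 0.
  pose be : 'cV[C]_r := if s is inr i then ctr Q *m delta_mx i 0 else 0.
  have [u [F [solF Fa Fb]]] := sol_exists ab mAd bAd AE Aherm mB bB mu0_gt0 coercive
    al be (lin0 P (fun i => d i < 0)) (linD P (fun i => d i < 0)) (lin0 Q (fun i => 0 < e i)) (linD Q (fun i => 0 < e i)) Naf Nbf.
  exists (u, F); split=> // -[] i; rewrite inE/= => pi.
  - rewrite -(dot_eigenvector PPc PcP) Fa ?dot_eigenvector//; last first.
      move=> j dj; rewrite eigencoord_delta//; case: eqVneq => // ji.
      by move: dj; rewrite ji ltNge ltW.
    rewrite (eigencoord PPc AaE) mulrC; congr (_ * _); rewrite /al; case: (s) => j.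
      by rewrite eigencoord_delta.
    by rewrite mulmx0 mxE.
  - rewrite -(dot_eigenvector QQc QcQ) Fb ?dot_eigenvector//; last first.
      move=> j dj; rewrite eigencoord_delta//; case: eqVneq => // ji.
      by move: dj; rewrite ji ltNge ltW.
    rewrite (eigencoord QQc AbE) mulrC; congr (_ * _); rewrite /be; case: (s) => j.
      by rewrite mulmx0 mxE.
    by rewrite eigencoord_delta.
have cf_sum (c : 'I_r + 'I_r -> C) (t : 'I_r + 'I_r) : t \in S ->
    cf (fun x => \sum_(s in S) c s *: (E s).2 x) t = c t * Complex (lam t) 0.
  move=> tS; have -> : cf (fun x => \sum_(s in S) c s *: (E s).2 x) t =
      \sum_(s in S) c s * cf (E s).2 t.
    case: t {tS} => i /=; rewrite mulmx_sumr summxE; apply: eq_bigr => s _;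
      by rewrite -scalemxAr mxE.
  rewrite (bigD1 t)//= big1 ?addr0 => [|s /andP[sS st]]; rewrite (hE _).2// ?eqxx ?mul1r//.
  by rewrite eq_sym (negbTE st) mul0r mulr0.
have sumE (V : nmodType) (G : 'I_r + 'I_r -> V) :
  \sum_(j < #|S|) G (enum_val j) = \sum_(s in S) G s by rewrite -big_enum_val.
exists (fun j => (E (enum_val j)).1); split; last split.
- by move=> j; apply/KE; exists (E (enum_val j)).2; exact: (hE _).1.
- move=> c hc j.
  (* Re-indexes the coefficients from ordinals to elements of [S]. The rank requires a proof of
     membership; the default 0 lies outside [S] and never enters the sums. *)
  pose c' s := if @idP (s \in S) is ReflectT h then c (enum_rank_in h s) else 0.
  have c'E i : c' (enum_val i) = c i.
    rewrite /c'; case: {-}_ / idP => [h|]; last by case; exact: enum_valP.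
    by rewrite enum_valK_in.
  have solc := sol_sum mB bB (index_enum _) (P := mem S) c' (fun i _ => (hE i).1).
  have [|Fa Fb] := sol_ends0 solc.
    apply: aeS hc => x h xab; rewrite -[RHS](h xab) -sumE; apply: eq_bigr => i _.
    by rewrite c'E.
  have := cf_sum c' _ (enum_valP j); rewrite c'E.
  have -> : cf (fun x => \sum_(s in S) c' s *: (E s).2 x) (enum_val j) = 0.
    by case: (enum_val j) => i /=; rewrite ?Fa ?Fb mulmx0 mxE.
  by move/esym/eqP; rewrite mulf_eq0 (negbTE (lam0 _ (enum_valP j))) orbF => /eqP.
- move=> u /KE [F solF].
  (* Division by the eigenvalue makes the combination share all coordinates of [F], so that the
     difference has coordinates 0 on [S]. *)
  pose c s := cf F s / Complex (lam s) 0.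
  exists (fun j => c (enum_val j)).
  have solc := sol_sum mB bB (index_enum _) (P := mem S) c (fun i _ => (hE i).1).
  have solD := sol_lin mB bB (-1) solF solc.
  set u' := fun x => _ in solD; set F' := fun x => _ in solD.
  have cf0 (t : 'I_r + 'I_r) : t \in S -> cf F' t = 0.
    move=> tS; have -> : cf F' t = cf F t - cf (fun x => \sum_(s in S) c s *: (E s).2 x) t.
      by case: t {tS} => i /=; rewrite /F' scaleN1r mulmxBr mxE [in X in _ + X]mxE.
    by rewrite cf_sum// divfK ?subrr// lam0.
  have [|xia [Fa Fa0]] := @trace_preimage R r (A a) P d PPc PcP AaE (F' a).
    move=> i di; rewrite -(dot_eigenvector PPc PcP).
    apply: (sol_trace ab mAd bAd AE Aherm mB bB solD); rewrite ?eqxx//.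
    exact: (kernel_eigenvector PPc PcP AaE).
  have [|xib [Fb Fb0]] := @trace_preimage R r (A b) Q e QQc QcQ AbE (F' b).
    move=> i di; rewrite -(dot_eigenvector QQc QcQ).
    apply: (sol_trace ab mAd bAd AE Aherm mB bB solD); rewrite ?eqxx ?orbT//.
    exact: (kernel_eigenvector QQc QcQ AbE).
  (* The coordinates at positive eigenvalues vanish, so only terms with d_i <= 0 remain in the form
     of the pseudo-inverse; the case d_i = 0 contributes 0 since 0^-1 = 0. The signs are reversed at
     [b]. *)
  have qa : Re ((ctr xia *m F' a) 0 0) <= 0.
    rewrite Fa0; apply: sumr_le0 => i _; have [di|di] := ltP 0 (d i).
      by rewrite [(P *m F' a) i 0](cf0 (inl i) di)/= expr0n/= addr0 mulr0.
    by rewrite mulr_le0_ge0 ?invr_le0// addr_ge0// sqr_ge0.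
  have qb : 0 <= Re ((ctr xib *m F' b) 0 0).
    rewrite Fb0; apply: sumr_ge0 => i _; have [di|di] := ltP (e i) 0.
      by rewrite [(Q *m F' b) i 0](cf0 (inr i) di)/= expr0n/= addr0 mulr0.
    by rewrite mulr_ge0 ?invr_ge0// addr_ge0// sqr_ge0.
  have h := sol_uniq ab mAd bAd AE Aherm mB bB mu0_gt0 coercive solD Fa qa Fb qb.
  apply: aeS h => x h xab; have := h xab; rewrite /u' scaleN1r => /eqP.
  rewrite subr_eq0 => /eqP ->.
  by rewrite -sumE.
Qed.

End Dimension.

(** * Weak derivatives and their continuous representatives *)

Section WeakDerivative.
Context {R : realType}.
Local Notation C := R[i].
Local Notation Re := complex.Re.
Local Notation Im := complex.Im.
Local Notation mu := (@lebesgue_measure R).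
Implicit Types (x y t : R).

Lemma normc_le (z : C) (K : R) : `|z| <= Complex K 0 -> `|Re z| <= K /\ `|Im z| <= K.
Proof.
rewrite normc_def lecR => h; rewrite -!sqrtr_sqr; split; apply: le_trans h; apply: ler_wsqrtr.
  by rewrite lerDl sqr_ge0.
by rewrite lerDr sqr_ge0.
Qed.

Lemma prim_ae a b (g h : R -> R) x : L1 `]a, b[ g -> L1 `]a, b[ h -> x <= b ->
  {ae mu, forall t, `]a, b[ t -> g t = h t} -> prim g a x = prim h a x.
Proof.
move=> Lg Lh xb gh; have sub t : `]a, x[ t -> `]a, b[ t.
  by rewrite /= !in_itv/= => /andP[-> tx]; rewrite (lt_le_trans tx).
apply: Rint_ae => //; [|by apply: L1_meas; exact: L1_oo Lh|].
  by apply: L1_meas; exact: L1_oo Lg.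
by apply: aeS gh => t h1 /sub.
Qed.

Lemma primN a b (g : R -> R) x : L1 `]a, b[ g -> x <= b ->
  prim (fun t => - g t) a x = - prim g a x.
Proof.
move=> Lg xb; have Lx : L1 `]a, x[ g by exact: L1_oo Lg.
rewrite -mulN1r /prim -(RintegralZl _ (moo a x) Lx).
by apply: eq_Rintegral => t _; rewrite mulN1r.
Qed.

Lemma rweak_derivP a b (f g : R -> R) : a < b -> L1 `]a, b[ f -> L1 `]a, b[ g ->
  rweak_deriv a b f g <->
  exists c, {ae mu, forall x, `]a, b[ x -> f x = c + prim g a x}.
Proof.
move=> ab Lf Lg.
have LM h k : L1 `]a, b[ h -> continuous k -> L1 `]a, b[ (fun x => h x * k x).
  move=> Lh ck; have [K _ hK] := cont_bdd_ae a b ck.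
  have := L1_bdd (moo a b) Lh (cont_mblfun (moo a b) ck) hK.
  by congr L1; apply/funext => x; rewrite mulrC.
have E phi : test_fun a b phi ->
    (\int[mu]_(x in `]a, b[) (f x * derive1 phi x)%:E = - \int[mu]_(x in `]a, b[) (g x * phi x)%:E)%E <->
    \int[mu]_(x in `]a, b[) (f x * derive1 phi x) = - \int[mu]_(x in `]a, b[) (g x * phi x).
  move=> /test_C1 pC; rewrite -!(EFin_Rint (moo a b)); last 2 first.
  - by apply: LM => //; exact: C1_cont pC.
  - by apply: LM => //; exact: pC.2.
  by rewrite -EFinN; split => [[]|->].
split=> [h|[c hc] phi tphi].
  by apply: weak_deriv_prim => // phi tphi; apply/E => //; exact: h.
apply/E => //; have pC := test_C1 tphi.
have := IBP c ab Lg pC; case: tphi => _ [c' [d' [ac [db z]]]].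
rewrite (z a); last by left.
rewrite (z b); last by right.
rewrite !mulr0 subr0 => /eqP; rewrite addrC addr_eq0 => /eqP <-.
have Lp := prim_L2 c Lg ab.
apply: Rint_ae => //.
- by apply: L1_meas; apply: LM => //; exact: pC.2.
- by apply: L1_meas; apply: LM; [exact: L2_L1|exact: pC.2].
by apply: aeS hc => x h xab; rewrite h.
Qed.

(** Provides the function [F] of a solution pair: a primitive of g on the closed interval in each
    real coordinate, equal to f almost everywhere. *)
Lemma weak_derivP a b r (f g : R -> 'cV[C]_r) : a < b ->
  (forall k, L1 `]a, b[ (fun x => rlv (f x) k)) ->
  (forall k, L1 `]a, b[ (fun x => rlv (g x) k)) ->
  weak_deriv a b f g <-> exists F : R -> 'cV[C]_r,
    (forall k x, `[a, b] x -> rlv (F x) k = rlv (F a) k + prim (fun t => rlv (g t) k) a x) /\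
    {ae mu, forall x, `]a, b[ x -> F x = f x}.
Proof.
move=> ab Lf Lg.
have E : weak_deriv a b f g <-> forall k, rweak_deriv a b (fun x => rlv (f x) k) (fun x => rlv (g x) k).
  have El (w : R -> 'cV[C]_r) i : (fun x => rlv (w x) (lshift r i)) = fun x => Re (w x i 0).
    by apply/funext => x; rewrite rlv_l.
  have Er (w : R -> 'cV[C]_r) i : (fun x => rlv (w x) (rshift r i)) = fun x => Im (w x i 0).
    by apply/funext => x; rewrite rlv_r.
  split=> [h k|h i]; last by rewrite -!El -!Er.
  by rewrite -(splitK k); case: (fintype.split k) => i /=; rewrite ?El ?Er; case: (h i).
split=> [/E h|[F [FE Ff]]]; last first.
  apply/E => k; apply/rweak_derivP => //; exists (rlv (F a) k).
  apply: aeS Ff => x h xab; rewrite -h// FE//; exact: subset_itv_oo_cc xab.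
have /choice[c hc] k : exists c, {ae mu, forall x, `]a, b[ x -> rlv (f x) k = c + prim (fun t => rlv (g t) k) a x}.
  by apply/rweak_derivP.
pose F x : 'cV[C]_r := cpx (fun k => c k + prim (fun t => rlv (g t) k) a x).
exists F; split.
  by move=> k x _; rewrite !cpxK prim0 addr0.
apply: aeS (ae_all hc) => x hx xab; apply: rlv_inj => k.
by rewrite cpxK hx.
Qed.

Lemma weak_derivN a b r (f g : R -> 'cV[C]_r) : a < b ->
  (forall k, L1 `]a, b[ (fun x => rlv (f x) k)) ->
  (forall k, L1 `]a, b[ (fun x => rlv (g x) k)) ->
  weak_deriv a b f g -> weak_deriv a b (fun x => - f x) (fun x => - g x).
Proof.
move=> ab Lf Lg /(weak_derivP ab Lf Lg)[F [FE Ff]].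
have LN (w : R -> 'cV[C]_r) : (forall k, L1 `]a, b[ (fun x => rlv (w x) k)) ->
    forall k, L1 `]a, b[ (fun x => rlv (- w x) k).
  move=> Lw k; rewrite (_ : (fun x => _) = fun x => - rlv (w x) k); first exact: L1N.
  by apply/funext => x; rewrite rlvN.
apply/(weak_derivP ab (LN _ Lf) (LN _ Lg)); exists (fun x => - F x); split.
  move=> k x xab; rewrite !rlvN FE// opprD; congr (_ + _).
  rewrite -(primN (Lg k)); last by move: xab; rewrite /= in_itv/= => /andP[].
  by congr prim; apply/funext => t; rewrite rlvN.
by apply: aeS Ff => x h xab; rewrite h.
Qed.

Lemma L2onP a b r (u : R -> 'cV[C]_r) : L2on a b u <-> forall k, L2 `]a, b[ (fun x => rlv (u x) k).
Proof.
have El i : (fun x => rlv (u x) (lshift r i)) = fun x => Re (u x i 0).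
  by apply/funext => x; rewrite rlv_l.
have Er i : (fun x => rlv (u x) (rshift r i)) = fun x => Im (u x i 0).
  by apply/funext => x; rewrite rlv_r.
have sE : (fun x => sqnormv (u x)) = fun x => \sum_k rlv (u x) k ^+ 2.
  by apply/funext => x; rewrite sqnormv_rlv.
split=> [[mu_ Iu] k|Lu].
  have mk l : mblfun `]a, b[ (fun x => rlv (u x) l).
    by rewrite -(splitK l); case: (fintype.split l) => i /=; rewrite ?El ?Er; case: (mu_ i).
  split=> //; have Ls : L1 `]a, b[ (fun x => sqnormv (u x)).
    apply/integrableP; split.
      apply/measurable_EFinP; rewrite sE; apply: measurable_sum => l.
      exact: measurable_funX.
    apply: le_lt_trans Iu; rewrite le_eqVlt; apply/orP; left; apply/eqP.
    apply: eq_integral => x _ /=; rewrite ger0_norm// sqnormv_rlv.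
    by apply: sumr_ge0 => l _; exact: sqr_ge0.
  apply: (L1_dom (moo a b) _ Ls); first exact: measurable_funX.
  apply: aeT => x _; rewrite ger0_norm ?sqr_ge0// sqnormv_rlv (bigD1 k)//= lerDl.
  by apply: sumr_ge0 => l _; exact: sqr_ge0.
split=> [i|].
  by split; [rewrite -El|rewrite -Er]; exact: L2_meas.
have : L1 `]a, b[ (fun x => sqnormv (u x)).
  by rewrite sE; apply: L1_sum => // k _; case: (Lu k).
move=> /integrableP[_]; apply: le_lt_trans; rewrite le_eqVlt; apply/orP; left; apply/eqP.
apply: eq_integral => x _ /=; rewrite ger0_norm// sqnormv_rlv.
by apply: sumr_ge0 => l _; exact: sqr_ge0.
Qed.

End WeakDerivative.

(** * The two kernels as solution spaces *)

Section Kernels.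
Context {R : realType}.
Local Notation C := R[i].
Local Notation mu := (@lebesgue_measure R).
Implicit Types (x y t : R).
Variables (a b : R) (r : nat) (A Ad B : R -> 'M[C]_r) (L M : R).
Hypothesis ab : a < b.
Hypothesis mAd : forall k l, mblfun `]a, b[ (fun x => rlm (Ad x) k l).
Hypothesis bAd : forall k l, {ae mu, forall x, `]a, b[ x -> `|rlm (Ad x) k l| <= L}.
Hypothesis AE : forall k l x, `[a, b] x ->
  rlm (A x) k l = rlm (A a) k l + prim (fun t => rlm (Ad t) k l) a x.

Lemma L1_coef u : (forall k, L2 `]a, b[ (fun x => rlv (u x) k)) ->
  forall k, L1 `]a, b[ (fun x => rlv (A x *m u x) k).
Proof.
move=> Lu k; rewrite (_ : (fun x => _) = fun x => \sum_l rlm (A x) k l * rlv (u x) l); last first.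
  by apply/funext => x; rewrite rlv_mul.
apply: L1_sum => // l _; apply: L2_L1 => //.
exact: (@L2_coefA R a b _ (fun k l x => rlm (A x) k l) (fun k l x => rlm (Ad x) k l)
  (fun k l => rlm (A a) k l) L ab mAd bAd AE k l _ (Lu l)).
Qed.

(** The weak derivative g equals - B u a.e., so the two have the same primitive. Conversely - B u
    itself serves as g, being in L^2 because B is bounded. *)
Lemma ker_T1_sol u : (forall k l, mblfun `]a, b[ (fun x => rlm (B x) k l)) ->
  (forall k l, {ae mu, forall x, `]a, b[ x -> `|rlm (B x) k l| <= M}) ->
  ker_T1 a b A B u <-> exists F, sol a b A B u F.
Proof.
move=> mB bB.
have Lrhs : (forall k, L2 `]a, b[ (fun x => rlv (u x) k)) ->
    forall k, L2 `]a, b[ (fun t => rlv (- (B t *m u t)) k).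
  move=> Lu k; rewrite (_ : (fun t => _) = (fun t => - \sum_l rlm (B t) k l * rlv (u t) l)).
    exact: (@L2_rhs R a b _ (fun k l x => rlm (B x) k l) M mB bB (fun k x => rlv (u x) k) Lu).
  by apply/funext => t; rewrite rlvN rlv_mul.
have L21 f : L2 `]a, b[ f -> L1 `]a, b[ f by exact: L2_L1.
split=> [[/L2onP Lu [g [/L2onP Lg [wd hg]]]]|[F [Lu FE FA]]].
  have [F [FE FA]] := (weak_derivP ab (L1_coef Lu) (fun k => L21 _ (Lg k))).1 wd.
  exists F; split=> // k x xab; rewrite FE//; congr (_ + _).
  apply: (@prim_ae _ a b); [exact/L21|exact/L21/Lrhs|by move: xab; rewrite /= in_itv/= => /andP[]|].
  apply: aeS hg => t h tab; congr (rlv _ k); apply/eqP; rewrite -subr_eq0 opprK.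
  by apply/eqP/h.
split; first exact/L2onP.
exists (fun x => - (B x *m u x)); split; first exact/L2onP/Lrhs.
split; last by apply: aeT => x _; rewrite addNr.
by apply/(weak_derivP ab (L1_coef Lu) (fun k => L21 _ (Lrhs Lu k))); exists F.
Qed.

(** Negating the weak derivative exchanges the two forms. The pointwise derivative [mderiv A] is
    replaced a.e. by [Ad], which carries the measurability and the bound. *)
Lemma ker_T1t_T1 u : {ae mu, forall x, `]a, b[ x -> mderiv A x = Ad x} ->
  ker_T1t a b A B u <-> ker_T1 a b (fun x => - A x) (fun x => ctr (B x) + Ad x) u.
Proof.
move=> dA.
have L21 f : L2 `]a, b[ f -> L1 `]a, b[ f by exact: L2_L1.
have LN (w : R -> 'cV[C]_r) : (forall k, L2 `]a, b[ (fun x => rlv (w x) k)) ->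
    forall k, L2 `]a, b[ (fun x => rlv (- w x) k).
  move=> Lw k; rewrite (_ : (fun x => _) = fun x => - rlv (w x) k); first exact: L2N.
  by apply/funext => x; rewrite rlvN.
have mulN : (fun x => - A x *m u x) = (fun x => - (A x *m u x)).
  by apply/funext => x; rewrite mulNmx.
split=> -[Lu [g [Lg [wd hg]]]]; split=> //; exists (fun x => - g x);
  (split; first by apply/L2onP/LN/L2onP); move/L2onP: Lu => Lu; move/L2onP : Lg => Lg.
  split; first by rewrite mulN; apply: weak_derivN => // k; [exact: L1_coef|exact: L21].
  by apply: aeS2 dA hg => x h1 h2 xab; rewrite -h1//; exact: h2.
rewrite mulN in wd; split.
  have := weak_derivN ab _ (fun k => L21 _ (Lg k)) wd.
  rewrite (_ : (fun x => - - _) = (fun x => A x *m u x)); last by apply/funext => x; rewrite opprK.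
  apply=> k; rewrite (_ : (fun x => _) = fun x => - rlv (A x *m u x) k).
    by apply: L1N; exact: L1_coef.
  by apply/funext => x; rewrite rlvN.
by apply: aeS2 dA hg => x h1 h2 xab; rewrite h1// opprK; exact: h2.
Qed.

End Kernels.

(** * Regularity of the coefficients *)

Section Coefficients.
Context {R : realType}.
Local Notation C := R[i].
Local Notation Re := complex.Re.
Local Notation Im := complex.Im.
Local Notation mu := (@lebesgue_measure R).
Implicit Types (x y t : R).

Lemma rlm_cases r (P : R -> Prop) (N : 'M[C]_r) k l : (forall s, P s -> P (- s)) ->
  (forall i j, P (Re (N i j)) /\ P (Im (N i j))) -> P (rlm N k l).
Proof.
move=> PN h; rewrite /rlm; case: (fintype.split k) => i; case: (fintype.split l) => j;
  by case: (h i j) => // ? ?; apply: PN.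
Qed.

Lemma rlm_mbl a b r (N : R -> 'M[C]_r) : (forall i j, cmeasurable a b (fun x => N x i j)) ->
  forall k l, mblfun `]a, b[ (fun x => rlm (N x) k l).
Proof.
move=> mN k l; rewrite /rlm; case: (fintype.split k) => i; case: (fintype.split l) => j;
  case: (mN i j) => // ? ?; exact: measurableT_comp.
Qed.

Lemma lipschitz_matrix (a b : R) r (A : R -> 'M[C]_r) (L : R) : a < b ->
  (forall x y, `[a, b] x -> `[a, b] y ->
     forall i j, `|A x i j - A y i j| <= Complex (L * `|x - y|) 0) ->
  exists Ad : R -> 'M[C]_r,
   [/\ forall k l, mblfun `]a, b[ (fun x => rlm (Ad x) k l),
    forall k l, {ae mu, forall x, `]a, b[ x -> `|rlm (Ad x) k l| <= L},
    forall k l x, `[a, b] x ->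
      rlm (A x) k l = rlm (A a) k l + prim (fun t => rlm (Ad t) k l) a x &
    {ae mu, forall x, `]a, b[ x -> mderiv A x = Ad x}].
Proof.
move=> ab AL.
have AL' x y i j : `[a, b] x -> `[a, b] y ->
    `|Re (A x i j) - Re (A y i j)| <= L * `|x - y| /\ `|Im (A x i j) - Im (A y i j)| <= L * `|x - y|.
  by move=> xab yab; have := normc_le (AL x y xab yab i j); rewrite !raddfB.
have /choice[gR hR] (p : 'I_r * 'I_r) := lipschitz_prim ab (f := fun x => Re (A x p.1 p.2))
  (fun x y xab yab => (AL' x y p.1 p.2 xab yab).1).
have /choice[gI hI] (p : 'I_r * 'I_r) := lipschitz_prim ab (f := fun x => Im (A x p.1 p.2))
  (fun x y xab yab => (AL' x y p.1 p.2 xab yab).2).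
pose Ad x : 'M[C]_r := \matrix_(i, j) Complex (gR (i, j) x) (gI (i, j) x).
exists Ad; split.
- apply: rlm_mbl => i j; have [mR _ _ _] := hR (i, j); have [mI _ _ _] := hI (i, j).
  split; first by move: mR; apply: eq_measurable_fun => x _; rewrite mxE.
  by move: mI; apply: eq_measurable_fun => x _; rewrite mxE.
- move=> k l; have bR : {ae mu, forall x, forall p, `]a, b[ x -> `|gR p x| <= L}.
    by apply: ae_all => p; case: (hR p).
  have bI : {ae mu, forall x, forall p, `]a, b[ x -> `|gI p x| <= L}.
    by apply: ae_all => p; case: (hI p).
  apply: aeS2 bR bI => x h1 h2 xab.
  apply: (@rlm_cases r (fun s => `|s| <= L)) => [s|i j]; first by rewrite normrN.
  by rewrite !mxE/=; split; [exact: h1|exact: h2].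
- move=> k l x xab; have xb : x <= b by move: xab; rewrite /= in_itv/= => /andP[].
  have LR p : L1 `]a, b[ (gR p).
    by case: (hR p) => mR bR _ _; apply: L2_L1 => //; apply: L2_bounded bR.
  have LI p : L1 `]a, b[ (gI p).
    by case: (hI p) => mR bR _ _; apply: L2_L1 => //; apply: L2_bounded bR.
  have ER i j : (fun t => Re (Ad t i j)) = gR (i, j) by apply/funext => t; rewrite mxE.
  have EI i j : (fun t => Im (Ad t i j)) = gI (i, j) by apply/funext => t; rewrite mxE.
  have ENI i j : prim (fun t => - Im (Ad t i j)) a x = - prim (gI (i, j)) a x.
    by rewrite -(primN (LI _) xb); congr prim; apply/funext => t; rewrite mxE.
  rewrite /rlm; case: (fintype.split k) => i; case: (fintype.split l) => j.
  + by rewrite ER; case: (hR (i, j)) => _ _ ->.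
  + by rewrite ENI -opprD; congr (- _); case: (hI (i, j)) => _ _ ->.
  + by rewrite EI; case: (hI (i, j)) => _ _ ->.
  + by rewrite ER; case: (hR (i, j)) => _ _ ->.
- have dR : {ae mu, forall x, forall p, `]a, b[ x -> derive1 (fun t => Re (A t p.1 p.2)) x = gR p x}.
    by apply: ae_all => p; case: (hR p).
  have dI : {ae mu, forall x, forall p, `]a, b[ x -> derive1 (fun t => Im (A t p.1 p.2)) x = gI p x}.
    by apply: ae_all => p; case: (hI p).
  apply: aeS2 dR dI => x h1 h2 xab; apply/matrixP => i j; rewrite !mxE.
  by rewrite -(h1 (i, j) xab) -(h2 (i, j) xab).
Qed.

Lemma Re_form_ctr r (N : 'M[C]_r) (v : 'cV[C]_r) :
  Re ((ctr v *m ctr N *m v) 0 0) = Re ((ctr v *m N *m v) 0 0).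
Proof.
have -> : ctr v *m ctr N *m v = ctr (ctr v *m N *m v) by rewrite !ctrM ctrK mulmxA.
by rewrite !mxE conjE.
Qed.

End Coefficients.

(** * The dimension formulas *)

Theorem theorem4p2 (R : realType) (a b : R) (r : nat)
    (A B : R -> 'M[R[i]]_r) (mu0 : R) :
  a < b ->
  (* A is (the Lipschitz representative on [a,b] of) a W^{1,oo} function *)
  (exists L : R, forall x y : R, `[a, b] x -> `[a, b] y ->
     forall i j, `|A x i j - A y i j| <= Complex (L * `|x - y|) 0) ->
  (* A(x) is Hermitian *)
  (forall x : R, `[a, b] x -> ctr (A x) = A x) ->
  (* B in L^oo *)
  (forall i j, cmeasurable a b (fun x => B x i j)) ->
  (exists M : R, {ae @lebesgue_measure R, forall x, `]a, b[ x ->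
      forall i j, `|B x i j| <= Complex M 0}) ->
  (* B + B^* + A' >= 2 mu0 1 a.e. *)
  0 < mu0 ->
  {ae @lebesgue_measure R, forall x, `]a, b[ x ->
     forall v : 'cV[R[i]]_r,
       0 <= (ctr v *m (B x + ctr (B x) + mderiv A x
                        - (Complex (2 * mu0) 0)%:M) *m v) 0 0} ->
  dim_ae a b (ker_T1 a b A B) (npos (A a) + nneg (A b))%N /\
  dim_ae a b (ker_T1t a b A B) (nneg (A a) + npos (A b))%N.
Proof.
move=> ab [L AL] Aherm mB [M bB] mu0_gt0 coer.
have [Ad [mAd bAd AE dA]] := lipschitz_matrix ab AL.
have ca : `[a, b] a by rewrite /= in_itv/= lexx ltW.
have cb : `[a, b] b by rewrite /= in_itv/= lexx ltW.
have coercive : {ae @lebesgue_measure R, forall x, `]a, b[ x -> forall v : 'cV[R[i]]_r,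
    2 * mu0 * sqnormv v <= complex.Re ((ctr v *m (B x + ctr (B x) + Ad x) *m v) 0 0)}.
  apply: aeS2 dA coer => x h1 h2 xab v; have := h2 xab v; rewrite h1// lecE => /andP[_].
  set X := B x + _ + _; rewrite mulmxBr mulmxBl mxE [X in _ + X]mxE raddfB/=.
  rewrite mul_mx_scalar -scalemxAl [X in _ - X](_ : _ = 2 * mu0 * sqnormv v) ?subr_ge0//.
  rewrite mxE ReM/= mul0r subr0 -rlv_dot sqnormv_rlv.
  by congr (_ * _); apply: eq_bigr => k _; rewrite expr2.
have mB' := rlm_mbl mB.
have bB' k l : {ae @lebesgue_measure R, forall x, `]a, b[ x -> `|rlm (B x) k l| <= M}.
  apply: aeS bB => x h xab; apply: (@rlm_cases R r (fun s => `|s| <= M)) => [s|i j].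
    by rewrite normrN.
  exact/normc_le/h.
split.
  apply: (dim_sol ab mAd bAd AE Aherm mB' bB' mu0_gt0 coercive) => u.
  exact: (ker_T1_sol ab mAd bAd AE u mB' bB').
have rlmN (N : 'M[R[i]]_r) k l : rlm (- N) k l = - rlm N k l.
  by rewrite /rlm; case: (fintype.split k) => i; case: (fintype.split l) => j; rewrite mxE raddfN.
(* From here on the hypotheses of [dim_sol] are checked for the pair - A, B^* + A', whose solution
   space is the second kernel. *)
pose B2 x := ctr (B x) + Ad x.
have mAN k l : mblfun `]a, b[ (fun x => rlm (- Ad x) k l).
  by apply: eq_measurable_fun (measurable_funN (mAd k l)) => x _; rewrite rlmN.
have bAN k l : {ae @lebesgue_measure R, forall x, `]a, b[ x -> `|rlm (- Ad x) k l| <= L}.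
  by apply: aeS (bAd k l) => x h xab; rewrite rlmN normrN; exact: h.
have LAd k l : L1 `]a, b[ (fun x => rlm (Ad x) k l).
  by apply: L2_L1 => //; apply: L2_bounded (bAd k l).
have AEN k l x : `[a, b] x ->
    rlm (- A x) k l = rlm (- A a) k l + prim (fun t => rlm (- Ad t) k l) a x.
  move=> xab; rewrite !rlmN AE// opprD; congr (_ + _).
  rewrite -(primN (LAd k l)); last by move: xab; rewrite /= in_itv/= => /andP[].
  by congr prim; apply/funext => t; rewrite rlmN.
have AN x : `[a, b] x -> ctr (- A x) = - A x.
  by move=> xab; rewrite -[in RHS]Aherm//; apply/matrixP => i j; rewrite !mxE rmorphN.
have mB2 k l : mblfun `]a, b[ (fun x => rlm (B2 x) k l).
  by apply: eq_measurable_fun (measurable_funD (mB' l k) (mAd k l)) => x _; rewrite rlmD rlm_ctr.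
have bB2 k l : {ae @lebesgue_measure R, forall x, `]a, b[ x -> `|rlm (B2 x) k l| <= M + L}.
  apply: aeS2 (bB' l k) (bAd k l) => x h1 h2 xab; rewrite rlmD rlm_ctr.
  by apply: le_trans (ler_normD _ _) _; rewrite lerD ?h1 ?h2.
(* A matrix and its adjoint have the same real quadratic form, so B2 + B2^* - A' and B + B^* + A'
   define the same one, and the constant [mu0] is unchanged. *)
have coer2 : {ae @lebesgue_measure R, forall x, `]a, b[ x -> forall v : 'cV[R[i]]_r,
    2 * mu0 * sqnormv v <= complex.Re ((ctr v *m (B2 x + ctr (B2 x) - Ad x) *m v) 0 0)}.
  apply: aeS coercive => x h xab v; apply: le_trans (h xab v) _.
  have Q (X Y : 'M[R[i]]_r) : complex.Re ((ctr v *m (X + Y) *m v) 0 0) =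
      complex.Re ((ctr v *m X *m v) 0 0) + complex.Re ((ctr v *m Y *m v) 0 0).
    by rewrite mulmxDr mulmxDl mxE raddfD.
  have QN (X : 'M[R[i]]_r) : complex.Re ((ctr v *m (- X) *m v) 0 0) = - complex.Re ((ctr v *m X *m v) 0 0).
    by rewrite mulmxN mulNmx mxE raddfN.
  rewrite (Q _ (Ad x)) (Q _ (ctr (B x))) Re_form_ctr.
  rewrite (Q _ (- Ad x)) QN (Q _ (ctr (B2 x))) (Re_form_ctr (B2 x)) (Q _ (Ad x)) Re_form_ctr.
  by rewrite le_eqVlt; apply/orP; left; apply/eqP; ring.
(* Changing the sign of A exchanges positive and negative eigenvalues at both ends. *)
have [<- _] := count_eigvalsN (Aherm a ca); have [_ <-] := count_eigvalsN (Aherm b cb).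
apply: (dim_sol (A := fun x => - A x) ab mAN bAN AEN AN mB2 bB2 mu0_gt0 coer2) => u.
exact: (iff_trans (ker_T1t_T1 B ab mAd bAd AE u dA)
  (ker_T1_sol (A := fun x => - A x) ab mAN bAN AEN u mB2 bB2)).
Qed.
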